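(* Let $(M,\omega)$ be a closed symplectic manifold of dimension $2n$, and let $\mathcal{AM}$ be the space of smooth associated metrics on $M$ with the weak Riemannian structure $(a,b)_g=\int_M\mathrm{tr}(AB)\,d\mu$. Then $\mathcal{AM}$ has the following geometric characteristics. 1) The curvature tensor is $R(a,b)c=-\frac14\,g\,[[A,B],C]$ for $a,b,c\in T_g\mathcal{AM}$. 2) The sectional curvature in the plane section $\sigma$ given by an orthonormal pair $a,b\in T_g\mathcal{AM}$ is $$K_\sigma=\frac14\int_M\mathrm{tr}\big([A,B]^2\big)\,d\mu .$$ In particular, the holomorphic sectional curvature (for $a$ of unit length) is $$K(a,\mathbf Ja)=-\int_M\mathrm{tr}(A^4)\,d\mu .$$ 3) The geodesic going out from $g\in\mathcal{AM}$ in direction $a\in T_g\mathcal{AM}$ is $g_t=g\,e^{tA}$.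
   Context: An almost complex structure $J$ on $M$ is positive associated if $\omega(JX,JY)=\omega(X,Y)$ and $\omega(X,JX)>0$ for $X\neq0$; its associated metric is $g(X,Y)=\omega(X,JY)$. $\mathcal{AM}$ is the (infinite-dimensional ILH) manifold of all smooth associated metrics; $T_g\mathcal{AM}$ consists of smooth symmetric 2-forms $h$ with $h(JX,JY)=-h(X,Y)$; $\mu=\frac1{n!}\omega^n$ is the common Riemannian volume form. For $a,b,c\in T_g\mathcal{AM}$: $A=g^{-1}a$, $B=g^{-1}b$, $C=g^{-1}c$ (raising the first index); $[A,B]=AB-BA$; $gE$ is the 2-form $g_{ik}E^k_j$. The almost complex structure on $\mathcal{AM}$ is $(\mathbf Ja)(X,Y)=a(X,JY)$. Curvature and geodesics are those of the torsion-free connection compatible with the weak metric (on $\mathcal{AM}$ this is the restriction of $\nabla_ab=d_ab-\frac12(aB+bA)$, $d$ the directional derivative in the space of symmetric 2-forms), with $R(a,b)c=\nabla_a\nabla_bc-\nabla_b\nabla_ac-\nabla_{[a,b]}c$ and sectional curvature $(R(a,b)b,a)_g$ for orthonormal $a,b$. *)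

(* Defs.v *)
From HB Require Import structures.
From mathcomp Require Import all_boot all_order all_fingroup all_algebra.
From mathcomp Require Import all_classical all_reals all_analysis.

Set Implicit Arguments.
Unset Strict Implicit.
Unset Printing Implicit Defensive.

Import Order.TTheory GRing.Theory Num.Theory.
Import numFieldNormedType.Exports.

Local Open Scope classical_set_scope.
Local Open Scope ring_scope.

(** * Smooth functions on open subsets of R^m *)

Section SmoothFunctions.
Variables (R : realType) (m : nat).

Definition partial (l : 'I_m) (f : 'cV[R]_m -> R) : 'cV[R]_m -> R :=
  fun u => 'D_(delta_mx l 0) f u.

Definition ipartial (s : seq 'I_m) (f : 'cV[R]_m -> R) : 'cV[R]_m -> R :=
  foldr partial f s.

Definition smooth_on (U : set 'cV[R]_m) (f : 'cV[R]_m -> R) : Prop :=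
  forall (s : seq 'I_m) (u : 'cV[R]_m), U u ->
    {for u, continuous (ipartial s f)} /\
    forall l : 'I_m, derivable (ipartial s f) u (delta_mx l 0).

End SmoothFunctions.

(* The Lebesgue integral over R^m of a nonnegative Borel function, as an
   iterated integral (Tonelli). *)
Fixpoint lebint (R : realType) (m : nat) : ('cV[R]_m -> \bar R) -> \bar R :=
  match m return ('cV[R]_m -> \bar R) -> \bar R with
  | 0 => fun f => f 0
  | m'.+1 => fun f =>
      (\int[lebesgue_measure]_t
         lebint (fun v : 'cV[R]_m' => f (col_mx (t%:M : 'cV[R]_1) v)))%E
  end.

Section Expm.
Variables (R : realType) (m : nat).

Definition expm (A : 'M[R]_m) : 'M[R]_m :=
  limn (series (fun k : nat => (k`!%:R)^-1 *: A ^+ k)).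

Definition commx (A B : 'M[R]_m) : 'M[R]_m := A *m B - B *m A.

End Expm.

(** * Closed manifolds *)

(* The atlas is indexed by the points of M: [chart_at x] is a distinguished
   chart around x, with domain [dom x], coordinate map [coord x] and inverse
   [icoord x].  T_x M is identified with R^m through the coordinate frame of
   the distinguished chart at x. *)
Record closed_manifold (R : realType) (m : nat) (M : ptopologicalType) := {
  dom : M -> set M;
  coord : M -> M -> 'cV[R]_m;
  icoord : M -> 'cV[R]_m -> M;
  man_hausdorff : hausdorff_space M;
  man_compact : compact [set: M];
  dom_open : forall x, open (dom x);
  dom_self : forall x, dom x x;
  coord_open : forall x, open (coord x @` dom x);
  coordK : forall x y, dom x y -> icoord x (coord x y) = y;
  coord_continuous : forall x y, dom x y -> {for y, continuous (coord x)};
  icoord_continuous : forall x u, (coord x @` dom x) u ->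
    {for u, continuous (icoord x)};
  transition_smooth : forall x y (k : 'I_m),
    smooth_on (coord x @` (dom x `&` dom y))
      (fun u => coord y (icoord x u) k 0)
}.

Section Tensors.
Variables (R : realType) (m : nat) (M : ptopologicalType).
Variable S : closed_manifold R m M.

(* A covariant 2-tensor or an endomorphism of the tangent bundle: its matrix
   at x in the distinguished frame of T_x M, with t(X, Y) = X^T *m t x *m Y
   in the first case and X |-> t x *m X in the second. *)
Definition tfield : Type := M -> 'M[R]_m.

(* The frame of the chart [i] at [icoord S i u], in the distinguished frame. *)
Definition frame (i : M) (u : 'cV[R]_m) : 'M[R]_m :=
  \matrix_(k, l)
    partial l (fun v => coord S (icoord S i u) (icoord S i v) k 0) u.

Definition comp02 (i : M) (t : tfield) (u : 'cV[R]_m) : 'M[R]_m :=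
  (frame i u)^T *m t (icoord S i u) *m frame i u.

Definition comp11 (i : M) (t : tfield) (u : 'cV[R]_m) : 'M[R]_m :=
  invmx (frame i u) *m t (icoord S i u) *m frame i u.

(* A family of covariant 2-tensor fields with parameters in an open subset D
   of R^k that is smooth jointly in the parameter and the point. *)
Definition smooth_family (k : nat) (D : set 'cV[R]_k)
    (p : 'cV[R]_k -> tfield) : Prop :=
  forall (i : M) (q l : 'I_m),
    smooth_on [set w : 'cV[R]_(k + m) |
                 D (usubmx w) /\ (coord S i @` dom S i) (dsubmx w)]
      (fun w => comp02 i (p (usubmx w)) (dsubmx w) q l).

Definition smooth02 (t : tfield) : Prop :=
  forall (i : M) (q l : 'I_m),
    smooth_on (coord S i @` dom S i) (fun u => comp02 i t u q l).

Definition smooth11 (t : tfield) : Prop :=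
  forall (i : M) (q l : 'I_m),
    smooth_on (coord S i @` dom S i) (fun u => comp11 i t u q l).

Definition closed_form (t : tfield) : Prop :=
  forall (i : M) (u : 'cV[R]_m) (p q l : 'I_m), (coord S i @` dom S i) u ->
    partial p (fun v => comp02 i t v q l) u
    + partial q (fun v => comp02 i t v l p) u
    + partial l (fun v => comp02 i t v p q) u = 0.

Definition symplectic (w : tfield) : Prop :=
  [/\ smooth02 w,
      (forall x, (w x)^T = - w x),
      (forall x, w x \in unitmx) &
      closed_form w].

End Tensors.

(** * The volume measure of omega^n / n! *)

(* The coefficient of omega^n / n! on dx_1 /\ ... /\ dx_2n when omega has
   constant matrix W: the wedge power omega^n evaluated on the standard basis
   is 2^-n times the alternating sum over permutations. *)
Definition liouville_coef (R : realType) (n : nat) (W : 'M[R]_(n + n)) : R :=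
  (n`!%:R)^-1 * ((2 ^+ n)^-1 *
    \sum_(s : 'S_(n + n)) (-1) ^+ s *
      \prod_(p < n + n | ~~ odd p) \prod_(q < n + n | q == p.+1 :> nat)
        W (s p) (s q)).

Definition borel (M : ptopologicalType) := g_sigma_algebraType (@open M).

Section Volume.
Variables (R : realType) (n : nat) (M : ptopologicalType).
Variable S : closed_manifold R (n + n) M.
Variable w : tfield R (n + n) M.

Definition is_volume (mu : {measure set (borel M) -> \bar R}) : Prop :=
  forall (i : M) (B : set (borel M)), measurable B -> B `<=` dom S i ->
    mu B = lebint (fun u =>
      (\1_(coord S i @` B) u * `|liouville_coef (comp02 S i w u)|)%:E).

End Volume.

(** * The space of associated metrics *)

Section AssociatedMetrics.
Variables (R : realType) (m : nat) (M : ptopologicalType).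
Variable S : closed_manifold R m M.
Variable w : tfield R m M.
Variable mu : {measure set (borel M) -> \bar R}.

Local Notation tfield := (tfield R m M).
Implicit Types (g a b c h r : tfield).

Definition positive_associated (J : tfield) : Prop :=
  [/\ smooth11 S J,
      (forall x, J x *m J x = - 1%:M),
      (forall x (X Y : 'cV[R]_m),
         (J x *m X)^T *m w x *m (J x *m Y) = X^T *m w x *m Y) &
      (forall x (X : 'cV[R]_m), X != 0 ->
         0 < (X^T *m w x *m (J x *m X)) 0 0)].

Definition AM : set tfield :=
  [set g | smooth02 S g /\
     exists2 J, positive_associated J & forall x, g x = w x *m J x].

(* The J with g(X, Y) = w(X, J Y). *)
Definition acs g : tfield := fun x => invmx (w x) *m g x.

Definition tangent g : set tfield :=
  [set h | [/\ smooth02 S h,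
               (forall x, (h x)^T = h x) &
               (forall x (X Y : 'cV[R]_m),
                  (acs g x *m X)^T *m h x *m (acs g x *m Y)
                  = - (X^T *m h x *m Y))]].

Definition raise g a : tfield := fun x => invmx (g x) *m a x.

Definition inner g a b : R :=
  fine (\int[mu]_x (\tr (raise g a x *m raise g b x))%:E)%E.

(* The almost complex structure of AM. *)
Definition bfJ g a : tfield := fun x => a x *m acs g x.

(** Differential calculus on AM, as a submanifold of the Frechet space of
    smooth symmetric 2-forms: a map is smooth when it sends smooth finite
    dimensional families to smooth finite dimensional families. *)

Definition curve_in_AM (I : set R) (gam : R -> tfield) : Prop :=
  smooth_family S [set s : 'cV[R]_1 | I (s 0 0)] (fun s => gam (s 0 0))
  /\ forall t, I t -> AM (gam t).

Definition velocity (gam : R -> tfield) (t : R) : tfield :=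
  fun x => derive1 (fun s => gam s x) t.

Definition vector_field (X : tfield -> tfield) : Prop :=
  (forall g, AM g -> tangent g (X g)) /\
  forall (k : nat) (D : set 'cV[R]_k) (p : 'cV[R]_k -> tfield), open D ->
    smooth_family S D p -> (forall s, D s -> AM (p s)) ->
    smooth_family S D (X \o p).

(* Some smooth curve in AM representing the tangent vector a at g. *)
Definition along g a : R -> tfield :=
  xget (fun=> g) [set gam | [/\ curve_in_AM setT gam, gam 0 = g
                              & velocity gam 0 = a]].

(* d_a X at g, for X with values in the space of 2-forms *)
Definition ddir (X : tfield -> tfield) g a : tfield :=
  velocity (fun t => X (along g a t)) 0.

(* d_a f at g, for a real-valued f *)
Definition ddirR (f : tfield -> R) g a : R :=
  derive1 (fun t => f (along g a t)) 0.

Definition bracket (X Y : tfield -> tfield) : tfield -> tfield :=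
  fun g => ddir Y g (X g) - ddir X g (Y g).

(** Connections on AM.  A connection is written d + G, with d the flat
    directional derivative of the space of 2-forms and G g bilinear on the
    tangent space at g; it then acts on vector fields on AM as well as on
    fields along curves. *)

Definition Christoffel : Type := tfield -> tfield -> tfield -> tfield.

Definition nabla (G : Christoffel) (X Y : tfield -> tfield) : tfield -> tfield :=
  fun g => ddir Y g (X g) + G g (X g) (Y g).

Definition connection (G : Christoffel) : Prop :=
  [/\ (forall g a a' b (r : R), AM g -> tangent g a -> tangent g a' ->
         tangent g b ->
         G g (r *: a + a') b = r *: G g a b + G g a' b),
      (forall g a b b' (r : R), AM g -> tangent g a -> tangent g b ->
         tangent g b' ->
         G g a (r *: b + b') = r *: G g a b + G g a b'),
      (forall (k : nat) (D : set 'cV[R]_k) (p a b : 'cV[R]_k -> tfield),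
         open D -> smooth_family S D p -> smooth_family S D a ->
         smooth_family S D b ->
         (forall s, D s -> [/\ AM (p s), tangent (p s) (a s)
                             & tangent (p s) (b s)]) ->
         smooth_family S D (fun s => G (p s) (a s) (b s))) &
      (forall X Y g, vector_field X -> vector_field Y -> AM g ->
         tangent g (nabla G X Y g))].

Definition torsion_free (G : Christoffel) : Prop :=
  forall X Y g, vector_field X -> vector_field Y -> AM g ->
    nabla G X Y g - nabla G Y X g = bracket X Y g.

Definition metric_compatible (G : Christoffel) : Prop :=
  forall X Y Z g, vector_field X -> vector_field Y -> vector_field Z -> AM g ->
    ddirR (fun g' => inner g' (Y g') (Z g')) g (X g)
    = inner g (nabla G X Y g) (Z g) + inner g (Y g) (nabla G X Z g).

Definition levi_civita (G : Christoffel) : Prop :=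
  [/\ connection G, torsion_free G & metric_compatible G].

(* nabla_a b = d_a b - (a B + b A) / 2 *)
Definition levi_civita_Christoffel : Christoffel := fun g a b x =>
  - (2^-1 *: (a x *m raise g b x + b x *m raise g a x)).

Definition curvature (G : Christoffel) (X Y Z : tfield -> tfield) :
    tfield -> tfield :=
  nabla G X (nabla G Y Z) - nabla G Y (nabla G X Z)
  - nabla G (bracket X Y) Z.

Definition extends (X : tfield -> tfield) g a : Prop :=
  vector_field X /\ X g = a.

(* r is R(a, b)c for tangent vectors a, b, c at g: vector fields extending
   them exist, and all such vector fields give the value r at g. *)
Definition is_curvature (G : Christoffel) g a b c r : Prop :=
  (exists X Y Z, [/\ extends X g a, extends Y g b & extends Z g c]) /\
  forall X Y Z, extends X g a -> extends Y g b -> extends Z g c ->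
    curvature G X Y Z g = r.

Definition orthonormal_pair g a b : Prop :=
  [/\ inner g a a = 1, inner g b b = 1 & inner g a b = 0].

Definition is_sectional_curvature (G : Christoffel) g a b (K : R) : Prop :=
  [/\ tangent g a, tangent g b, orthonormal_pair g a b &
      exists2 r, is_curvature G g a b b r & K = inner g r a].

Definition geodesic (G : Christoffel) (I : set R) (gam : R -> tfield) : Prop :=
  curve_in_AM I gam /\
  forall t, I t ->
    velocity (velocity gam) t + G (gam t) (velocity gam t) (velocity gam t)
    = 0.

End AssociatedMetrics.

(* Main.v *)
Require Import Defs.
From HB Require Import structures.
From mathcomp Require Import all_boot all_order all_fingroup all_algebra.
From mathcomp Require Import all_classical all_reals all_analysis.
From mathcomp Require Import ring lra.
Set Implicit Arguments.
Unset Strict Implicit.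
Unset Printing Implicit Defensive.
Import Order.TTheory GRing.Theory Num.Theory.
Import numFieldNormedType.Exports.
Local Open Scope classical_set_scope.
Local Open Scope ring_scope.

(** The flat affine structure of the space of 2-forms carries the proof.  A map
    from AM to 2-forms is differentiated along curves, and for a smooth map the
    result only depends on the velocity ([ddirE]); second derivatives commute up
    to the bracket, as in an affine space ([ddir_flat]).  With a = gA and
    b = gB, the Christoffel form -(aB + bA)/2 does three things: it brings the
    derivative of a tangent field back into the tangent space ([ptan_nabla]),
    it is symmetric, hence adds no torsion, and it cancels the derivatives of
    the two inverse metrics in tr (g^-1 b g^-1 c) ([metric_compatible0]).  The
    usual algebra of the Koszul formula shows that it is the only choice on
    tangent vectors ([christoffel_unique]); this uses that a tangent form of
    zero length vanishes, that is, that the volume measure is finite and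
    charges open sets ([volume_finite], [integral_eq0]), the density being a
    Pfaffian, which is nonzero for a nondegenerate form
    ([liouville_coef_neq0]).

    In the curvature the flat second derivatives cancel, and an identity between
    noncommutative monomials in A, B, C remains ([curvature0]).  The sectional
    curvatures follow by moving factors under the trace; for b = aJ one has
    [A, AJ] = 2 A^2 J, as A anticommutes with J, and J commutes with A^2.  The
    geodesic equation is c'' = c' c^-1 c', which says that c^-1 c' is constant;
    so c' = cA and c = g e^(tA) ([geodesic_unique]).

    Two constructions of associated metrics make the calculus elementary.  If A
    is symmetric for g and anticommutes with J = w^-1 g, then J e^A = e^-A J and
    g e^A is an associated metric ([compat_expm]); this gives curves of any
    tangent velocity and, with more parameters, families in which derivatives
    of maps become partial derivatives.  And any curve c that starts at g has a
    Cayley parameter X = (g + c)^-1 (c - g), with c = g (1 + X) (1 - X)^-1.  By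
    Hadamard's lemma ([smooth_dquot]) X(t) = t B(t) with B smooth, so c(t) is
    the diagonal of the family g (1 + sB(t)) (1 - sB(t))^-1, which is constant
    for s = 0: the derivative of a map along c is the derivative in s at t = 0,
    and it only involves B(0), that is, the velocity ([velocity_cay]).  Division
    by t also compares a vector field along a curve with a coordinate field
    ([ddir_ddir]).

    Smoothness of the exponential, jointly in parameters and points, holds
    because its derivative is a block of the exponential of a matrix of twice
    the size ([mder_expm], [msmooth_expm]). *)

(** * Derivatives along lines and curves *)

Section MatrixNorm.
Variable R : realType.

Lemma mx_coord_le p q (A : 'M[R]_(p, q)) i j : `|A i j| <= `|A|.
Proof.
by rewrite [leRHS]/Num.Def.normr/= mx_normrE; exact: (le_bigmax _ (fun ij => `|A ij.1 ij.2|) (i, j)).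
Qed.

Lemma mx_norm_le p q (A : 'M[R]_(p, q)) c : 0 <= c ->
  (forall i j, `|A i j| <= c) -> `|A| <= c.
Proof.
move=> c0 Ac; rewrite [leLHS]/Num.Def.normr/= mx_normrE.
by rewrite (bigmax_le _ c0)// => -[i j] _ /=.
Qed.

Lemma cvg_mxP p q T (F : set_system T) (FF : Filter F) (f : T -> 'M[R]_(p, q)) (l : 'M[R]_(p, q)) :
  f x @[x --> F] --> l <-> forall i j, (f x i j) @[x --> F] --> l i j.
Proof.
split=> [fl i j|fl].
  exact: (cvg_comp _ _ fl (@coord_continuous _ _ _ i j l)).
apply/cvgrPdist_le => /= e e0.
have H : \forall x \near F, forall ij : 'I_p * 'I_q, `|l ij.1 ij.2 - f x ij.1 ij.2| <= e.
  by apply: filter_forall => -[i j] /=; exact: (cvgrPdist_le _ _).1.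
near=> x; apply: (mx_norm_le (ltW e0)) => i j; rewrite !mxE.
exact: (near H x _ (i, j)).
Unshelve. all: by end_near. Qed.

Lemma continuous_mxP p q (T : topologicalType) (f : T -> 'M[R]_(p, q)) x :
  {for x, continuous f} <-> forall i j, {for x, continuous (fun y => f y i j)}.
Proof. exact: cvg_mxP. Qed.

End MatrixNorm.

Lemma cvg_sumr (R : realType) T (F : set_system T) (FF : Filter F) I (r : seq I) (P : pred I)
    (f : I -> T -> R) (l : I -> R) : (forall j, P j -> f j x @[x --> F] --> l j) ->
  (\sum_(j <- r | P j) f j x) @[x --> F] --> \sum_(j <- r | P j) l j.
Proof.
move=> fl; elim: r => [|j r IH].
  by rewrite big_nil; under eq_fun do rewrite big_nil; exact: cvg_cst.
rewrite big_cons; under eq_fun do rewrite big_cons.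
by case: ifP => // Pj; apply: cvgD => //; exact: fl.
Qed.

Section ChainRule.
Variable R : realType.

Lemma is_derive_line (V W : normedModType R) (f : V -> W) (u v : V) (t : R) d :
  is_derive t 1 (fun h : R => f (h *: v + u)) d <-> is_derive (t *: v + u) v f d.
Proof.
have E : (fun h : R => h^-1 *: (((fun h : R => f (h *: v + u)) \o shift t) (h *: 1) -
    f (t *: v + u))) = (fun h : R => h^-1 *: ((f \o shift (t *: v + u)) (h *: v) - f (t *: v + u))).
  by apply/funext => h /=; rewrite [_%:A]mulr1 scalerDl addrA.
by split=> -[df dv]; (apply: DeriveDef; [move: df; rewrite /derivable E|move: dv; rewrite /derive E]).
Qed.

Lemma is_derive_cvg (f : R -> R) (t d : R) : is_derive t 1 f d <->
  (h^-1 * (f (h + t) - f t)) @[h --> 0^'] --> d.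
Proof.
have E : (fun h : R => h^-1 *: ((f \o shift t) (h *: 1) - f t)) =
   (fun h : R => h^-1 * (f (h + t) - f t)).
  by apply/funext => h /=; rewrite [_%:A]mulr1.
split.
  by move=> [df <-]; move: df; rewrite /derivable /derive E => /cvg_ex[l Hl]; rewrite (cvg_lim _ Hl).
by move=> H; apply: DeriveDef; rewrite /derivable /derive E; [apply/cvg_ex; exists d|exact/cvg_lim].
Qed.

Lemma is_derive_affine (c d t : R) : is_derive t 1 (fun h => h * c + d) c.
Proof.
apply/is_derive_cvg; have : (fun _ : R => c) @ 0^' --> c by exact: cvg_cst.
apply: cvg_trans; apply: near_eq_cvg.
near=> h; have h0 : h != 0 by near: h; exact: nbhs_dnbhs_neq.
by rewrite opprD addrACA subrr addr0 -mulrBl addrK mulKf.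
Unshelve. all: by end_near. Qed.

Lemma is_derive_continuous (f : R -> R) (t d : R) : is_derive t 1 f d -> {for t, continuous f}.
Proof. by move=> [df _]; apply/differentiable_continuous/derivable1_diffP. Qed.

Lemma line_MVT (V : normedModType R) (f : V -> R) (u v : V) (s : R) :
  (forall c : R, `|c| <= `|s| -> derivable f (c *: v + u) v) ->
  exists2 c : R, `|c| <= `|s| & f (s *: v + u) - f u = s * 'D_v f (c *: v + u).
Proof.
move=> df.
have dg (c : R) : `|c| <= `|s| -> is_derive c 1 (fun h : R => f (h *: v + u)) ('D_v f (c *: v + u)).
  by move=> cs; apply/is_derive_line; apply: derivableP; exact: df.
have cg (c : R) : `|c| <= `|s| -> {for c, continuous (fun h : R => f (h *: v + u))}.
  by move=> /dg; exact: is_derive_continuous.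
have [s0|s0|->] := ltgtP s 0; last first.
- by exists 0 => //; rewrite mul0r scale0r add0r subrr.
- have [||c] := @MVT _ (fun h : R => f (h *: v + u)) (fun c => 'D_v f (c *: v + u)) 0 s s0.
  + by move=> x; rewrite in_itv /= => /andP[x0 xs]; apply: dg; rewrite !ger0_norm ?ltW.
  + apply: continuous_in_subspaceT => x; rewrite inE /= in_itv /= => /andP[x0 xs].
    by apply: (cg x); rewrite (ger0_norm x0) (ger0_norm (ltW s0)).
  rewrite in_itv /= => /andP[c0 cs] E; exists c; first by rewrite !ger0_norm ?ltW.
  by move: E; rewrite scale0r add0r subr0 mulrC.
- have [||c] := @MVT _ (fun h : R => f (h *: v + u)) (fun c => 'D_v f (c *: v + u)) s 0 s0.
  + by move=> x; rewrite in_itv /= => /andP[x0 xs]; apply: dg; rewrite !ltr0_norm// ltW// ltrN2.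
  + apply: continuous_in_subspaceT => x; rewrite inE /= in_itv /= => /andP[x0 xs].
    by apply: (cg x); rewrite (ler0_norm xs) (ler0_norm (ltW s0)) lerN2.
  rewrite in_itv /= => /andP[c0 cs] E; exists c; first by rewrite !ltr0_norm ?ltW ?ltrN2.
  move: E; rewrite scale0r add0r sub0r => E; rewrite -opprB E; ring.
Qed.

(** The increment is split into steps parallel to the axes, the mean value
    theorem being applied to each step; the intermediate points stay within
    distance [|h|] of [a] in the maximum norm. *)
Lemma C1_increment N (f : 'cV[R]_N -> R) (a : 'cV[R]_N) (r : R) :
  (forall u l, `|u - a| < r -> derivable f u (delta_mx l 0)) ->
  forall h : 'cV[R]_N, `|h| < r -> exists2 xi : 'I_N -> 'cV[R]_N,
    (forall j, `|xi j - a| <= `|h|) &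
    f (a + h) - f a = \sum_j h j 0 * partial j f (xi j).
Proof.
move=> df h hr.
(* the first k coordinates of h *)
pose T k : 'cV[R]_N := \col_j (if (j < k)%N then h j 0 else 0).
have T0 : T 0%N = 0 by apply/colP => j; rewrite !mxE.
have TN : T N = h by apply/colP => j; rewrite !mxE ltn_ord.
have TS (k : 'I_N) : T k.+1 = h k 0 *: delta_mx k 0 + T k.
  apply/colP => j; rewrite !mxE eqxx andbT ltnS leq_eqVlt.
  case: (eqVneq j k) => [->|jk] /=; first by rewrite eqxx ltnn mulr1 addr0.
  by rewrite mulr0 add0r; case: eqP => // /val_inj E; rewrite E eqxx in jk.
have Tn (k : 'I_N) c : `|c| <= `|h k 0| -> `|c *: delta_mx k 0 + T k| <= `|h|.
  move=> ch; apply: mx_norm_le => // i j; rewrite !mxE !ord1 eqxx andbT.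
  case: (eqVneq i k) => [->|ik] /=.
    by rewrite ltnn mulr1 addr0 (le_trans ch)// mx_coord_le.
  rewrite mulr0 add0r; case: ifP => _; last by rewrite normr0.
  exact: mx_coord_le.
have /choice[xi Hxi] : forall k : 'I_N, exists x, `|x - a| <= `|h| /\
    f (a + T k.+1) - f (a + T k) = h k 0 * partial k f x.
  move=> k.
  have [|c cs E] := @line_MVT _ f (a + T k) (delta_mx k 0) (h k 0).
    move=> c ch; apply: df; apply: le_lt_trans hr.
    by rewrite addrCA addrAC subrr add0r; exact: Tn.
  exists (c *: delta_mx k 0 + (a + T k)); split.
    by rewrite addrCA addrAC subrr add0r; exact: Tn.
  by rewrite TS -E addrCA.
exists xi => [j|]; first exact: (Hxi j).1.
rewrite -(eq_bigr _ (fun k _ => (Hxi k).2)).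
rewrite -(big_mkord xpredT (fun k => f (a + T k.+1) - f (a + T k))).
by rewrite telescope_sumr// TN T0 addr0.
Qed.

(** The chain rule for a curve that need only be differentiable at one time:
    the partial derivatives in the increment formula are taken at points that
    converge to [phi t]. *)
Lemma is_derive_comp_curve N (U : set 'cV[R]_N) (f : 'cV[R]_N -> R) (phi : R -> 'cV[R]_N)
    (t : R) (dphi : 'cV[R]_N) : open U -> U (phi t) ->
  (forall u l, U u -> derivable f u (delta_mx l 0)) ->
  (forall l, {for phi t, continuous (partial l f)}) ->
  (forall j, is_derive t 1 (fun s => phi s j 0) (dphi j 0)) ->
  is_derive t 1 (fun s => f (phi s)) (\sum_j dphi j 0 * partial j f (phi t)).
Proof.
move=> oU Ut df cf dphiP.
have /nbhs_ballP[r /= r0 rU] : nbhs (phi t) U by exact: open_nbhs_nbhs.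
have df' u l : `|u - phi t| < r -> derivable f u (delta_mx l 0).
  by move=> ur; apply: df; apply: rU; rewrite mx_norm_ball /ball_ /= distrC.
pose P h (x : 'I_N -> 'cV[R]_N) := (forall j, `|x j - phi t| <= `|phi (h + t) - phi t|) /\
   (`|phi (h + t) - phi t| < r ->
   f (phi (h + t)) - f (phi t) = \sum_j (phi (h + t) - phi t) j 0 * partial j f (x j)).
have /choice[xi Hxi] : forall h, exists x, P h x.
  move=> h; have [hr|hr] := ltP `|phi (h + t) - phi t| r.
    have [x Hx1 Hx2] := C1_increment df' hr; exists x; split => // _.
    by rewrite -Hx2 addrCA subrr addr0.
  by exists (fun=> phi t); split => [j|]; [rewrite subrr normr0 | rewrite ltNge hr].
have cphi : (phi (h + t)) @[h --> 0^'] --> phi t.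
  apply/cvg_mxP => i j; rewrite (ord1 j).
  have := is_derive_continuous (dphiP i); rewrite /continuous_at => H.
  have H2 : (h + t) @[h --> (0:R)^'] --> t.
    apply: cvg_within_filter.
    have := @cvgD _ _ _ (nbhs (0 : R)) _ id (cst t) 0 t; rewrite add0r; apply; [exact: cvg_id|exact: cvg_cst].
  exact: (cvg_comp _ _ H2 H).
apply/is_derive_cvg.
have E : {near 0^', (fun h : R => \sum_j (h^-1 * (phi (h + t) j 0 - phi t j 0)) * partial j f (xi h j)) =1
    (fun h : R => h^-1 * (f (phi (h + t)) - f (phi t)))}.
  near=> h; rewrite (Hxi h).2; last first.
    by near: h; move/cvgrPdist_lt : cphi => /(_ _ r0); apply: filterS => h; rewrite distrC.
  by rewrite mulr_sumr; apply: eq_bigr => j _; rewrite !mxE mulrA.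
apply: cvg_trans; first exact: (near_eq_cvg E).
apply: cvg_sumr => j _; apply: cvgM; first exact/is_derive_cvg.
have cx : (xi h j) @[h --> 0^'] --> phi t.
  apply/cvgrPdist_le => e e0.
  move/cvgrPdist_le : cphi => /(_ _ e0); apply: filterS => h.
  rewrite distrC => H; rewrite distrC; apply: le_trans H; exact: (Hxi h).1.
exact: (cvg_comp _ _ cx (cf j)).
Unshelve. all: by end_near. Qed.

End ChainRule.

(** * Smooth functions *)

Section Smooth.
Variable R : realType.

(** The order of differentiability, as a natural number: closure properties of
    smooth functions are proved by induction on it, which the quantification
    over sequences of directions does not allow. *)
Fixpoint Cr (r : nat) N (U : set 'cV[R]_N) (f : 'cV[R]_N -> R) : Prop :=
  (forall u, U u -> {for u, continuous f}) /\
  if r is r'.+1 then (forall u l, U u -> derivable f u (delta_mx l 0)) /\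
    forall l, Cr r' U (partial l f) else True.

Lemma CrS r N (U : set 'cV[R]_N) f : Cr r.+1 U f -> Cr r U f.
Proof.
elim: r f => [|r IH] f [cf [df H]]; first by split.
by split => //; split => // l; exact: IH.
Qed.

Lemma Cr_continuous r N (U : set 'cV[R]_N) f : Cr r U f -> forall u, U u -> {for u, continuous f}.
Proof. by case: r => [|r] []. Qed.

Lemma smooth_onE N (U : set 'cV[R]_N) f : smooth_on U f <-> forall r, Cr r U f.
Proof.
split=> [sf r|sf s].
  have : forall s, smooth_on U (ipartial s f).
    move=> s s' u Uu; have := sf (s' ++ s) u Uu.
    by rewrite /ipartial foldr_cat.
  move=> {}sf; rewrite -[f]/(ipartial [::] f); elim: r [::] => [|r IH] s.
    by split=> // u Uu; have [] := sf s [::] u Uu.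
  split=> [u Uu|]; first by have [] := sf s [::] u Uu.
  split=> [u l Uu|l]; first by have [_] := sf s [::] u Uu; apply.
  exact: (IH (l :: s)).
move=> u Uu.
have : forall r, Cr r U (ipartial s f).
  elim: s => [//|l s IH] r.
  by have [_ [_]] := IH r.+1; apply.
by move=> /(_ 1%N)[cf [df _]]; split=> [|l]; [exact: cf|exact: df].
Qed.

Lemma smooth_continuous N (U : set 'cV[R]_N) f u : smooth_on U f -> U u -> {for u, continuous f}.
Proof. by move=> /(_ [::] u) H /H[]. Qed.

Lemma smooth_derivable N (U : set 'cV[R]_N) f u l : smooth_on U f -> U u ->
  derivable f u (delta_mx l 0).
Proof. by move=> /(_ [::] u) H /H[_]; apply. Qed.

Lemma smooth_partial N (U : set 'cV[R]_N) f l : smooth_on U f -> smooth_on U (partial l f).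
Proof.
move=> sf s u Uu; have := sf (rcons s l) u Uu.
by rewrite /ipartial foldr_rcons.
Qed.

Lemma smooth_sub N (U V : set 'cV[R]_N) f : V `<=` U -> smooth_on U f -> smooth_on V f.
Proof. by move=> VU sf s u /VU; exact: sf. Qed.

#[local] Opaque smooth_on.

Lemma near_eq_continuous (T S : topologicalType) (f g : T -> S) x :
  (\near x, f x = g x) -> {for x, continuous f} -> {for x, continuous g}.
Proof.
move=> fg cf; rewrite /prop_for /continuous_at -(nbhs_singleton fg).
exact: cvg_trans (near_eq_cvg fg) cf.
Qed.

Section Open.
Variables (N : nat) (U : set 'cV[R]_N).
Hypothesis oU : open U.
Implicit Types f g : 'cV[R]_N -> R.

Let nearU u (P : 'cV[R]_N -> Prop) : U u -> (forall v, U v -> P v) -> \near u, P u.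
Proof. by move=> Uu UP; apply: filterS (open_nbhs_nbhs (conj oU Uu)). Qed.

Lemma eq_partial f g u l : (forall v, U v -> f v = g v) -> U u -> partial l f u = partial l g u.
Proof. by move=> fg Uu; apply: near_eq_derive; exact: nearU. Qed.

Lemma Cr_ext r f g : (forall v, U v -> f v = g v) -> Cr r U f -> Cr r U g.
Proof.
elim: r f g => [|r IH] f g fg [cf H]; split.
- by move=> u Uu; apply: near_eq_continuous (cf u Uu); exact: nearU.
- by [].
- by move=> u Uu; apply: near_eq_continuous (cf u Uu); exact: nearU.
case: H => df H; split.
  by move=> u l Uu; apply: near_eq_derivable (df u l Uu); exact: nearU.
by move=> l; apply: IH (H l) => v Uv; exact: eq_partial.
Qed.

Lemma smooth_ext f g : (forall v, U v -> f v = g v) -> smooth_on U f -> smooth_on U g.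
Proof. by move=> fg /smooth_onE sf; apply/smooth_onE => r; exact: Cr_ext (sf r). Qed.

Lemma Cr_cst r (c : R) : Cr r U (cst c).
Proof.
have cc c' u : {for u, continuous (@cst 'cV[R]_N R c')} by exact: cst_continuous.
elim: r c => [|r IH] c; (split; first by move=> u _; exact: cc) => //.
split=> [u l _|l]; first by apply: derivable_cst.
apply: (@Cr_ext r (cst 0)) => // v _; rewrite /partial derive_cst //.
Qed.

Lemma smooth_cst (c : R) : smooth_on U (cst c).
Proof. by apply/smooth_onE => r; exact: Cr_cst. Qed.

Lemma CrD r f g : Cr r U f -> Cr r U g -> Cr r U (fun u => f u + g u).
Proof.
elim: r f g => [|r IH] f g [cf Hf] [cg Hg]; split => //.
- by move=> u Uu; apply: continuousD; [exact: cf|exact: cg].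
- by move=> u Uu; apply: continuousD; [exact: cf|exact: cg].
case: Hf Hg => [df Hf] [dg Hg]; split.
  by move=> u l Uu; apply: derivableD; [exact: df|exact: dg].
move=> l; apply: Cr_ext (IH _ _ (Hf l) (Hg l)) => v Uv.
by rewrite /partial deriveD//; [exact: df|exact: dg].
Qed.

Lemma CrM r f g : Cr r U f -> Cr r U g -> Cr r U (fun u => f u * g u).
Proof.
elim: r f g => [|r IH] f g Cf Cg; move: (Cf) (Cg) => [cf Hf] [cg Hg]; split => //.
- by move=> u Uu; apply: continuousM; [exact: cf|exact: cg].
- by move=> u Uu; apply: continuousM; [exact: cf|exact: cg].
case: Hf Hg => [df Hf] [dg Hg]; split.
  by move=> u l Uu; apply: derivableM; [exact: df|exact: dg].
move=> l; apply: Cr_ext (CrD (IH _ _ (CrS Cf) (Hg l)) (IH _ _ (CrS Cg) (Hf l))) => v Uv.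
by rewrite /partial (deriveM (df v l Uv) (dg v l Uv)).
Qed.

Lemma CrV r f : (forall u, U u -> f u != 0) -> Cr r U f -> Cr r U (fun u => (f u)^-1).
Proof.
move=> f0; elim: r => [|r IH] Cf; move: (Cf) => [cf Hf]; split => //.
- by move=> u Uu; apply: continuousV; [exact: f0|exact: cf].
- by move=> u Uu; apply: continuousV; [exact: f0|exact: cf].
case: Hf => df Hf; split.
  by move=> u l Uu; apply: derivableV; [exact: f0|exact: df].
move=> l; have CV := IH (CrS Cf).
apply: Cr_ext (CrM (Cr_cst r (-1)) (CrM (CrM CV CV) (Hf l))) => v Uv.
rewrite /partial deriveV//; last exact: df.
  by rewrite /= expr2 invfM mulN1r scaleNr.
exact: f0.
Qed.

Lemma smoothD f g : smooth_on U f -> smooth_on U g -> smooth_on U (fun u => f u + g u).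
Proof. by move=> /smooth_onE sf /smooth_onE sg; apply/smooth_onE => r; exact: CrD. Qed.

Lemma smoothM f g : smooth_on U f -> smooth_on U g -> smooth_on U (fun u => f u * g u).
Proof. by move=> /smooth_onE sf /smooth_onE sg; apply/smooth_onE => r; exact: CrM. Qed.

Lemma smoothV f : (forall u, U u -> f u != 0) -> smooth_on U f ->
  smooth_on U (fun u => (f u)^-1).
Proof. by move=> f0 /smooth_onE sf; apply/smooth_onE => r; exact: CrV. Qed.

Lemma Cr_sum r I (s : seq I) (P : pred I) (f : I -> 'cV[R]_N -> R) :
  (forall i, P i -> Cr r U (f i)) -> Cr r U (fun u => \sum_(i <- s | P i) f i u).
Proof.
move=> sf; elim: s => [|i s IH].
  by under eq_fun do rewrite big_nil; exact: Cr_cst.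
case Pi: (P i); last by under eq_fun do rewrite big_cons Pi.
by under eq_fun do rewrite big_cons Pi; apply: CrD => //; exact: sf.
Qed.

Lemma smooth_sum I (s : seq I) (P : pred I) (f : I -> 'cV[R]_N -> R) :
  (forall i, P i -> smooth_on U (f i)) -> smooth_on U (fun u => \sum_(i <- s | P i) f i u).
Proof.
move=> sf; apply/smooth_onE => r; apply: Cr_sum => i Pi.
by have /smooth_onE := sf i Pi; apply.
Qed.

Lemma Cr_prod r I (s : seq I) (P : pred I) (f : I -> 'cV[R]_N -> R) :
  (forall i, P i -> Cr r U (f i)) -> Cr r U (fun u => \prod_(i <- s | P i) f i u).
Proof.
move=> sf; elim: s => [|i s IH].
  by under eq_fun do rewrite big_nil; exact: Cr_cst.
case Pi: (P i); last by under eq_fun do rewrite big_cons Pi.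
by under eq_fun do rewrite big_cons Pi; apply: CrM => //; exact: sf.
Qed.

Lemma smooth_prod I (s : seq I) (P : pred I) (f : I -> 'cV[R]_N -> R) :
  (forall i, P i -> smooth_on U (f i)) -> smooth_on U (fun u => \prod_(i <- s | P i) f i u).
Proof.
move=> sf; apply/smooth_onE => r; apply: Cr_prod => i Pi.
by have /smooth_onE := sf i Pi; apply.
Qed.

Lemma is_derive_coord (j : 'I_N) (u v : 'cV[R]_N) : is_derive u v (fun w => w j 0) (v j 0).
Proof.
have := @is_derive_line _ _ _ (fun w : 'cV[R]_N => w j 0) u v 0 (v j 0).
rewrite scale0r add0r => -[H _]; apply: H.
have -> : (fun h : R => (h *: v + u) j 0) = (fun h : R => h * v j 0 + u j 0).
  by apply/funext => h; rewrite !mxE.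
exact: is_derive_affine.
Qed.

Lemma smooth_coord (j : 'I_N) : smooth_on U (fun w => w j 0).
Proof.
apply/smooth_onE => r; have cc u : {for u, continuous (fun w : 'cV[R]_N => w j 0)}.
  exact: coord_continuous.
case: r => [|r]; split => //; split=> [u l _|l].
  by case: (is_derive_coord j u (delta_mx l 0)).
apply: (@Cr_ext r (cst ((delta_mx l 0 : 'cV[R]_N) j 0))); last exact: Cr_cst.
by move=> v _; rewrite /partial; case: (is_derive_coord j v (delta_mx l 0)).
Qed.

End Open.

(** By induction on the order: a partial derivative of [f (phi u)] is a sum of
    products of partial derivatives of [phi] with functions of the form
    [partial j f (phi u)], to which the induction hypothesis applies. *)
Lemma smooth_comp N N' (U : set 'cV[R]_N) (V : set 'cV[R]_N') (f : 'cV[R]_N' -> R)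
    (phi : 'cV[R]_N -> 'cV[R]_N') : open U -> open V ->
  (forall u, U u -> V (phi u)) -> (forall j, smooth_on U (fun u => phi u j 0)) ->
  smooth_on V f -> smooth_on U (fun u => f (phi u)).
Proof.
move=> oU oV UV sphi sf; apply/smooth_onE => r; elim: r f sf => [|r IH] f sf.
  split => // u Uu; apply: (@continuous_comp _ _ _ phi f).
    by apply/continuous_mxP => i j; rewrite (ord1 j); exact: smooth_continuous (sphi i) Uu.
  exact: smooth_continuous sf (UV _ Uu).
have D u l : U u -> is_derive u (delta_mx l 0) (fun u => f (phi u))
    (\sum_j partial l (fun u => phi u j 0) u * partial j f (phi u)).
  move=> Uu; have := @is_derive_line _ _ _ (fun u => f (phi u)) u (delta_mx l 0) 0.
  move=> /(_ (\sum_j partial l (fun u => phi u j 0) u * partial j f (phi u))).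
  rewrite scale0r add0r => -[H _]; apply: H.
  have := @is_derive_comp_curve _ _ V f (fun h => phi (h *: delta_mx l 0 + u)) 0
    (\col_j partial l (fun u => phi u j 0) u) oV.
  rewrite scale0r add0r => H.
  have -> : \sum_j partial l (fun u => phi u j 0) u * partial j f (phi u) =
     \sum_j (\col_j partial l (fun u => phi u j 0) u) j 0 * partial j f (phi u).
    by apply: eq_bigr => j _; rewrite mxE.
  apply: H.
  - exact: UV.
  - by move=> v j Vv; exact: smooth_derivable Vv.
  - by move=> j; exact: smooth_continuous (smooth_partial j sf) (UV _ Uu).
  move=> j; apply/(is_derive_line (fun u => phi u j 0)); rewrite scale0r add0r mxE.
  by apply: derivableP; exact: smooth_derivable Uu.
split.
  exact: (Cr_continuous (IH f sf)).
split=> [u l Uu|l]; first by case: (D u l Uu).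
apply: (@Cr_ext _ _ oU _ (fun u => \sum_j partial l (fun u => phi u j 0) u * partial j f (phi u))).
  by move=> u Uu; rewrite /partial; case: (D u l Uu).
apply: (Cr_sum oU) => j _; apply: (CrM oU); last exact/IH/smooth_partial.
by move: r {IH D}; apply/smooth_onE; exact: smooth_partial.
Qed.

Definition msmooth N (U : set 'cV[R]_N) p q (A : 'cV[R]_N -> 'M[R]_(p, q)) :=
  forall i j, smooth_on U (fun u => A u i j).

Section Matrices.
Variables (N : nat) (U : set 'cV[R]_N).
Hypothesis oU : open U.

Lemma msmooth_ext p q (A B : 'cV[R]_N -> 'M[R]_(p, q)) :
  (forall u, U u -> A u = B u) -> msmooth U A -> msmooth U B.
Proof. by move=> AB sA i j; apply: (smooth_ext oU) (sA i j) => u Uu; rewrite AB. Qed.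

Lemma msmooth_cst p q (A : 'M[R]_(p, q)) : msmooth U (cst A).
Proof. by move=> i j; exact: smooth_cst. Qed.

Lemma msmoothD p q (A B : 'cV[R]_N -> 'M[R]_(p, q)) :
  msmooth U A -> msmooth U B -> msmooth U (fun u => A u + B u).
Proof.
by move=> sA sB i j; under eq_fun do rewrite mxE; exact: smoothD.
Qed.

Lemma msmoothZ p q (f : 'cV[R]_N -> R) (A : 'cV[R]_N -> 'M[R]_(p, q)) :
  smooth_on U f -> msmooth U A -> msmooth U (fun u => f u *: A u).
Proof.
by move=> sf sA i j; under eq_fun do rewrite mxE; exact: smoothM.
Qed.

Lemma msmoothT p q (A : 'cV[R]_N -> 'M[R]_(p, q)) :
  msmooth U A -> msmooth U (fun u => (A u)^T).
Proof. by move=> sA i j; under eq_fun do rewrite mxE; exact: sA. Qed.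

Lemma msmoothM p q r (A : 'cV[R]_N -> 'M[R]_(p, q)) (B : 'cV[R]_N -> 'M[R]_(q, r)) :
  msmooth U A -> msmooth U B -> msmooth U (fun u => A u *m B u).
Proof.
move=> sA sB i j; under eq_fun do rewrite mxE.
by apply: smooth_sum => // k _; exact: smoothM.
Qed.

Lemma msmooth_tr p (A : 'cV[R]_N -> 'M[R]_p) :
  msmooth U A -> smooth_on U (fun u => \tr (A u)).
Proof. by move=> sA; apply: smooth_sum => // k _; exact: sA. Qed.

Lemma msmooth_det p (A : 'cV[R]_N -> 'M[R]_p) :
  msmooth U A -> smooth_on U (fun u => \det (A u)).
Proof.
move=> sA; apply: smooth_sum => // s _; apply: smoothM => //; first exact: smooth_cst.
by apply: smooth_prod => // i _; exact: sA.
Qed.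

(** Cramer's formula: the inverse is a quotient of polynomials in the entries.
    *)
Lemma msmoothV p (A : 'cV[R]_N -> 'M[R]_p) : (forall u, U u -> A u \in unitmx) ->
  msmooth U A -> msmooth U (fun u => invmx (A u)).
Proof.
move=> uA sA; apply: (@msmooth_ext _ _ (fun u => (\det (A u))^-1 *: \adj (A u))).
  by move=> u Uu; rewrite /invmx uA.
apply: msmoothZ.
  apply: smoothV => //; last exact: msmooth_det.
  by move=> u Uu; rewrite -unitfE -unitmxE uA.
move=> i j; under eq_fun do rewrite mxE /cofactor.
apply: smoothM => //; first exact: smooth_cst.
by apply: msmooth_det => k l; under eq_fun do rewrite !mxE; exact: sA.
Qed.

End Matrices.

End Smooth.

(** * Derivatives of matrix-valued functions *)

Section Mder.
Variable R : realType.

(** Entrywise differentiation: it keeps the statement that the derivative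
    exists together with its value, so that product rules chain without side
    conditions. *)
Definition mder p q (F : R -> 'M[R]_(p, q)) (t : R) (dF : 'M[R]_(p, q)) :=
  forall i j, is_derive t 1 (fun s => F s i j) (dF i j).

Lemma mder_eq p q (F : R -> 'M[R]_(p, q)) t A B : A = B -> mder F t A -> mder F t B.
Proof. by move->. Qed.

Lemma mder_uniq p q (F : R -> 'M[R]_(p, q)) t A B : mder F t A -> mder F t B -> A = B.
Proof.
by move=> FA FB; apply/matrixP => i j; have [_ <-] := FA i j; have [_ <-] := FB i j.
Qed.

Lemma mder_cst p q (A : 'M[R]_(p, q)) t : mder (fun=> A) t 0.
Proof. by move=> i j; rewrite mxE; exact: is_derive_cst. Qed.

Lemma mderD p q (F G : R -> 'M[R]_(p, q)) t dF dG : mder F t dF -> mder G t dG ->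
  mder (fun s => F s + G s) t (dF + dG).
Proof.
move=> HF HG i j; rewrite mxE; under eq_fun do rewrite mxE.
exact: is_deriveD (HF i j) (HG i j).
Qed.

Lemma is_derive_sumr (I : Type) (r : seq I) (P : pred I) (f : I -> R -> R) (df : I -> R) (t : R) :
  (forall i, P i -> is_derive t 1 (f i) (df i)) ->
  is_derive t 1 (fun s => \sum_(i <- r | P i) f i s) (\sum_(i <- r | P i) df i).
Proof.
move=> H; elim: r => [|i r IH].
  by rewrite big_nil; under eq_fun do rewrite big_nil; exact: is_derive_cst.
rewrite big_cons; case Pi: (P i); under eq_fun do rewrite big_cons Pi; last exact: IH.
exact: is_deriveD (H _ Pi) IH.
Qed.

Lemma mderM p q r (F : R -> 'M[R]_(p, q)) (G : R -> 'M[R]_(q, r)) t dF dG :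
  mder F t dF -> mder G t dG -> mder (fun s => F s *m G s) t (dF *m G t + F t *m dG).
Proof.
move=> HF HG i j; rewrite !mxE -big_split /=; under eq_fun do rewrite mxE.
apply: is_derive_sumr => k _; rewrite addrC [_ * G t k j]mulrC.
exact: is_deriveM (HF i k) (HG k j).
Qed.

Lemma mderMl p q r (A : 'M[R]_(p, q)) (G : R -> 'M[R]_(q, r)) t dG :
  mder G t dG -> mder (fun s => A *m G s) t (A *m dG).
Proof.
by move=> HG; apply: mder_eq (mderM (mder_cst A t) HG); rewrite mul0mx add0r.
Qed.

Lemma mderMr p q r (A : 'M[R]_(q, r)) (F : R -> 'M[R]_(p, q)) t dF :
  mder F t dF -> mder (fun s => F s *m A) t (dF *m A).
Proof.
by move=> HF; apply: mder_eq (mderM HF (mder_cst A t)); rewrite mulmx0 addr0.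
Qed.

Lemma mderZ p q (F : R -> 'M[R]_(p, q)) (c : R) t dF :
  mder F t dF -> mder (fun s => c *: F s) t (c *: dF).
Proof.
by move=> HF i j; rewrite mxE; under eq_fun do rewrite mxE; exact: is_deriveZ (HF i j).
Qed.

Lemma mderN p q (F : R -> 'M[R]_(p, q)) t dF :
  mder F t dF -> mder (fun s => - F s) t (- dF).
Proof.
by move=> /(mderZ (-1)); rewrite scaleN1r; under eq_fun do rewrite scaleN1r.
Qed.

Lemma mderB p q (F G : R -> 'M[R]_(p, q)) t dF dG : mder F t dF -> mder G t dG ->
  mder (fun s => F s - G s) t (dF - dG).
Proof. by move=> HF HG; exact: mderD HF (mderN HG). Qed.

Lemma mderT p q (F : R -> 'M[R]_(p, q)) t dF :
  mder F t dF -> mder (fun s => (F s)^T) t (dF^T).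
Proof. by move=> HF i j; rewrite mxE; under eq_fun do rewrite mxE; exact: HF. Qed.

Lemma mder_scale p q (A : 'M[R]_(p, q)) t : mder (fun s => s *: A) t A.
Proof.
move=> i j; under eq_fun do rewrite mxE -[_ * _]addr0; exact: is_derive_affine.
Qed.

Lemma mder_tr p (F : R -> 'M[R]_p) t dF : mder F t dF -> is_derive t 1 (fun s => \tr (F s)) (\tr dF).
Proof. by move=> HF; apply: is_derive_sumr => i _; exact: HF. Qed.

Lemma mder_near p q (F G : R -> 'M[R]_(p, q)) t dF :
  (\near t, F t = G t) -> mder F t dF -> mder G t dF.
Proof.
move=> FG HF i j; have [df dv] := HF i j.
have FG' : \near t, F t i j = G t i j by apply: filterS FG => s ->.
apply: DeriveDef; first exact: near_eq_derivable df.
by rewrite -(near_eq_derive _ FG').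
Qed.

Lemma mder_continuous p q (F : R -> 'M[R]_(p, q)) t dF : mder F t dF -> {for t, continuous F}.
Proof.
by move=> HF; apply/continuous_mxP => i j; exact: is_derive_continuous (HF i j).
Qed.

(** The bridge to the derivative of a matrix-valued function as a
    vector-valued one. *)
Lemma mder_derive1 p q (F : R -> 'M[R]_(p, q)) t dF : mder F t dF -> derive1 F t = dF.
Proof.
move=> HF; rewrite derive1E derive_mx; first by apply/matrixP => i j; rewrite mxE; case: (HF i j).
by apply/derivable_mxP => i j; case: (HF i j).
Qed.

Lemma is_derive_comp1 (f g : R -> R) (t a b : R) : is_derive t 1 g a -> is_derive (g t) 1 f b ->
  is_derive t 1 (fun s => f (g s)) (b * a).
Proof.
move=> [dg <-] [df <-].
have dfg : derivable (f \o g) t 1.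
  by apply/derivable1_diffP; apply: differentiable_comp; exact/derivable1_diffP.
apply: DeriveDef => //; have := derive1_comp dg df; rewrite !derive1E //.
Qed.

Lemma mder_comp p q (F : R -> 'M[R]_(p, q)) (g : R -> R) (t a : R) dF : is_derive t 1 g a ->
  mder F (g t) dF -> mder (fun s => F (g s)) t (a *: dF).
Proof.
by move=> Hg HF i j; rewrite mxE mulrC; exact: is_derive_comp1 Hg (HF i j).
Qed.

Lemma itv_between (I : set R) a b x : is_interval I -> I a -> I b -> a <= x <= b -> I x.
Proof. by move=> HI Ia Ib axb; apply: HI Ia Ib _ axb. Qed.

Lemma mder0_cst p q (F : R -> 'M[R]_(p, q)) (I : set R) : is_interval I ->
  (forall t, I t -> mder F t 0) -> forall s t, I s -> I t -> F s = F t.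
Proof.
move=> II HF.
suff H s t : s <= t -> I s -> I t -> F s = F t.
  by move=> s t Is It; case: (leP s t) => [|/ltW] st; [exact: H|exact/esym/H].
move=> st Is It; apply/matrixP => i j.
have d x : s <= x <= t -> is_derive x 1 (fun x => F x i j) 0.
  by move=> xst; have := HF x (itv_between II Is It xst) i j; rewrite mxE.
have [||c _] := @MVT_segment _ (fun x => F x i j) (fun=> 0) s t st.
- by move=> x; rewrite in_itv /= => /andP[sx xt]; apply: d; rewrite !ltW.
- apply: continuous_in_subspaceT => x; rewrite inE /= in_itv /= => xst.
  exact: is_derive_continuous (d x xst).
by rewrite mul0r => /eqP; rewrite subr_eq0 => /eqP.
Qed.

Lemma msmooth_mder p q (U : set 'cV[R]_1) (F : 'cV[R]_1 -> 'M[R]_(p, q)) (t : R) : U t%:M ->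
  msmooth U F -> mder (fun s => F s%:M) t (\matrix_(i, j) partial 0 (fun u => F u i j) t%:M).
Proof.
move=> Ut sF i j; rewrite mxE.
have := @is_derive_line _ _ _ (fun u => F u i j) 0 (delta_mx 0 0) t (partial 0 (fun u => F u i j) t%:M).
have e1 (s : R) : s *: (delta_mx 0 0 : 'cV[R]_1) + 0 = s%:M.
  by rewrite addr0; apply/matrixP => k l; rewrite !mxE !ord1 eqxx /= mulr1.
under eq_fun do rewrite e1; rewrite e1 => -[_ H]; apply: H.
apply: derivableP; exact: smooth_derivable (sF i j) Ut.
Qed.

End Mder.

(** * The matrix exponential *)

Section Expm.
Variable R : realType.

Definition exps m (A : 'M[R]_m) (k : nat) : 'M[R]_m := (k`!%:R)^-1 *: A ^+ k.

Lemma mx_powS m (A : 'M[R]_m) k : A ^+ k.+1 = A *m A ^+ k.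
Proof. by rewrite exprS. Qed.

Lemma mxM_le m (A B : 'M[R]_m) i j a b : `|A| <= a -> (forall i j, `|B i j| <= b) ->
  `|(A *m B) i j| <= m%:R * a * b.
Proof.
move=> Aa Bb; rewrite mxE (le_trans (ler_norm_sum _ _ _))//.
have : \sum_(k < m) `|A i k * B k j| <= \sum_(k < m) a * b.
  apply: ler_sum => k _; rewrite normrM ler_pM//.
  exact: le_trans (mx_coord_le _ _ _) Aa.
move=> /le_trans; apply; by rewrite sumr_const card_ord -[_ *+ _]mulr_natl mulrA.
Qed.

Lemma mx_pow_le m (A : 'M[R]_m) k i j : `|(A ^+ k) i j| <= (m%:R * `|A|) ^+ k.
Proof.
elim: k i j => [|k IH] i j.
  by rewrite !expr0 mxE; case: eqP => _; rewrite ?normr1 ?normr0.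
by rewrite mx_powS exprS; exact: mxM_le.
Qed.

Lemma series_mxE m (u : nat -> 'M[R]_m) n i j : series u n i j = series (fun k => u k i j) n.
Proof. by rewrite /series /= summxE. Qed.

Lemma expm_cvg m (A : 'M[R]_m) : series (exps A) @ \oo --> expm A.
Proof.
suff /cvg_ex[l Hl] : cvgn (series (exps A)) by rewrite /expm (cvg_lim _ Hl).
have H i j : cvgn (series (fun k => exps A k i j)).
  apply: normed_cvg; apply: (@series_le_cvg _ _ (exp_coeff (m%:R * `|A|))).
  - by move=> k; exact: normr_ge0.
  - by move=> k; rewrite exp_coeff_ge0// mulr_ge0.
  - move=> k; rewrite /= mxE normrM mulrC.
    rewrite [X in _ * X]ger0_norm ?invr_ge0 ?ler0n// /exp_coeff /=.
    by rewrite ler_wpM2r ?invr_ge0 ?ler0n ?mx_pow_le.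
  exact: is_cvg_series_exp_coeff.
apply/cvg_ex; exists (\matrix_(i, j) limn (series (fun k => exps A k i j))).
apply/cvg_mxP => i j; rewrite mxE; under eq_fun do rewrite series_mxE.
exact: H.
Qed.

Arguments expm_cvg {m} A.

Lemma cvg_mxM p q r (F : nat -> 'M[R]_(p, q)) (G : nat -> 'M[R]_(q, r)) (A : 'M[R]_(p, q)) (B : 'M[R]_(q, r)) :
  F @ \oo --> A -> G @ \oo --> B -> (fun n => F n *m G n) @ \oo --> A *m B.
Proof.
move=> /cvg_mxP FA /cvg_mxP GB; apply/cvg_mxP => i j; rewrite mxE.
under eq_fun do rewrite mxE.
by apply: cvg_sumr => k _; apply: cvgM; [exact: FA|exact: GB].
Qed.

Lemma cvgn_mx_unique p q (F : nat -> 'M[R]_(p, q)) (A B : 'M[R]_(p, q)) : F @ \oo --> A -> F @ \oo --> B -> A = B.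
Proof. by move=> FA FB; apply: (cvg_unique _ FA FB). Qed.

(** The powers of [X] and [Y] are intertwined by [P], hence so are the partial
    sums. All algebraic properties of the exponential used below are
    instances: commutation, conjugation, and the block identities of
    [expm_block], where [P] is rectangular. *)
Lemma expm_intertwine p q (X : 'M[R]_p) (Y : 'M[R]_q) (P : 'M[R]_(p, q)) :
  X *m P = P *m Y -> expm X *m P = P *m expm Y.
Proof.
move=> XP; have H k : X ^+ k *m P = P *m Y ^+ k.
  elim: k => [|k IH]; first by rewrite !expr0 mul1mx mulmx1.
  by rewrite exprSr -mulmxE -mulmxA XP mulmxA IH -mulmxA mulmxE -exprSr.
have cP : (fun _ : nat => P) @ \oo --> P by exact: cvg_cst.
apply: (cvgn_mx_unique (cvg_mxM (expm_cvg X) cP)).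
have -> : (fun n => series (exps X) n *m P) = (fun n => P *m series (exps Y) n).
  apply/funext => n; rewrite /series /= mulmx_suml mulmx_sumr.
  by apply: eq_bigr => k _; rewrite -scalemxAl H scalemxAr.
exact: cvg_mxM cP (expm_cvg Y).
Qed.

Lemma expm_tr m (A : 'M[R]_m) : (expm A)^T = expm A^T.
Proof.
apply: (@cvgn_mx_unique _ _ (fun n => (series (exps A) n)^T)).
  apply/cvg_mxP => i j; rewrite mxE; under eq_fun do rewrite mxE.
  by have /cvg_mxP := expm_cvg A; apply.
have -> : (fun n => (series (exps A) n)^T) = series (exps A^T); last exact: expm_cvg.
apply/funext => n; rewrite /series /= raddf_sum; apply: eq_bigr => k _.
rewrite /= /exps linearZ /=; congr (_ *: _).
elim: k => [|k IH]; first by rewrite !expr0 trmx1.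
by rewrite exprSr exprS -!mulmxE trmx_mul IH.
Qed.

Lemma expm0 m : expm (0 : 'M[R]_m) = 1%:M.
Proof.
apply: (cvgn_mx_unique (expm_cvg 0)); rewrite -cvg_shiftS.
have -> : [sequence series (exps (0 : 'M[R]_m)) n.+1]_n = (fun=> 1%:M); last exact: cvg_cst.
apply/funext => n; rewrite /series /= big_nat_recl// big1 ?addr0.
  by rewrite /exps expr0 fact0 invr1 scale1r.
by move=> k _; rewrite /exps expr0n /= scaler0.
Qed.

(** Telescoping B^(k+1) - A^(k+1) = B (B^k - A^k) + (B - A) A^k; the factor 2
    absorbs the number of terms. *)
Lemma mx_pow_lip m (A B : 'M[R]_m) c k i j : `|A| <= c -> `|B| <= c -> 1 <= m%:R * c ->
  `|(B ^+ k - A ^+ k) i j| <= (2 * (m%:R * c)) ^+ k * (m%:R * `|B - A|).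
Proof.
move=> Ac Bc c1; have K0 : 0 <= m%:R * c by exact: le_trans ler01 c1.
have d0 : 0 <= m%:R * `|B - A| by rewrite mulr_ge0.
elim: k i j => [|k IH] i j.
  by rewrite !expr0 subrr mxE normr0 mul1r.
have -> : B ^+ k.+1 - A ^+ k.+1 = B *m (B ^+ k - A ^+ k) + (B - A) *m A ^+ k.
  by rewrite mulmxBr mulmxBl addrA subrK !mx_powS.
rewrite mxE (le_trans (ler_normD _ _))//.
have H1 := mxM_le i j Bc IH.
have H2 : `|((B - A) *m A ^+ k) i j| <= m%:R * `|B - A| * (m%:R * c) ^+ k.
  apply: mxM_le => // i' j'; apply: le_trans (mx_pow_le _ _ _ _) _.
  have mA : m%:R * `|A| <= m%:R * c by rewrite ler_wpM2l.
  by apply: lerXn2r mA; rewrite nnegrE// mulr_ge0.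
apply: le_trans (lerD H1 H2) _.
set K := m%:R * c in c1 K0 *; set d := m%:R * `|B - A| in d0 *.
rewrite exprS [leRHS](_ : _ = K * ((2 * K) ^+ k * d) + K * ((2 * K) ^+ k * d)); last by ring.
rewrite lerD2l mulrC mulrA ler_wpM2r//.
apply: (@le_trans _ _ ((2 * K) ^+ k)).
  have K2 : K <= 2 * K by rewrite ler_peMl// ler1n.
  by apply: lerXn2r K2; rewrite nnegrE// mulr_ge0.
by rewrite ler_peMl// exprn_ge0// mulr_ge0.
Qed.

Lemma expm_lip m (A B : 'M[R]_m) c i j : `|A| <= c -> `|B| <= c -> 1 <= m%:R * c ->
  `|expm B i j - expm A i j| <= expR (2 * (m%:R * c)) * (m%:R * `|B - A|).
Proof.
move=> Ac Bc c1; have K0 : 0 <= 2 * (m%:R * c) by rewrite mulr_ge0// (le_trans ler01).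
have d0 : 0 <= m%:R * `|B - A| by rewrite mulr_ge0.
have /cvg_mxP/(_ i j) HA := expm_cvg A; have /cvg_mxP/(_ i j) HB := expm_cvg B.
have H : (fun n => `|series (exps B) n i j - series (exps A) n i j|) @ \oo -->
    `|expm B i j - expm A i j| by apply: cvg_norm; exact: cvgB HB HA.
rewrite -(cvg_lim _ H)//; apply: limr_le; first by apply/cvg_ex; eexists; exact: H.
near=> n.
rewrite !series_mxE /series /= -sumrB.
apply: le_trans (ler_norm_sum _ _ _) _.
apply: (@le_trans _ _ (series (exp_coeff (2 * (m%:R * c))) n * (m%:R * `|B - A|))).
  rewrite /series /= mulr_suml; apply: ler_sum => k _.
  have := mx_pow_lip k i j Ac Bc c1; rewrite !mxE -mulrBr normrM => H1.
  rewrite [X in X * _]ger0_norm ?invr_ge0// /exp_coeff /= mulrAC mulrC.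
  by rewrite ler_wpM2r ?invr_ge0.
rewrite ler_wpM2r//; apply: nondecreasing_cvgn_le; last exact: is_cvg_series_exp_coeff.
by apply: nondecreasing_series => k _ _; exact: exp_coeff_ge0.
Unshelve. all: by end_near. Qed.

Lemma expm_continuous m : continuous (@expm R m).
Proof.
move=> A; apply/(@cvg_mxP _ _ _ _ (nbhs A) _) => i j; apply/cvgrPdist_le => /= e e0.
case: m A i j => [|m] A i j; first by case: i.
set c := `|A| + 1; set L := expR (2 * (m.+1%:R * c)) * m.+1%:R.
have c1 : 1 <= c by rewrite lerDr.
have m1 : (1 : R) <= m.+1%:R by rewrite ler1n.
have L0 : 0 < L by rewrite mulr_gt0 ?expR_gt0.
have H r : 0 < r -> \forall B \near A, `|A - B| <= r.
  by move=> r0; have /cvgrPdist_le := @cvg_id _ (nbhs A); apply.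
near=> B.
have B1 : `|A - B| <= 1 by near: B; exact: H.
have Be : `|A - B| <= e / L by near: B; apply: H; rewrite divr_gt0.
have Bc : `|B| <= c.
  by rewrite -[B](subrK A) addrC (le_trans (ler_normD _ _))// lerD2l distrC.
have cm : 1 <= m.+1%:R * c by rewrite mulr_ege1.
have Ac : `|A| <= c by rewrite lerDl.
apply: le_trans (expm_lip i j Bc Ac cm) _.
by rewrite [leLHS](_ : _ = `|A - B| * L) ?/L; [rewrite -ler_pdivlMr|ring].
Unshelve. all: by end_near. Qed.

(** The block matrix is conjugate, by a unipotent block, to the diagonal one
    with blocks [B] and [A]; the conjugation is written with two intertwiners.
    The difference quotient of the exponential thus is a block of an
    exponential. *)
Lemma expm_block m (A B : 'M[R]_m) (h : R) : h != 0 ->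
  ursubmx (expm (block_mx B (h^-1 *: (B - A)) 0 A)) = h^-1 *: (expm B - expm A).
Proof.
move=> h0; set X := block_mx _ _ _ _.
have H1 : X *m col_mx 1%:M 0 = col_mx 1%:M 0 *m B.
  by rewrite mul_block_col mul_col_mx !mulmx1 !mulmx0 !addr0 mul1mx mul0mx.
have H2 : X *m col_mx (- h^-1)%:M 1%:M = col_mx (- h^-1)%:M 1%:M *m A.
  rewrite mul_block_col mul_col_mx !mulmx1 mul1mx mul0mx add0r; congr col_mx.
  by rewrite mul_mx_scalar mul_scalar_mx scalerBr addrA scaleNr addNr add0r scaleNr.
have := expm_intertwine H1; have := expm_intertwine H2.
rewrite -(submxK (expm X)) block_mxKur !mul_block_col !mul_col_mx !mulmx1 !mulmx0 !addr0 !mul1mx.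
move=> /eq_col_mx[E _] /eq_col_mx[E1 _]; move: E; rewrite E1.
by rewrite mul_mx_scalar mul_scalar_mx scalerBr !scaleNr => <-; rewrite addrA subrr add0r.
Qed.

(** Pass to the limit in [expm_block] by continuity: no termwise
    differentiation of the series is needed. *)
Lemma mder_expm m (A : R -> 'M[R]_m) (t : R) dA : mder A t dA ->
  mder (fun s => expm (A s)) t (ursubmx (expm (block_mx (A t) dA 0 (A t)))).
Proof.
move=> HA i j; apply/is_derive_cvg.
pose X (h : R) := block_mx (A (h + t)) (h^-1 *: (A (h + t) - A t)) 0 (A t).
have XE : {near 0^', (fun h : R => ursubmx (expm (X h)) i j) =1
    (fun h : R => h^-1 * (expm (A (h + t)) i j - expm (A t) i j))}.
  near=> h; have h0 : h != 0 by near: h; exact: nbhs_dnbhs_neq.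
  by rewrite expm_block// !mxE.
apply: cvg_trans; first exact: (near_eq_cvg XE).
have cX : (X h) @[h --> 0^'] --> block_mx (A t) dA 0 (A t).
  have cA : (A (h + t)) @[h --> 0^'] --> A t.
    have H2 : (h + t) @[h --> (0:R)^'] --> t.
      apply: cvg_within_filter.
      have := @cvgD _ _ _ (nbhs (0 : R)) _ id (cst t) 0 t; rewrite add0r; apply; [exact: cvg_id|exact: cvg_cst].
    exact: (cvg_comp _ _ H2 (mder_continuous HA)).
  apply/cvg_mxP => i' j'.
  rewrite -(splitK i') -(splitK j').
  case: (fintype.split i') => k; case: (fintype.split j') => l; rewrite /= /X;
    rewrite ?block_mxEul ?block_mxEur ?block_mxEdl ?block_mxEdr.
  - by under eq_fun do rewrite block_mxEul; move/cvg_mxP : cA; apply.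
  - under eq_fun do rewrite block_mxEur !mxE.
    by have /is_derive_cvg := HA k l.
  - by under eq_fun do rewrite block_mxEdl; exact: cvg_cst.
  - by under eq_fun do rewrite block_mxEdr; exact: cvg_cst.
have := cvg_comp _ _ cX (@expm_continuous _ _) => /cvg_mxP /(_ (lshift _ i) (rshift _ j)).
rewrite !mxE /=; apply: cvg_trans; apply: near_eq_cvg; near=> h.
by rewrite !mxE.
Unshelve. all: by end_near. Qed.

(** The partial derivatives of [expm (A u)] are again blocks of exponentials
    of smooth matrices, of twice the size; this closes the induction on the
    order of differentiability, provided that it runs over all sizes at once.
    *)
Lemma msmooth_expm N (U : set 'cV[R]_N) m (A : 'cV[R]_N -> 'M[R]_m) : open U ->
  msmooth U A -> msmooth U (fun u => expm (A u)).
Proof.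
move=> oU sA i j; apply/smooth_onE => r; elim: r m A sA i j => [|r IH] m A sA i j.
  split=> // u Uu; have cA : {for u, continuous A}.
    by apply/continuous_mxP => k l; exact: smooth_continuous (sA k l) Uu.
  have := continuous_comp cA (@expm_continuous _ (A u)) => /continuous_mxP; exact.
split; first exact: (Cr_continuous (IH m A sA i j)).
have D u l : U u -> is_derive u (delta_mx l 0) (fun u => expm (A u) i j)
    (ursubmx (expm (block_mx (A u) (\matrix_(i, j) partial l (fun u => A u i j) u) 0 (A u))) i j).
  move=> Uu; have := @is_derive_line _ _ _ (fun u => expm (A u) i j) u (delta_mx l 0) 0
    (ursubmx (expm (block_mx (A u) (\matrix_(i, j) partial l (fun u => A u i j) u) 0 (A u))) i j).
  rewrite scale0r add0r => -[H _]; apply: H.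
  have := @mder_expm _ (fun s => A (s *: delta_mx l 0 + u)) 0 (\matrix_(i, j) partial l (fun u => A u i j) u).
  rewrite scale0r add0r; apply => i' j'; rewrite mxE.
  apply/(is_derive_line (fun u => A u i' j')); rewrite scale0r add0r.
  by apply: derivableP; exact: smooth_derivable Uu.
split=> [u l Uu|l]; first by case: (D u l Uu).
apply: (Cr_ext oU (f := fun u => expm (block_mx (A u) (\matrix_(i, j) partial l (fun u => A u i j) u) 0 (A u))
   (lshift _ i) (rshift _ j))).
  by move=> u Uu; rewrite /partial; case: (D u l Uu) => _ ->; rewrite !mxE.
apply: IH => i' j'; rewrite -(splitK i') -(splitK j').
case: (fintype.split i') => k; case: (fintype.split j') => l'; rewrite /=.
- by under eq_fun do rewrite block_mxEul; exact: sA.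
- by under eq_fun do rewrite block_mxEur mxE; exact: smooth_partial.
- by under eq_fun do rewrite block_mxEdl mxE; exact: smooth_cst.
- by under eq_fun do rewrite block_mxEdr; exact: sA.
Qed.

Lemma block_pow m (X Y : 'M[R]_m) k : X *m Y = Y *m X ->
  (block_mx X Y 0 X) ^+ k.+1 = block_mx (X ^+ k.+1) (k.+1%:R *: (X ^+ k *m Y)) 0 (X ^+ k.+1).
Proof.
move=> XY; elim: k => [|k IH].
  by rewrite !expr1 expr0 mul1mx scale1r.
rewrite mx_powS IH mulmx_block !mulmx0 !mul0mx !addr0 !add0r -!mx_powS; congr block_mx.
rewrite -scalemxAr mulmxA -mx_powS -[in RHS](addn1 k.+1) natrD scalerDl scale1r; congr (_ + _).
have : forall k, Y *m X ^+ k = X ^+ k *m Y.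
  elim=> [|l IHl]; first by rewrite !expr0 mulmx1 mul1mx.
  by rewrite mx_powS mulmxA -XY -mulmxA IHl mulmxA.
by move=> ->.
Qed.

(** When [X] and [Y] commute, the corner of the k-th power is k X^(k-1) Y, and
    the factor k shifts the exponential series by one step. *)
Lemma expm_block_comm m (X Y : 'M[R]_m) : X *m Y = Y *m X ->
  ursubmx (expm (block_mx X Y 0 X)) = expm X *m Y.
Proof.
move=> XY; apply: (@cvgn_mx_unique _ _ (fun n => ursubmx (series (exps (block_mx X Y 0 X)) n.+1))).
  have H := expm_cvg (block_mx X Y 0 X); rewrite -cvg_shiftS in H.
  apply/cvg_mxP => i j; rewrite !mxE; under eq_fun do rewrite !mxE.
  by move/cvg_mxP : H; apply.
have -> : (fun n => ursubmx (series (exps (block_mx X Y 0 X)) n.+1)) =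
    (fun n => series (exps X) n *m Y).
  have urD (P Q : 'M[R]_(m + m)) : ursubmx (P + Q) = ursubmx P + ursubmx Q.
    by apply/matrixP => i j; rewrite !mxE.
  have urZ (c : R) (P : 'M[R]_(m + m)) : ursubmx (c *: P) = c *: ursubmx P.
    by apply/matrixP => i j; rewrite !mxE.
  have ur0 : ursubmx (0 : 'M[R]_(m + m)) = 0 by apply/matrixP => i j; rewrite !mxE.
  apply/funext => n; rewrite /series /= big_nat_recl// urD {1}/exps expr0.
  rewrite urZ (_ : ursubmx (1 : 'M[R]_(m + m)) = 0) ?scaler0 ?add0r; last first.
    by rewrite -[1]/(1%:M) (scalar_mx_block _ _ 1) block_mxKur.
  rewrite (big_morph _ urD ur0) mulmx_suml; apply: eq_bigr => k _.
  rewrite /exps block_pow// urZ block_mxKur scalerA -scalemxAl; congr (_ *: _).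
  by rewrite factS natrM invfM mulrAC mulVf ?mul1r// pnatr_eq0.
apply: cvg_mxM (expm_cvg X) _; exact: cvg_cst.
Qed.

Lemma mder_expm_scale m (A : 'M[R]_m) t : mder (fun s => expm (s *: A)) t (expm (t *: A) *m A).
Proof.
apply: mder_eq (mder_expm (mder_scale A t)); apply: expm_block_comm.
by rewrite -scalemxAl -scalemxAr.
Qed.

Lemma expm_comm m (A : 'M[R]_m) t : A *m expm (t *: A) = expm (t *: A) *m A.
Proof. by apply/esym/expm_intertwine; rewrite -scalemxAl -scalemxAr. Qed.

(** The product e^(sA) e^(-sA) has zero derivative. *)
Lemma expmN m (A : 'M[R]_m) : expm A *m expm (- A) = 1%:M.
Proof.
have H t : mder (fun s => expm (s *: A) *m expm (s *: - A)) t 0.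
  apply: mder_eq (mderM (mder_expm_scale A t) (mder_expm_scale (- A) t)).
  by rewrite -[X in _ + _ *m X](expm_comm (- A) t) mulNmx mulmxN mulmxA subrr.
have := @mder0_cst _ _ _ (fun s => expm (s *: A) *m expm (s *: - A)) setT _ (fun t _ => H t) 1 0 I I.
by rewrite !scale1r !scale0r expm0 mulmx1; apply=> x y _ _ z _.
Qed.

Lemma expm_unit m (A : 'M[R]_m) : expm A \in unitmx.
Proof. by have /mulmx1_unit[] := expmN A. Qed.

(** As for [expmN], with e^(sA/2) e^(sA/2) e^(-sA). *)
Lemma expm_half m (A : 'M[R]_m) : expm (2^-1 *: A) *m expm (2^-1 *: A) = expm A.
Proof.
set B := 2^-1 *: A.
have BA : A = B + B 
  by rewrite /B -scalerDl (_ : 2^-1 + 2^-1 = 1) ?scale1r//; field.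
have E (s : R) : s *: - A = - (s *: A) by rewrite scalerN.
have H t : mder (fun s => expm (s *: B) *m expm (s *: B) *m expm (s *: - A)) t 0.
  apply: mder_eq (mderM (mderM (mder_expm_scale B t) (mder_expm_scale B t)) (mder_expm_scale (- A) t)).
  rewrite -[X in _ + _ *m X](expm_comm (- A) t) [X in _ + X]mulmxA -mulmxDl.
  set e := expm (t *: B).
  rewrite [X in X *m _](_ : _ = 0) ?mul0mx//.
  by rewrite -[e *m B *m e]mulmxA (expm_comm B t) -/e !mulmxA mulmxN BA mulmxDr subrr.
have := @mder0_cst _ _ _ (fun s => expm (s *: B) *m expm (s *: B) *m expm (s *: - A)) setT _ (fun t _ => H t) 1 0 I I.
rewrite !scale1r !scale0r expm0 !mulmx1 => K.
rewrite -[LHS]mulmx1 -(expmN (- A)) opprK mulmxA K ?mul1mx// => x y _ _ z _.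
Qed.

End Expm.

(** * Integrals depending on a parameter *)

Section Tube.
Variable R : realType.

(** Continuity at the points of a compact fibre is uniform along the fibre. *)
Lemma tube (T S : topologicalType) (K : set T) (f : S -> T -> R) s0 e : compact K ->
  (forall x, K x -> {for (s0, x), continuous (fun z : S * T => f z.1 z.2)}) -> 0 < e ->
  \forall s \near s0, forall x, K x -> `|f s x - f s0 x| < e.
Proof.
move=> /compact_near_coveringP cK cf e0.
apply: (cK _ (nbhs s0) (fun s x => `|f s x - f s0 x| < e)) => x Kx.
have e20 : 0 < e / 2 by rewrite divr_gt0.
have /cvgrPdist_lt/(_ _ e20) [/= [A B] /= [As0 Bx] H] := cf x Kx.
exists (B, A) => //= -[x' s] /= [Bx' As].
have H1 := H (s, x') (conj As Bx').
have H2 := H (s0, x') (conj (nbhs_singleton As0) Bx').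
rewrite (_ : f s x' - f s0 x' = (f s0 x - f s0 x') - (f s0 x - f s x')); last by ring.
by rewrite (splitr e) (le_lt_trans (ler_normB _ _))// ltrD.
Qed.

Lemma tube_lt (T S : topologicalType) (K : set T) (f : S -> T -> R) s0 c : compact K ->
  (forall x, K x -> {for (s0, x), continuous (fun z : S * T => f z.1 z.2)}) ->
  (forall x, K x -> f s0 x < c) ->
  \forall s \near s0, forall x, K x -> f s x < c.
Proof.
move=> /compact_near_coveringP cK cf fc.
apply: (cK _ (nbhs s0) (fun s x => f s x < c)) => x Kx.
have : \forall z \near (s0, x), f z.1 z.2 < c.
  by apply: (cvgr_lt _ (cf x Kx)); exact: fc.
by move=> [/= [A B] /= [As0 Bx] H]; exists (B, A) => //= -[x' s] /= [Bx' As]; exact: (H (s, x')).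
Qed.

Section Param.
Context d (T : measurableType d) (mu : {measure set T -> \bar R}) (D : set T).
Hypothesis mD : measurable D.
Hypothesis fD : (mu D < +oo)%E.

Lemma Rintegral_dist (f g : T -> R) e : mu.-integrable D (EFin \o f) -> mu.-integrable D (EFin \o g) ->
  (forall x, D x -> `|f x - g x| <= e) ->
  `|Rintegral mu D f - Rintegral mu D g| <= e * fine (mu D).
Proof.
move=> fi gi fg; rewrite -RintegralB//.
have fgi : mu.-integrable D (EFin \o (fun x => f x - g x)).
  by have := integrableB mD fi gi; apply: eq_integrable.
apply: le_trans (le_normr_Rintegral mD fgi) _.
rewrite -(Rintegral_cst mu mD); apply: le_Rintegral => //.
- by have := integrable_norm fgi; apply: eq_integrable.
- apply: measurable_bounded_integrable => //.
  by exists `|e|; split => // M eM x _ /=; rewrite (le_trans _ (ltW eM)).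
Qed.

Lemma Rintegral_cvg I (F : set_system I) (FF : Filter F) (f : I -> T -> R) (g : T -> R) :
  (\forall i \near F, mu.-integrable D (EFin \o f i)) -> mu.-integrable D (EFin \o g) ->
  (forall e, 0 < e -> \forall i \near F, forall x, D x -> `|f i x - g x| < e) ->
  Rintegral mu D (f i) @[i --> F] --> Rintegral mu D g.
Proof.
move=> fi gi fg; apply/cvgrPdist_le => /= e e0.
set c := fine (mu D); have c0 : 0 <= c by rewrite fine_ge0.
have d0 : 0 < e / (c + 1) by rewrite divr_gt0// ltr_wpDl.
near=> i; rewrite distrC.
have fii : mu.-integrable D (EFin \o f i) by near: i.
apply: (@le_trans _ _ (e / (c + 1) * c)).
  apply: Rintegral_dist => // x Dx; apply: ltW.
  by move: x Dx; near: i; exact: fg.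
by rewrite mulrAC ler_pdivrMr ?ltr_wpDl// ler_pM2l// lerDl.
Unshelve. all: by end_near. Qed.

(** Differentiation under the integral sign, for a finite measure and
    difference quotients that converge uniformly. *)
Lemma is_derive_Rintegral (f : R -> T -> R) (df : T -> R) (t : R) :
  (\forall s \near t, mu.-integrable D (EFin \o f s)) -> mu.-integrable D (EFin \o df) ->
  (forall e, 0 < e -> \forall h \near 0^', forall x, D x -> `|h^-1 * (f (h + t) x - f t x) - df x| < e) ->
  is_derive t 1 (fun s => Rintegral mu D (f s)) (Rintegral mu D df).
Proof.
move=> fi dfi H; apply/is_derive_cvg.
have fit : mu.-integrable D (EFin \o f t) by exact: nbhs_singleton fi.
have fih : \forall h \near (0 : R)^', mu.-integrable D (EFin \o f (h + t)).
  have ch : (h + t) @[h --> (0 : R)^'] --> t.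
    apply: cvg_within_filter.
    have := @cvgD _ _ _ (nbhs (0 : R)) _ id (cst t) 0 t; rewrite add0r; apply; [exact: cvg_id|exact: cvg_cst].
  exact: ch fi.
have qi : \forall h \near (0 : R)^', mu.-integrable D (EFin \o (fun x => h^-1 * (f (h + t) x - f t x))).
  near=> h; have fh : mu.-integrable D (EFin \o f (h + t)) by near: h.
  by have := integrableZl mD h^-1 (integrableB mD fh fit); apply: eq_integrable.
apply: (cvg_trans _ (Rintegral_cvg _ qi dfi H)); apply: near_eq_cvg.
near=> h; have fh : mu.-integrable D (EFin \o f (h + t)) by near: h.
rewrite RintegralZl//; last by have := integrableB mD fh fit; apply: eq_integrable.
by rewrite RintegralB.
Unshelve. all: by end_near. Qed.

End Param.

(** A difference quotient is a value of the derivative at a nearby time, and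
    those values are uniformly close by [tube]. *)
Lemma unif_quotient (T : topologicalType) (K : set T) (f df : R -> T -> R) (t : R) : compact K ->
  (\forall s \near t, forall x, K x -> is_derive (s : R) (1 : R) (f ^~ x) (df s x)) ->
  (forall x, K x -> {for (t, x), continuous (fun z : R * T => df z.1 z.2)}) ->
  forall e, 0 < e -> \forall h \near 0^', forall x, K x -> `|h^-1 * (f (h + t) x - f t x) - df t x| < e.
Proof.
move=> cK fd cdf e e0.
have H : \forall s \near t, (forall x, K x -> is_derive (s : R) (1 : R) (f ^~ x) (df s x)) /\
   (forall x, K x -> `|df s x - df t x| < e).
  by apply: filterI => //; exact: (tube (f := df)).
have /nbhs_ballP[r /= r0 rH] := H.
near=> h => x Kx.
have h0 : h != 0 by near: h; exact: nbhs_dnbhs_neq.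
have hr : `|h| < r by near: h; exact: dnbhs0_lt.
have B c : `|c| <= `|h| -> ball t r (c + t).
  by move=> ch; rewrite /ball /= opprD addrCA subrr addr0 normrN (le_lt_trans ch).
have [|c ch E] := @line_MVT _ R^o (f ^~ x) t (1 : R) h.
  move=> c ch; have /rH[H1 _] := B c ch; have := H1 x Kx.
  by rewrite [c *: 1]mulr1 => -[].
move: E; rewrite [h *: 1]mulr1 [c *: 1]mulr1 => ->.
have /rH[H1 H2] := B c ch.
by rewrite mulKf//; have [_ ->] := H1 x Kx; exact: H2.
Unshelve. all: by end_near. Qed.

End Tube.

Section ColScalar.
Variables (R : realType) (N : nat).

Lemma col_scalar_u (a : R) (v : 'cV[R]_N) k i :
  (col_mx a%:M v : 'cV[R]_(1 + N)) (lshift N k) i = a.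
Proof. by rewrite col_mxEu mxE (ord1 k) (ord1 i) eqxx mulr1n. Qed.

Lemma col_scalar_d (a : R) (v : 'cV[R]_N) k i :
  (col_mx a%:M v : 'cV[R]_(1 + N)) (rshift 1 k) i = v k i.
Proof. by rewrite col_mxEd. Qed.

End ColScalar.

Section IntegralSmooth.
Variable R : realType.
Variable N : nat.

Let mu := @lebesgue_measure R.
Let I01 : set R := `[0, 1].

(** The variable of integration is the first coordinate of the argument of
    [F]. *)
Definition int01 (F : 'cV[R]_(1 + N) -> R) (v : 'cV[R]_N) : R :=
  Rintegral mu I01 (fun th => F (col_mx th%:M v)).

Lemma col_mx_continuous (T : topologicalType) (f : T -> R) (g : T -> 'cV[R]_N) z :
  {for z, continuous f} -> {for z, continuous g} ->
  {for z, continuous (fun z => col_mx (f z)%:M (g z) : 'cV[R]_(1 + N))}.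
Proof.
move=> cf cg; apply/continuous_mxP => i j; rewrite (ord1 j) -(splitK i).
case: (fintype.split i) => k /=.
  under [X in {for _, continuous X}]eq_fun do rewrite col_mxEu mxE (ord1 k) eqxx mulr1n.
  exact: cf.
under [X in {for _, continuous X}]eq_fun do rewrite col_mxEd.
by move/continuous_mxP : cg => /(_ k 0).
Qed.

Lemma int01_cst F v c : (forall th, F (col_mx th%:M v) = c) -> int01 F v = c.
Proof.
move=> Fc; rewrite /int01 (_ : (fun th => F (col_mx th%:M v)) = (fun=> c)); last exact/funext.
have m1 : mu I01 = 1%E by rewrite /mu /I01 lebesgue_measure_itv /= lte_fin ltr01 sube0.
apply: etrans; first by apply: Rintegral_cst; exact: measurable_itv.
have -> : fine (lebesgue_measure I01) = (1 : R) by rewrite -[X in fine X]/(mu I01) m1.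
by rewrite mulr1.
Qed.

Variables (W : set 'cV[R]_(1 + N)) (V : set 'cV[R]_N).
Hypothesis oV : open V.
Hypothesis VW : forall th v, 0 <= th <= 1 -> V v -> W (col_mx th%:M v).

Let mI : measurable I01. Proof. exact: measurable_itv. Qed.
Let muI : (mu I01 < +oo)%E.
Proof. by rewrite /mu /I01 lebesgue_measure_itv /= lte_fin ltr01 sube0 ltry. Qed.
Let cI : compact I01. Proof. exact: segment_compact. Qed.
Let I01P th : I01 th -> 0 <= th <= 1. Proof. by rewrite /I01 /= in_itv. Qed.

Let int_ok F v : smooth_on W F -> V v -> mu.-integrable I01 (EFin \o (fun th => F (col_mx th%:M v))).
Proof.
move=> sF Vv; apply: continuous_compact_integrable => //.
apply: continuous_in_subspaceT => th; rewrite inE => /I01P th01.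
apply: (@continuous_comp _ _ _ (fun th => col_mx th%:M v) F).
  by apply: col_mx_continuous; [exact: cvg_id|exact: cst_continuous].
by apply: smooth_continuous sF _; exact: VW.
Qed.

Lemma smooth_int01 F : smooth_on W F -> smooth_on V (int01 F).
Proof.
move=> sF; apply/smooth_onE => r; elim: r F sF => [|r IH] F sF.
  split=> // v Vv.
  have H : \forall v' \near v, V v' by exact: open_nbhs_nbhs.
  apply: (@Rintegral_cvg _ _ _ mu I01 mI muI _ (nbhs v) _ (fun v th => F (col_mx th%:M v))).
  - by apply: filterS H => v' Vv'; exact: int_ok.
  - exact: int_ok.
  move=> e e0; apply: (@tube _ _ _ _ (fun v th => F (col_mx th%:M v)) v e cI _ e0) => th /I01P th01.
  apply: (@continuous_comp _ _ _ (fun z : 'cV[R]_N * R => col_mx z.2%:M z.1) F).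
    by apply: col_mx_continuous; [exact: cvg_snd|exact: cvg_fst].
  by apply: smooth_continuous sF _; exact: VW.
have D v l : V v -> is_derive v (delta_mx l 0) (int01 F) (int01 (partial (rshift 1 l) F) v).
  move=> Vv; have sdF := smooth_partial (rshift 1 l) sF.
  have := @is_derive_line _ _ _ (int01 F) v (delta_mx l 0) 0 (int01 (partial (rshift 1 l) F) v).
  rewrite scale0r add0r => -[H _]; apply: H.
  pose g (h : R) := h *: delta_mx l 0 + v.
  have cg h : {for h, continuous g}.
    apply: continuousD; last exact: cst_continuous.
    exact: scalel_continuous.
  have Vg : \forall h \near (0 : R), V (g h).
    apply: (cg 0 V); rewrite /g scale0r add0r; exact: open_nbhs_nbhs.
  apply: (@is_derive_Rintegral _ _ _ mu I01 mI muI (fun h th => F (col_mx th%:M (g h)))).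
  - by apply: filterS Vg => h Vh; exact: int_ok.
  - exact: int_ok.
  have := @unif_quotient _ _ I01 (fun h th => F (col_mx th%:M (g h)))
    (fun h th => partial (rshift 1 l) F (col_mx th%:M (g h))) 0 cI.
  rewrite /g scale0r add0r; apply.
    apply: filterS Vg => h Vh th /I01P th01.
    have E h' : col_mx th%:M (h' *: delta_mx l 0 + v) = h' *: delta_mx (rshift 1 l) 0 + col_mx th%:M v.
      apply/colP => i; rewrite -(splitK i); case: (fintype.split i) => k /=.
        by rewrite col_scalar_u mxE [X in _ + X]col_scalar_u !mxE eq_lrshift mulr0 add0r.
      by rewrite col_scalar_d [in RHS]mxE col_scalar_d !mxE (inj_eq (@rshift_inj _ _)).
    under eq_fun do rewrite E; rewrite E; apply/is_derive_line; apply: derivableP.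
    by apply: smooth_derivable sF _; rewrite -E; exact: VW.
  move=> th /I01P th01.
  apply: (@continuous_comp _ _ _ (fun z : R * R => col_mx z.2%:M (g z.1)) (partial (rshift 1 l) F)).
    apply: col_mx_continuous; first exact: cvg_snd.
    apply: (@continuous_comp _ _ _ fst g); [exact: cvg_fst|exact: cg].
  by apply: smooth_continuous sdF _; rewrite /g scale0r add0r; exact: VW.
split; first exact: (Cr_continuous (IH F sF)).
split=> [v l Vv|l]; first by case: (D v l Vv).
apply: (Cr_ext oV (f := int01 (partial (rshift 1 l) F))); last exact/IH/smooth_partial.
by move=> v Vv; rewrite /partial; case: (D v l Vv).
Qed.

End IntegralSmooth.

(** * Division by a variable *)

Section Hadamard.
Variable R : realType.

(** The quotient of [f] by its first variable, extended by the derivative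
    where that variable vanishes; it is smooth when [f] vanishes there, by
    [smooth_dquot]. *)
Definition dquot N (f : 'cV[R]_(1 + N) -> R) (w : 'cV[R]_(1 + N)) : R :=
  if w (lshift N 0) 0 == 0 then partial (lshift N 0) f w else (w (lshift N 0) 0)^-1 * f w.

Lemma dquot0 N (f : 'cV[R]_(1 + N) -> R) (w : 'cV[R]_(1 + N)) : w (lshift N 0) 0 = 0 ->
  dquot f w = partial (lshift N 0) f w.
Proof. by rewrite /dquot => ->; rewrite eqxx. Qed.

Lemma dquotN0 N (f : 'cV[R]_(1 + N) -> R) (w : 'cV[R]_(1 + N)) : w (lshift N 0) 0 != 0 ->
  dquot f w = (w (lshift N 0) 0)^-1 * f w.
Proof. by rewrite /dquot => /negPf ->. Qed.

Lemma col0E N (w : 'cV[R]_(1 + N)) : w = col_mx (w (lshift N 0) 0)%:M (dsubmx w).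
Proof.
rewrite -{1}(vsubmxK w); congr col_mx; apply/colP => i.
by rewrite (ord1 i) !mxE eqxx mulr1n.
Qed.

Lemma col_line N (h c : R) (v : 'cV[R]_N) :
  h *: delta_mx (lshift N 0) 0 + col_mx c%:M v = col_mx (h + c)%:M v :> 'cV[R]_(1 + N).
Proof.
apply/colP => i; rewrite -(splitK i); case: (fintype.split i) => k /=.
  by rewrite col_scalar_u mxE col_scalar_u !mxE (ord1 k) !eqxx mulr1.
by rewrite col_scalar_d mxE col_scalar_d !mxE eq_rlshift mulr0 add0r.
Qed.

(** Hadamard's lemma: f (t, v) / t is the integral over [0, 1] of the
    derivative of [f] in its first variable at (theta t, v), and this formula
    is also right at t = 0. *)
Lemma smooth_dquot N (f : 'cV[R]_(1 + N) -> R) (U : set 'cV[R]_N) : open U ->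
  smooth_on [set w : 'cV[R]_(1 + N) | U (dsubmx w)] f ->
  (forall v, U v -> f (col_mx 0 v) = 0) ->
  smooth_on [set w : 'cV[R]_(1 + N) | U (dsubmx w)] (dquot f).
Proof.
move=> oU sf f0.
set O := [set w : 'cV[R]_(1 + N) | U (dsubmx w)].
have oO : open O.
  apply: (@open_comp _ _ (@dsubmx _ 1 N 1) U) => // w _.
  by apply/continuous_mxP => i j; under [X in {for _, continuous X}]eq_fun do rewrite mxE; exact: coord_continuous.
(* phi (theta, t, v) = (theta t, v) *)
pose phi (z : 'cV[R]_(1 + (1 + N))) : 'cV[R]_(1 + N) :=
  col_mx (z (lshift _ 0) 0 * z (rshift 1 (lshift N 0)) 0)%:M (dsubmx (dsubmx z)).
pose W := [set z : 'cV[R]_(1 + (1 + N)) | U (dsubmx (dsubmx z))].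
have oW : open W.
  apply: (@open_comp _ _ (fun z : 'cV[R]_(1 + (1 + N)) => dsubmx (dsubmx z)) U) => // w _.
  by apply/continuous_mxP => i j; under [X in {for _, continuous X}]eq_fun do rewrite !mxE; exact: coord_continuous.
have sphi j : smooth_on W (fun z => phi z j 0).
  rewrite -(splitK j) /phi; case: (fintype.split j) => k /=.
    under eq_fun do rewrite col_scalar_u.
    by apply: smoothM => //; exact: smooth_coord.
  under eq_fun do rewrite col_scalar_d !mxE.
  exact: smooth_coord.
pose p f := partial (lshift N 0) f : 'cV[R]_(1 + N) -> R.
have sF : smooth_on W (fun z => p f (phi z)).
  apply: (smooth_comp oW oO _ sphi) (smooth_partial _ sf).
  by move=> z Wz; rewrite /O /phi /= col_mxKd.
have H := fun VW => @smooth_int01 R (1 + N) W O oO VW (fun z => p f (phi z)) sF.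
apply: (smooth_ext oO) (H _); last first.
  by move=> th v _ Ov; rewrite /W /= col_mxKd.
move=> w Ow; rewrite /dquot.
set w0 := w (lshift N 0) 0; pose pt c : 'cV[R]_(1 + N) := col_mx c%:M (dsubmx w).
have wE : pt w0 = w by rewrite /pt -col0E.
have cE (th : R) : phi (col_mx th%:M w) = pt (th * w0).
  by rewrite /phi col_mxKd col_scalar_u col_scalar_d.
case: eqP => w00.
  by apply: int01_cst => th; rewrite cE w00 mulr0 -w00 wE.
have O' th : O (pt th) by rewrite /O /pt /= col_mxKd.
have df (th : R) : is_derive th 1 (fun h => f (pt h)) (p f (pt th)).
  have pE c : pt c = c *: delta_mx (lshift N 0) 0 + pt 0 by rewrite /pt col_line addr0.
  have -> : (fun h => f (pt h)) = (fun h => f (h *: delta_mx (lshift N 0) 0 + pt 0)).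
    by apply/funext => h; rewrite pE.
  rewrite (pE th); apply/is_derive_line; apply: derivableP.
  by apply: smooth_derivable sf _; rewrite -pE; exact: O'.
(* a primitive of the integrand when t = w0 is nonzero *)
pose K (th : R) := w0^-1 * f (pt (th * w0)).
have dK (th : R) : is_derive th 1 K (p f (phi (col_mx th%:M w))).
  rewrite cE; have := is_derive_affine w0 0 th; under eq_fun do rewrite addr0.
  move=> Ha; have := is_deriveZ w0^-1 (is_derive_comp1 Ha (df (th * w0))).
  by rewrite mulrC /GRing.scale /= mulKf//; exact/eqP.
have cK th : {for th, continuous K} by exact: is_derive_continuous (dK th).
have := @continuous_FTC2 R (fun th => p f (phi (col_mx th%:M w))) K 0 1 ltr01.
rewrite /int01 /Rintegral => ->.
- rewrite /K mul1r mul0r wE /pt (_ : 0%:M = 0); last by apply/matrixP => i j; rewrite !mxE mul0rn.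
  by rewrite f0// mulr0 sube0.
- apply: continuous_in_subspaceT => th _.
  apply: (@continuous_comp _ _ _ (fun th => col_mx th%:M w) (fun z => p f (phi z))).
    by apply: col_mx_continuous; [exact: cvg_id|exact: cst_continuous].
  by apply: smooth_continuous sF _; rewrite /W /= col_mxKd.
- split.
  + by move=> th _; case: (dK th).
  + by apply: cvg_within_filter; exact: cK.
  + by apply: cvg_within_filter; exact: cK.
- by move=> th _; rewrite derive1E; case: (dK th).
Qed.

(** The mean value theorem in the direction i for f (v + h e_j) - f v, and
    then in the direction j for the partial derivative of [f]. *)
Lemma second_difference N (f : 'cV[R]_N -> R) (i j : 'I_N) (h : R) : smooth_on setT f ->
  exists2 z, `|z| <= 2 * `|h| &
    f (h *: delta_mx i 0 + h *: delta_mx j 0) - f (h *: delta_mx i 0) - (f (h *: delta_mx j 0) - f 0) =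
    h * (h * partial j (partial i f) z).
Proof.
move=> sf; set a := delta_mx i 0; set b := delta_mx j 0.
have df (g : 'cV[R]_N -> R) (k : 'I_N) (u : 'cV[R]_N) : smooth_on setT g -> is_derive u (delta_mx k 0) g (partial k g u).
  by move=> sg; apply: derivableP; exact: smooth_derivable sg I.
pose F (v : 'cV[R]_N) := f (v + h *: b) - f v.
have dF u : is_derive u a F (partial i f (u + h *: b) - partial i f u).
  suff Hb : is_derive u a (fun v => f (v + h *: b)) (partial i f (u + h *: b)).
    by have := df f i u sf => Hf; exact: is_deriveB.
  have := @is_derive_line _ _ _ (fun v => f (v + h *: b)) u a 0 (partial i f (u + h *: b)).
  rewrite scale0r add0r => -[H _]; apply: H; under eq_fun do rewrite -addrA.
  by apply/is_derive_line; rewrite scale0r add0r; exact: df.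
have [|c ch E] := @line_MVT _ _ F 0 a h; first by move=> c _; case: (dF (c *: a + 0)).
have [_ Ec] := dF (c *: a + 0); rewrite {}Ec in E.
have [|d dh E'] := @line_MVT _ _ (partial i f) (c *: a + 0) b h.
  by move=> d _; case: (df _ j (d *: b + (c *: a + 0)) (smooth_partial i sf)).
exists (d *: b + (c *: a + 0)).
  have n1 k : `|delta_mx k 0 : 'cV[R]_N| <= 1.
    by apply: mx_norm_le => // p q; rewrite mxE; case: (_ && _); rewrite ?normr1 ?normr0.
  rewrite addr0 (le_trans (ler_normD _ _))// mulrDl mul1r lerD// normrZ.
    by rewrite (le_trans _ dh)// ler_piMr// n1.
  by rewrite (le_trans _ ch)// ler_piMr// n1.
rewrite -[partial j _ _]/('D_b (partial i f) (d *: b + (c *: a + 0))) -E' [h *: b + _]addrC -E /F.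
by rewrite addr0 add0r.
Qed.

(** The second difference is symmetric in [i] and [j], so by
    [second_difference] the two mixed derivatives agree at two points that are
    arbitrarily close to 0. *)
Lemma Schwarz N (f : 'cV[R]_N -> R) (i j : 'I_N) : smooth_on setT f ->
  partial i (partial j f) 0 = partial j (partial i f) 0.
Proof.
move=> sf; apply/eqP/negPn/negP => ne.
pose P := partial i (partial j f); pose Q := partial j (partial i f).
pose e := `|P 0 - Q 0| / 2; have e0 : 0 < e by rewrite divr_gt0// normr_gt0 subr_eq0.
have cP : {for 0, continuous P} by apply: smooth_continuous (smooth_partial i (smooth_partial j sf)) I.
have cQ : {for 0, continuous Q} by apply: smooth_continuous (smooth_partial j (smooth_partial i sf)) I.
have /nbhs_ballP[r /= r0 H] : \forall z \near (0 : 'cV[R]_N), `|P 0 - P z| < e /\ `|Q 0 - Q z| < e.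
  by apply: filterI; [exact: (cvgrPdist_lt _ _).1 cP e e0|exact: (cvgrPdist_lt _ _).1 cQ e e0].
have [z zr Ez] := second_difference j i (r / 4) sf; have [z' zr' Ez'] := second_difference i j (r / 4) sf.
have B y : `|y| <= 2 * `|r / 4| -> ball (0 : 'cV[R]_N) r y.
  rewrite mx_norm_ball /ball_ /= sub0r normrN => /le_lt_trans; apply.
  rewrite gtr0_norm ?divr_gt0//; clear -r0; lra.
have PQ : P z = Q z'.
  have h0 : r / 4 != 0 by rewrite gt_eqF// divr_gt0.
  move: Ez Ez'; rewrite [_ *: delta_mx j 0 + _]addrC => Ez Ez'.
  apply: (mulfI h0 (mulfI h0 _)); rewrite -[LHS]Ez -[RHS]Ez'.
  by rewrite !opprB addrACA [- _ + - _]addrC addrACA.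
have Hz := (H z (B z zr)).1; have Hz' := (H z' (B z' zr')).2.
have : `|P 0 - Q 0| < e + e.
  apply: le_lt_trans (ler_distD (P z) (P 0) (Q 0)) _.
  by apply: ltrD; [exact: Hz|rewrite PQ distrC; exact: Hz'].
by rewrite /e -splitr ltxx.
Qed.

End Hadamard.

(** * The Pfaffian *)

Section Pfaffian.
Variable R : realType.

(** The Pfaffian, up to the factor 2^n n!, with the pairs of indices (i, n +
    i) in place of (2i, 2i + 1). *)
Definition pf n (W : 'M[R]_(n + n)) : R :=
  \sum_(s : 'S_(n + n)) (-1) ^+ s * \prod_(i < n) W (s (lshift n i)) (s (rshift n i)).

(** A choice of n pairs of indices, read as a choice of one row index for each
    of the n + n columns. *)
Definition glue n (f : {ffun 'I_n -> 'I_(n + n) * 'I_(n + n)}) (p : 'I_(n + n)) : 'I_(n + n) :=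
  match fintype.split p with inl i => (f i).1 | inr i => (f i).2 end.

Lemma glue_l n (f : {ffun 'I_n -> 'I_(n + n) * 'I_(n + n)}) i : glue f (lshift n i) = (f i).1.
Proof. by rewrite /glue -[lshift n i]/(unsplit (inl i)) unsplitK. Qed.

Lemma glue_r n (f : {ffun 'I_n -> 'I_(n + n) * 'I_(n + n)}) i : glue f (rshift n i) = (f i).2.
Proof. by rewrite /glue -[rshift n i]/(unsplit (inr i)) unsplitK. Qed.

(** Expanding every entry of the congruent matrix turns the alternating sum
    into determinants of matrices whose rows are repeated rows of [F]. *)
Lemma pf_congrE n (W F : 'M[R]_(n + n)) : pf (F^T *m W *m F) =
  \sum_(f : {ffun 'I_n -> 'I_(n + n) * 'I_(n + n)})
     (\prod_i W (f i).1 (f i).2) * (\det (rowsub (glue f) 1%:M) * \det F).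
Proof.
have E (a b : 'I_(n + n)) : (F^T *m W *m F) a b = \sum_(z : 'I_(n + n) * 'I_(n + n)) W z.1 z.2 * (F z.1 a * F z.2 b).
  rewrite mxE -(pair_bigA _ (fun k l => W k l * (F k a * F l b))) exchange_big /=.
  apply: eq_bigr => l _; rewrite mxE mulr_suml; apply: eq_bigr => k _.
  by rewrite mxE; ring.
rewrite /pf.
under eq_bigr do under eq_bigr do rewrite E.
under eq_bigr do rewrite bigA_distr_bigA /= mulr_sumr.
rewrite exchange_big /=; apply: eq_bigr => f _.
rewrite -det_mulmx mul_rowsub_mx mul1mx /determinant mulr_sumr; apply: eq_bigr => s _.
rewrite big_split /= mulrCA; congr (_ * (_ * _)).
rewrite big_split_ord /= big_split /=; congr (_ * _); apply: eq_bigr => i _; rewrite mxE.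
  by rewrite glue_l.
by rewrite glue_r.
Qed.

(** Both sides have the same expansion, since the one of [pf W] is [pf_congrE]
    for the identity. *)
Lemma pf_congr n (W F : 'M[R]_(n + n)) : pf (F^T *m W *m F) = pf W * \det F.
Proof.
have := pf_congrE W 1%:M; rewrite trmx1 mul1mx mulmx1 => ->.
rewrite pf_congrE mulr_suml; apply: eq_bigr => f _.
by rewrite det1 mulr1 mulrA.
Qed.

Definition Omega n : 'M[R]_(n + n) := block_mx 0 1%:M (- 1%:M) 0.

Lemma det_block_sym n (A B : 'M[R]_n) : \det (block_mx A B B A) = \det (A + B) * \det (A - B).
Proof.
have E : block_mx 1%:M 1%:M 0 1%:M *m block_mx A B B A *m block_mx 1%:M (- 1%:M) 0 1%:M =
    block_mx (A + B) 0 B (A - B).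
  rewrite !mulmx_block !mul1mx !mulmx1 !mul0mx !mulmx0 !addr0 !add0r !mulmxN !mulmx1.
  by rewrite [B + A]addrC addNr [- B + A]addrC.
have := congr1 determinant E.
by rewrite !det_mulmx det_lblock !det_ublock !det1 !mulr1 !mul1r.
Qed.

Definition side n (j : 'I_n) (c : bool) : 'I_(n + n) := if c then rshift n j else lshift n j.

(** Each nonzero entry of [Omega] comes from one index [j] and one of the two
    orders [c] of its pair, with sign (-1)^c. *)
Lemma OmegaE n (a b : 'I_(n + n)) : Omega n a b =
  \sum_(z : 'I_n * bool) (-1) ^+ z.2 * ((a == side z.1 z.2)%:R * (b == side z.1 (~~ z.2))%:R).
Proof.
rewrite -(pair_bigA _ (fun j c => (-1) ^+ (nat_of_bool c) * ((a == side j c)%:R * (b == side j (~~ c))%:R))) /=.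
under eq_bigr do rewrite big_bool /= expr1 expr0 mul1r mulN1r.
rewrite /Omega -(splitK a) -(splitK b); case: (fintype.split a) => i; case: (fintype.split b) => k /=.
- rewrite block_mxEul mxE big1// => j _.
  by rewrite eq_lrshift mul0r oppr0 add0r eq_lrshift mulr0.
- rewrite block_mxEur mxE (bigD1 i)//= big1 ?addr0 => [|j ji].
    by rewrite eq_lrshift mul0r oppr0 add0r eqxx mul1r (inj_eq (@rshift_inj _ _)) eq_sym.
  by rewrite eq_lrshift mul0r oppr0 add0r (inj_eq (@lshift_inj _ _)) eq_sym (negPf ji) mul0r.
- rewrite block_mxEdl !mxE (bigD1 i)//= big1 ?addr0 => [|j ji].
    by rewrite eqxx mul1r eq_rlshift mul0r addr0 (inj_eq (@lshift_inj _ _)) eq_sym.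
  by rewrite (inj_eq (@rshift_inj _ _)) eq_sym (negPf ji) mul0r eq_rlshift mul0r oppr0 addr0.
rewrite block_mxEdr mxE big1// => j _.
by rewrite eq_rlshift !mulr0 oppr0 add0r eq_rlshift mul0r.
Qed.

(** For a fixed choice of one entry of [Omega] per pair, the signed sum over
    permutations is a determinant of the shape of [det_block_sym], and its
    sign cancels the product of the signs of the chosen entries; only squares
    remain. *)
Lemma pf_OmegaE n : pf (Omega n) =
  \sum_(h : {ffun 'I_n -> 'I_n * bool}) (\det (\matrix_(i, j) (j == (h i).1)%:R : 'M[R]_n)) ^+ 2.
Proof.
rewrite /pf.
under eq_bigr do under eq_bigr do rewrite OmegaE.
under eq_bigr do rewrite bigA_distr_bigA /= mulr_sumr.
rewrite exchange_big /=; apply: eq_bigr => h _.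
set T := \matrix_(i, j) _.
(* [C] marks the pairs that are chosen in reverse order *)
pose C : 'M[R]_n := diag_mx (\row_i ((h i).2)%:R).
have -> : \sum_(s : 'S_(n + n)) (-1) ^+ s * \prod_(i < n) ((-1) ^+ (h i).2 *
      ((s (lshift n i) == side (h i).1 (h i).2)%:R * (s (rshift n i) == side (h i).1 (~~ (h i).2))%:R)) =
    (\prod_i (-1) ^+ (h i).2) * \det (block_mx ((1%:M - C) *m T) (C *m T) (C *m T) ((1%:M - C) *m T)).
  rewrite /determinant mulr_sumr; apply: eq_bigr => s _.
  rewrite big_split /= mulrCA; congr (_ * (_ * _)).
  rewrite big_split_ord /= big_split /=.
  have CT i j : (C *m T) i j = (h i).2%:R * (j == (h i).1)%:R.
    by rewrite mul_diag_mx !mxE.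
  have DT i j : ((1%:M - C) *m T) i j = (~~ (h i).2)%:R * (j == (h i).1)%:R.
    rewrite mulmxBl mul1mx mxE [X in _ + X]mxE CT mxE.
    by case: (h i).2; rewrite /= ?mul1r ?mul0r ?subrr ?subr0.
  congr (_ * _); apply: eq_bigr => i _.
    rewrite -(splitK (s (lshift n i))); case: (fintype.split _) => k /=.
      rewrite block_mxEul DT; case: (h i).2; rewrite /= ?mul0r ?mul1r ?eq_lrshift//.
    rewrite block_mxEur CT; case: (h i).2; rewrite /= ?mul0r ?mul1r ?eq_rlshift//.
    by rewrite (inj_eq (@rshift_inj _ _)).
  rewrite -(splitK (s (rshift n i))); case: (fintype.split _) => k /=.
    rewrite block_mxEdl CT; case: (h i).2; rewrite /= ?mul0r ?mul1r ?eq_lrshift//.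
  rewrite block_mxEdr DT; case: (h i).2; rewrite /= ?mul0r ?mul1r ?eq_rlshift//.
  by rewrite (inj_eq (@rshift_inj _ _)).
rewrite det_block_sym -mulmxDl subrK mul1mx -mulmxBl det_mulmx.
have -> : \det (1%:M - C - C) = \prod_i (-1) ^+ (h i).2.
  have -> : 1%:M - C - C = diag_mx (\row_i (-1) ^+ (h i).2).
    apply/matrixP => i j; rewrite !mxE; case: (i == j); rewrite ?mulr1n ?mulr0n ?subr0//.
    by case: (h i).2; rewrite ?expr1 ?expr0 /=; ring.
  by rewrite det_diag; apply: eq_bigr => i _; rewrite mxE.
set p := \prod_i _; have pp : p * p = 1.
  by rewrite -big_split /= big1// => i _; rewrite -expr2 sqrr_sign.
by transitivity ((p * p) * \det T ^+ 2); [ring|rewrite pp mul1r].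
Qed.

Lemma pf_Omega_gt0 n : 0 < pf (Omega n).
Proof.
rewrite pf_OmegaE (bigD1 [ffun i => (i, false)])//=.
rewrite (_ : \matrix_(i, j) _ = 1%:M); last first.
  by apply/matrixP => i j; rewrite !mxE ffunE /= eq_sym.
by rewrite det1 expr1n ltr_wpDr// sumr_ge0// => h _; exact: sqr_ge0.
Qed.

Lemma exists_ker_vec m N (A : 'M[R]_(m, N)) : (m < N)%N -> exists2 x : 'cV[R]_N, x != 0 & A *m x = 0.
Proof.
move=> mN; have K0 : kermx A^T != 0.
  rewrite -mxrank_eq0 mxrank_ker subn_eq0 -ltnNge.
  by rewrite (leq_ltn_trans (rank_leq_col _)).
have [i Hi] : exists i, row i (kermx A^T) != 0.
  apply/existsP; apply: contraT; rewrite negb_exists => /forallP H.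
  case/eqP: K0; apply/row_matrixP => i; rewrite row0; apply/eqP.
  by have := H i; rewrite negbK.
exists (row i (kermx A^T))^T; first by apply: contraNneq Hi => H0; rewrite -[row _ _]trmxK H0 trmx0.
by apply: trmx_inj; rewrite trmx_mul trmxK -row_mul mulmx_ker row0 trmx0.
Qed.

Lemma skew_form0 N (W : 'M[R]_N) (x : 'cV[R]_N) : W^T = - W -> x^T *m W *m x = 0.
Proof.
move=> sW; have : (x^T *m W *m x)^T = - (x^T *m W *m x).
  by rewrite !trmx_mul trmxK sW mulNmx mulmxN mulmxA.
move: (x^T *m W *m x) => q /(congr1 (fun z : 'M[R]_1 => z 0 0)).
rewrite mxE [RHS]mxE => H; apply/matrixP => i j; rewrite !ord1 [RHS]mxE; lra.
Qed.

(** Symplectic Gram-Schmidt: a pair (x, y) with x^T W y = 1 is found in the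
    W-orthogonal of the k pairs constructed so far, which is nonzero by a
    dimension count. *)
Lemma symplectic_basis n (W : 'M[R]_(n + n)) : W^T = - W -> W \in unitmx ->
  exists V : 'M[R]_(n + n), V^T *m W *m V = Omega n.
Proof.
move=> sW uW.
have sk p q (A : 'M[R]_(n + n, p)) (B : 'M[R]_(n + n, q)) : B^T *m W *m A = - (A^T *m W *m B)^T.
  by rewrite !trmx_mul trmxK sW !mulNmx mulmxN opprK mulmxA.
have [E [F [EE FF EF]]] : exists E F : 'M[R]_(n + n, n),
    [/\ E^T *m W *m E = 0, F^T *m W *m F = 0 & E^T *m W *m F = 1%:M].
  suff H k : (k <= n)%N -> exists E F : 'M[R]_(n + n, k),
    [/\ E^T *m W *m E = 0, F^T *m W *m F = 0 & E^T *m W *m F = 1%:M] by exact: H.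
  elim: k => [|k IH] kn.
    by exists 0, 0; split; apply/matrixP => -[].
  have [E [F [EE FF EF]]] := IH (ltnW kn).
  have FE : F^T *m W *m E = - 1%:M by rewrite sk EF trmx1.
  have [x x0] := @exists_ker_vec (k + k) (n + n) (col_mx (E^T *m W) (F^T *m W)) (leq_add kn (ltnW kn)).
  rewrite mul_col_mx -[0]col_mx0 => /eq_col_mx[Ex Fx].
  have xE : x^T *m W *m E = 0 by rewrite sk Ex trmx0 oppr0.
  have xF : x^T *m W *m F = 0 by rewrite sk Fx trmx0 oppr0.
  have [y0 xy0] : exists y0, x^T *m W *m y0 = 1%:M.
    have [j xj] : exists j, (x^T *m W) 0 j != 0.
      apply/existsP; apply: contraT; rewrite negb_exists => /forallP H.
      have : x^T *m W = 0 
        by apply/rowP => j; rewrite [RHS]mxE; apply/eqP; have := H j; rewrite negbK.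
      move=> /(congr1 (fun z => z *m invmx W)); rewrite mulmxK// mul0mx => xT0.
      by case/eqP: x0; apply: trmx_inj; rewrite xT0 trmx0.
    exists (((x^T *m W) 0 j)^-1 *: delta_mx j 0).
    rewrite -scalemxAr -colE; apply/matrixP => a b; rewrite !ord1 [LHS]mxE [col _ _ _ _]mxE.
    by rewrite mulVf// mxE eqxx.
  (* y0 has the right product with x; it is corrected to be orthogonal to E and F *)
  pose al := E^T *m W *m y0; pose be := F^T *m W *m y0.
  pose y := y0 - F *m al + E *m be.
  have Ey : E^T *m W *m y = 0.
    by rewrite /y mulmxDr mulmxBr (mulmxA _ F al) EF (mulmxA _ E be) EE mul1mx mul0mx addr0 subrr.
  have Fy : F^T *m W *m y = 0.
    by rewrite /y mulmxDr mulmxBr (mulmxA _ F al) FF (mulmxA _ E be) FE mul0mx subr0 mulNmx mul1mx subrr.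
  have xy : x^T *m W *m y = 1%:M.
    by rewrite /y mulmxDr mulmxBr (mulmxA _ F al) xF (mulmxA _ E be) xE !mul0mx addr0 subr0.
  have yE : y^T *m W *m E = 0 by rewrite sk Ey trmx0 oppr0.
  have yF : y^T *m W *m F = 0 by rewrite sk Fy trmx0 oppr0.
  rewrite -[k.+1]addn1; exists (row_mx E x), (row_mx F y).
  rewrite !tr_row_mx !mul_col_mx !mul_mx_row.
  rewrite EE Ex xE FF Fy yF EF Ey xF xy !skew_form0// !row_mx0 !col_mx0; split=> //.
  by rewrite -block_mxEv -scalar_mx_block.
exists (row_mx E F); rewrite tr_row_mx !mul_col_mx !mul_mx_row EE EF FF sk EF trmx1.
by rewrite /Omega block_mxEv.
Qed.

Lemma pf_neq0 n (W : 'M[R]_(n + n)) : W^T = - W -> W \in unitmx -> pf W != 0.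
Proof.
move=> sW uW; have [V VW] := symplectic_basis sW uW.
apply/eqP => p0; have := pf_congr W V; rewrite VW p0 mul0r => E.
by have := pf_Omega_gt0 n; rewrite E ltxx.
Qed.

Lemma ev_subproof n (i : 'I_n) : (i.*2 < n + n)%N.
Proof. by rewrite addnn ltn_double. Qed.
Lemma od_subproof n (i : 'I_n) : (i.*2.+1 < n + n)%N.
Proof. by rewrite addnn -doubleS leq_double. Qed.
Lemma hf_subproof n (p : 'I_(n + n)) : (p./2 < n)%N.
Proof. by rewrite ltn_half_double -addnn. Qed.

(** The relabelling of indices that sends the pair (i, n + i) to (2i, 2i + 1).
    *)
Definition evod n (p : 'I_(n + n)) : 'I_(n + n) :=
  match fintype.split p with inl i => Ordinal (ev_subproof i) | inr i => Ordinal (od_subproof i) end.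

Lemma evod_inj n : injective (@evod n).
Proof.
rewrite /evod => p q H; apply: (can_inj (@splitK _ _)); move: H.
case: (fintype.split p) => i; case: (fintype.split q) => j /(congr1 val) /= H.
- by congr inl; apply/val_inj; apply: double_inj.
- by move: (congr1 odd H); rewrite /= !odd_double.
- by move: (congr1 odd H); rewrite /= !odd_double.
- by congr inr; apply/val_inj; case: H; apply: double_inj.
Qed.

Lemma liouville_coefE n (W : 'M[R]_(n + n)) :
  liouville_coef W = (n`!%:R)^-1 * ((2 ^+ n)^-1 * ((-1) ^+ perm (@evod_inj n) * pf W)).
Proof.
rewrite /liouville_coef; congr (_ * (_ * _)).
set sg := perm (@evod_inj n).
rewrite /pf mulr_sumr [RHS](reindex_inj (mulgI sg)) /=; apply: eq_bigr => s _.
rewrite odd_permM signr_addb !mulrA -signr_addb addbb expr0 mul1r; congr (_ * _).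
rewrite (reindex_onto (fun i : 'I_n => Ordinal (ev_subproof i)) (fun p => Ordinal (hf_subproof p))) /=; last first.
  move=> p np; apply/val_inj => /=; rewrite -[RHS](odd_double_half p).
  by rewrite (negPf np).
apply: eq_big => [i|i _].
  by rewrite odd_double /=; apply/eqP/val_inj; rewrite /= doubleK.
rewrite (big_pred1 (Ordinal (od_subproof i))).
  by rewrite !permM !permE /evod -[lshift n i]/(unsplit (inl i)) -[rshift n i]/(unsplit (inr i)) !unsplitK.
by move=> q.
Qed.

(** Congruence to the standard symplectic matrix multiplies the Pfaffian by a
    determinant, and the standard one has a positive Pfaffian. This is what
    makes the volume measure charge open sets. *)
Lemma liouville_coef_neq0 n (W : 'M[R]_(n + n)) : W^T = - W -> W \in unitmx -> liouville_coef W != 0.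
Proof.
move=> sW uW; rewrite liouville_coefE !mulf_neq0 ?pf_neq0 ?signr_eq0//.
Qed.

End Pfaffian.

(** * Positive definite matrices *)

Section Posdef.
Variable R : realType.

Definition posdef m (g : 'M[R]_m) := forall X : 'cV[R]_m, X != 0 -> 0 < (X^T *m g *m X) 0 0.

Lemma posdef_unit m (g : 'M[R]_m) : posdef g -> g \in unitmx.
Proof.
move=> pg; rewrite -row_free_unit -kermx_eq0; apply/negPn/negP => K0.
have [i Hi] : exists i, row i (kermx g) != 0.
  apply/existsP; apply: contraT; rewrite negb_exists => /forallP H.
  case/eqP: K0; apply/row_matrixP => i; rewrite row0; apply/eqP.
  by have := H i; rewrite negbK.
have := pg (row i (kermx g))^T; rewrite trmxK -row_mul mulmx_ker row0 mul0mx mxE ltxx.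
by rewrite -(trmx0 R 1 m) (inj_eq trmx_inj) => /(_ Hi).
Qed.

Lemma posdefD m (g h : 'M[R]_m) : posdef g -> posdef h -> posdef (g + h).
Proof.
by move=> pg ph X X0; rewrite mulmxDr mulmxDl mxE addr_gt0 ?pg ?ph.
Qed.

Lemma posdef_congr m (g P : 'M[R]_m) : P \in unitmx -> posdef g -> posdef (P^T *m g *m P).
Proof.
move=> uP pg X X0; rewrite -!mulmxA mulmxA -trmx_mul mulmxA pg//.
by apply: contraNneq X0 => PX; rewrite -(mulKmx uP X) PX mulmx0.
Qed.

Lemma orthonormal_basis m (g : 'M[R]_m) : g^T = g -> posdef g ->
  exists P : 'M[R]_m, P^T *m g *m P = 1%:M.
Proof.
move=> sg pg; suff H k : (k <= m)%N -> exists P : 'M[R]_(m, k), P^T *m g *m P = 1%:M by exact: H.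
elim: k => [|k IH] km; first by exists 0; apply/matrixP => -[].
have [P PP] := IH (ltnW km).
have [x x0 Px] := @exists_ker_vec R k m (P^T *m g) km.
have xP : x^T *m g *m P = 0.
  by apply: trmx_inj; rewrite !trmx_mul trmxK sg mulmxA Px trmx0.
set c := (x^T *m g *m x) 0 0; have c0 : 0 < c by exact: pg.
pose d := (Num.sqrt c)^-1; have dc : d * (d * c) = 1.
  by rewrite mulrA -expr2 exprVn sqr_sqrtr ?ltW// mulVf ?gt_eqF.
rewrite -[k.+1]addn1; exists (row_mx P (d *: x)).
have -> : (row_mx P (d *: x))^T = col_mx P^T (d *: x^T).
  by rewrite tr_row_mx; congr col_mx; apply/matrixP => a b; rewrite !mxE.
rewrite !mul_col_mx !mul_mx_row PP -!scalemxAl -!scalemxAr Px xP !scaler0.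
by rewrite [x^T *m g *m x]mx11_scalar -/c !scale_scalar_mx dc -block_mxEv -scalar_mx_block.
Qed.

Lemma tr_sym_sqE m (S : 'M[R]_m) : S^T = S -> \tr (S *m S) = \sum_i \sum_j S i j ^+ 2.
Proof.
move=> sS; apply: eq_bigr => i _; rewrite mxE; apply: eq_bigr => j _.
by rewrite -{2}sS mxE expr2.
Qed.

Lemma sum_cauchy_schwarz m (a b : 'I_m -> R) :
  (\sum_j a j * b j) ^+ 2 <= (\sum_j a j ^+ 2) * (\sum_j b j ^+ 2).
Proof.
set A := \sum_j a j ^+ 2; set B := \sum_j b j ^+ 2; set C := \sum_j a j * b j.
have H (t : R) : 0 <= A + 2 * t * C + t ^+ 2 * B.
  have -> : A + 2 * t * C + t ^+ 2 * B = \sum_j (a j + t * b j) ^+ 2.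
    rewrite /A /B /C !mulr_sumr -!big_split /=; apply: eq_bigr => j _; ring.
  by apply: sumr_ge0 => j _; exact: sqr_ge0.
have B0 : 0 <= B by apply: sumr_ge0 => j _; exact: sqr_ge0.
move: B0; rewrite le_eqVlt => /predU1P[B0|B0].
  have [-> |C0] := eqVneq C 0; first by rewrite -B0 mulr0 expr0n.
  have := H (- (A + 1) / (2 * C)); rewrite -B0 mulr0 addr0.
  have -> : A + 2 * (- (A + 1) / (2 * C)) * C = -1 by field.
  by rewrite oppr_ge0 ler10.
(* the minimum of the quadratic polynomial *)
have := H (- C / B).
have -> : A + 2 * (- C / B) * C + (- C / B) ^+ 2 * B = (A * B - C ^+ 2) / B.
  by field; rewrite gt_eqF.
by rewrite pmulr_lge0 ?invr_gt0// subr_ge0.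
Qed.

Section Metric.
Variables (m : nat) (g : 'M[R]_m).
Hypotheses (sg : g^T = g) (pg : posdef g).

(** In a basis orthonormal for [g] the endomorphism g^-1 h becomes a symmetric
    matrix, and the trace of its square is the sum of the squares of the
    entries. *)
Lemma tr_raise_sq (h : 'M[R]_m) : h^T = h ->
  exists2 S : 'M[R]_m, \tr (invmx g *m h *m (invmx g *m h)) = \sum_i \sum_j S i j ^+ 2 & (S = 0 -> h = 0).
Proof.
move=> sh; have [P PP] := orthonormal_basis sg pg.
have [_ uP] := mulmx1_unit PP.
have gi : invmx g = P *m P^T.
  have : (P *m P^T) *m g = 1%:M.
    by rewrite -mulmxA; apply: mulmx1C.
  by move=> H; rewrite -[LHS]mul1mx -H mulmxK// posdef_unit.
exists (P^T *m h *m P).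
  rewrite -tr_sym_sqE; last by rewrite !trmx_mul trmxK sh mulmxA.
  rewrite gi (_ : P *m P^T *m h *m (P *m P^T *m h) = P *m (P^T *m h *m P *m P^T *m h)); last by rewrite !mulmxA.
  by rewrite mxtrace_mulC !mulmxA.
move=> S0; have uPT : P^T \in unitmx by rewrite unitmx_tr.
have : P^T *m h = 0 by rewrite -(mulmxK uP (P^T *m h)) S0 mul0mx.
by move=> H; rewrite -(mulKmx uPT h) H mulmx0.
Qed.

Lemma tr_raise_sq_ge0 (h : 'M[R]_m) : h^T = h -> 0 <= \tr (invmx g *m h *m (invmx g *m h)).
Proof.
move=> /tr_raise_sq[S -> _]; apply: sumr_ge0 => i _; apply: sumr_ge0 => j _; exact: sqr_ge0.
Qed.

Lemma tr_raise_sq_eq0 (h : 'M[R]_m) : h^T = h -> \tr (invmx g *m h *m (invmx g *m h)) = 0 -> h = 0.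
Proof.
move=> /tr_raise_sq[S -> H] S0; apply: H; apply/matrixP => i j; rewrite mxE.
have H i' : 0 <= \sum_j S i' j ^+ 2 by apply: sumr_ge0 => j' _; exact: sqr_ge0.
have /eqP := S0; rewrite psumr_eq0// => /allP /(_ i (mem_index_enum _)) /= /eqP.
move=> /eqP; rewrite psumr_eq0; last by move=> j' _; exact: sqr_ge0.
by move=> /allP /(_ j (mem_index_enum _)) /=; rewrite sqrf_eq0 => /eqP.
Qed.

(** In an orthonormal basis [B] is a symmetric matrix whose Euclidean norm is
    less than 1, so that it strictly decreases lengths by the Cauchy-Schwarz
    inequality. *)
Lemma posdef_contraction (B : 'M[R]_m) : (g *m B)^T = g *m B -> \tr (B *m B) < 1 ->
  posdef (g *m (1%:M - B *m B)).
Proof.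
move=> sB tB v v0; have [P PP] := orthonormal_basis sg pg.
have [uPg uP] := mulmx1_unit PP.
pose y := invmx P *m v; have vE : v = P *m y by rewrite mulKVmx.
have y0 : y != 0 by apply: contraNneq v0 => y0; rewrite vE y0 mulmx0.
pose S := P^T *m (g *m B) *m P.
have sS : S^T = S by rewrite /S trmx_mul [(_ *m (g *m B))^T]trmx_mul sB trmxK mulmxA.
have PS : P *m S = B *m P.
  by rewrite /S !mulmxA -[P *m P^T *m g]mulmxA (mulmx1C PP) mul1mx.
have tS : \tr (B *m B) = \sum_i \sum_j S i j ^+ 2.
  rewrite -tr_sym_sqE//; have -> : B *m B = P *m (S *m S *m invmx P).
    have -> : B = P *m S *m invmx P by rewrite PS mulmxK.
    by rewrite !mulmxA mulmxKV.
  by rewrite mxtrace_mulC mulmxKV.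
have E : v^T *m (g *m (1%:M - B *m B)) *m v = y^T *m y - (S *m y)^T *m (S *m y).
  clearbody S; have SS : P^T *m g *m B *m B *m P = S *m S.
    by rewrite -(mulmxA _ B P) -PS !mulmxA -(mulmxA _ B P) -PS !mulmxA PP mul1mx.
  clearbody y; rewrite vE !trmx_mul sS mulmxBr mulmx1 mulmxBr mulmxBl !mulmxA; congr (_ - _).
    by rewrite -(mulmxA _ P^T g) -(mulmxA _ (P^T *m g) P) PP mulmx1.
  by rewrite -(mulmxA y^T S S) -SS !mulmxA.
rewrite E mxE [X in _ + X]mxE subr_gt0.
have n2 (z : 'cV[R]_m) : (z^T *m z) 0 0 = \sum_i z i 0 ^+ 2.
  by rewrite mxE; apply: eq_bigr => i _; rewrite mxE expr2.
rewrite !n2.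
have yp : 0 < \sum_i y i 0 ^+ 2.
  rewrite lt_neqAle eq_sym sumr_ge0 ?andbT; last by move=> i _; exact: sqr_ge0.
  apply: contraNneq y0 => /eqP; rewrite psumr_eq0; last by move=> i _; exact: sqr_ge0.
  move=> /allP H; apply/eqP/colP => i; rewrite [RHS]mxE; apply/eqP.
  by have := H i (mem_index_enum _); rewrite /= sqrf_eq0.
apply: (@le_lt_trans _ _ (\tr (B *m B) * \sum_i y i 0 ^+ 2)); last by rewrite -[ltRHS]mul1r ltr_pM2r.
rewrite tS mulr_suml; apply: ler_sum => i _; rewrite mxE.
exact: sum_cauchy_schwarz.
Qed.

End Metric.

End Posdef.

(** * Tensor fields on a manifold *)

Section Manifold.
Variables (R : realType) (m : nat) (M : ptopologicalType).
Variable S : closed_manifold R m M.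
Local Notation tfield := (tfield R m M).
Local Notation img i := (Defs.coord S i @` Defs.dom S i).

Lemma open_nbhs_in (T : topologicalType) (U : set T) u : open U -> U u -> nbhs u U.
Proof. by move=> oU Uu; apply: open_nbhs_nbhs. Qed.

Lemma img_open i : open (img i).
Proof. exact: coord_open. Qed.
Arguments img_open : clear implicits.

Lemma domO x : open (Defs.dom S x).
Proof. exact: dom_open. Qed.
Arguments domO : clear implicits.

Lemma icoord_dom i u : img i u -> Defs.dom S i (icoord S i u).
Proof. by move=> [x dx <-]; rewrite coordK. Qed.

Lemma icoordK i u : img i u -> Defs.coord S i (icoord S i u) = u.
Proof. by move=> [x dx <-]; rewrite coordK. Qed.

Lemma img_coord i x : Defs.dom S i x -> img i (Defs.coord S i x).
Proof. by move=> dx; exists x. Qed.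

Lemma img_center x : img x (Defs.coord S x x).
Proof. exact/img_coord/dom_self. Qed.

Lemma icoord_center x : icoord S x (Defs.coord S x x) = x.
Proof. exact/coordK/dom_self. Qed.

Lemma overlap_open i x : open (Defs.coord S i @` (Defs.dom S i `&` Defs.dom S x)).
Proof.
have -> : Defs.coord S i @` (Defs.dom S i `&` Defs.dom S x) = img i `&` (icoord S i @^-1` Defs.dom S x).
  apply/seteqP; split=> [u [y [iy xy] <-]|u [iu xu]].
    by split; [exists y|rewrite /= coordK].
  by exists (icoord S i u); [split=> //; exact: icoord_dom|exact: icoordK].
rewrite openE => u [iu xu]; apply: filterI; first exact: open_nbhs_in (img_open i) iu.
by apply: (icoord_continuous iu); exact: open_nbhs_in (domO x) xu.
Qed.

Arguments overlap_open : clear implicits.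

(** The chain rule for the two inverse changes of coordinates gives a left
    inverse. *)
Lemma frame_unit i u : img i u -> frame S i u \in unitmx.
Proof.
move=> iu; set x := icoord S i u.
have dxi : Defs.dom S i x by exact: icoord_dom.
have dxx : Defs.dom S x x by exact: dom_self.
pose phi v := Defs.coord S x (icoord S i v); pose psi v := Defs.coord S i (icoord S x v).
pose U1 := Defs.coord S i @` (Defs.dom S i `&` Defs.dom S x); pose U2 := Defs.coord S x @` (Defs.dom S x `&` Defs.dom S i).
have U1u : U1 u by exists x => //; exact: icoordK.
have U2u : U2 (phi u) by exists x.
have psiphi v : U1 v -> psi (phi v) = v.
  by move=> [y [iy xy] <-]; rewrite /psi /phi !coordK.
pose G := \matrix_(k, j) partial j (fun v => psi v k 0) (phi u).
suff : G *m frame S i u = 1%:M by move/mulmx1_unit => [].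
apply/matrixP => k l; rewrite [LHS]mxE [RHS]mxE.
have s1 j : smooth_on U1 (fun v => phi v j 0) by exact: transition_smooth.
have s2 : smooth_on U2 (fun v => psi v k 0) by exact: transition_smooth.
have := @is_derive_comp_curve _ _ U2 (fun v => psi v k 0) (fun h : R => phi (h *: delta_mx l 0 + u)) 0
  (\col_j frame S i u j l) (overlap_open x i).
rewrite scale0r add0r => H.
have {H} : is_derive (0 : R) 1 (fun h : R => psi (phi (h *: delta_mx l 0 + u)) k 0)
    (\sum_j (\col_j frame S i u j l) j 0 * partial j (fun v => psi v k 0) (phi u)).
  apply: H => //.
  - by move=> v j Uv; exact: smooth_derivable s2 Uv.
  - by move=> j; exact: smooth_continuous (smooth_partial j s2) U2u.
  move=> j; rewrite !mxE; apply/(is_derive_line (fun v => phi v j 0)); rewrite scale0r add0r.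
  by apply: derivableP; exact: smooth_derivable (s1 j) U1u.
move=> [_ H].
have [_ H2] : is_derive (0 : R) 1 (fun h : R => (h *: delta_mx l 0 + u) k 0) ((delta_mx l 0 : 'cV[R]_m) k 0).
  by apply/(is_derive_line (fun v : 'cV[R]_m => v k 0)); exact: is_derive_coord.
have -> : \sum_j G k j * frame S i u j l = \sum_j (\col_j frame S i u j l) j 0 * partial j (fun v => psi v k 0) (phi u).
  by apply: eq_bigr => j _; rewrite [G _ _]mxE [(\col_j _) _ _]mxE mulrC.
rewrite -H.
have -> : 'D_1 (fun h : R => psi (phi (h *: delta_mx l 0 + u)) k 0) 0 = 'D_1 (fun h : R => (h *: delta_mx l 0 + u) k 0) 0.
  apply: near_eq_derive.
  have c0 : {for 0, continuous (fun h : R => h *: delta_mx l 0 + u)}.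
    by apply: continuousD; [exact: scalel_continuous|exact: cst_continuous].
  have : \forall h \near (0 : R), U1 (h *: delta_mx l 0 + u).
    apply: c0; rewrite scale0r add0r; exact: open_nbhs_in (overlap_open i x) U1u.
  by apply: filterS => h Uh; rewrite psiphi.
by rewrite H2 mxE eqxx andbT.
Qed.

Lemma frame_center x : frame S x (Defs.coord S x x) = 1%:M.
Proof.
apply/matrixP => k l; rewrite !mxE icoord_center /partial.
have -> : 'D_(delta_mx l 0) (fun v => Defs.coord S x (icoord S x v) k 0) (Defs.coord S x x) =
    'D_(delta_mx l 0) (fun v : 'cV[R]_m => v k 0) (Defs.coord S x x).
  apply: near_eq_derive; have : \forall v \near Defs.coord S x x, img x v.
    exact: open_nbhs_in (img_open x) (img_center x).
  by apply: filterS => v xv; rewrite icoordK.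
by case: (is_derive_coord k (Defs.coord S x x) (delta_mx l 0)) => _ ->; rewrite mxE eqxx andbT.
Qed.

(** Covariant 2-tensors and endomorphisms are treated together: their
    transformation laws only differ by the left factor, the transpose of the
    frame or its inverse. *)
Definition lfactor := M -> 'cV[R]_m -> 'M[R]_m.
Definition L02 : lfactor := fun i u => (frame S i u)^T.
Definition L11 : lfactor := fun i u => invmx (frame S i u).

Definition compL (L : lfactor) (i : M) (t : tfield) (u : 'cV[R]_m) : 'M[R]_m :=
  L i u *m t (icoord S i u) *m frame S i u.

Definition tdom k (D : set 'cV[R]_k) (i : M) : set 'cV[R]_(k + m) :=
  [set w | D (usubmx w) /\ img i (dsubmx w)].

(** For the left factor [L02] this is convertible to the smoothness of
    families of 2-forms. *)
Definition sfam (L : lfactor) k (D : set 'cV[R]_k) (p : 'cV[R]_k -> tfield) : Prop :=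
  forall i, msmooth (tdom D i) (fun w => compL L i (p (usubmx w)) (dsubmx w)).

Lemma sub_continuous k (w : 'cV[R]_(k + m)) :
  {for w, continuous (@usubmx R k m 1)} /\ {for w, continuous (@dsubmx R k m 1)}.
Proof.
by split; apply/continuous_mxP => i j;
  under [X in {for _, continuous X}]eq_fun do rewrite mxE; exact: coord_continuous.
Qed.

Lemma tdom_open k (D : set 'cV[R]_k) i : open D -> open (tdom D i).
Proof.
move=> oD; rewrite openE => w [Dw iw]; have [cu cd] := sub_continuous w.
apply: filterI; [apply: cu|apply: cd]; apply: open_nbhs_nbhs; split => //.
exact: coord_open.
Qed.

Arguments tdom_open : clear implicits.

Lemma tdom_col k (D : set 'cV[R]_k) i s u : D s -> img i u -> tdom D i (col_mx s u).
Proof. by move=> Ds iu; rewrite /tdom /= col_mxKu col_mxKd. Qed.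

Lemma col_mx_smooth n k (U : set 'cV[R]_n) (f : 'cV[R]_n -> 'cV[R]_k) (g : 'cV[R]_n -> 'cV[R]_m) :
  (forall j, smooth_on U (fun w => f w j 0)) -> (forall j, smooth_on U (fun w => g w j 0)) ->
  forall j, smooth_on U (fun w => col_mx (f w) (g w) j 0).
Proof.
move=> sf sg j; rewrite -(splitK j); case: (fintype.split j) => a /=.
  by under eq_fun do rewrite col_mxEu; exact: sf.
by under eq_fun do rewrite col_mxEd; exact: sg.
Qed.

Section Generic.
Variable L : lfactor.

Lemma compLD i a b u : compL L i (fun x => a x + b x) u = compL L i a u + compL L i b u.
Proof. by rewrite /compL mulmxDr mulmxDl. Qed.

Lemma sfam_sub k (D D' : set 'cV[R]_k) p : D' `<=` D -> sfam L D p -> sfam L D' p.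
Proof.
move=> DD sp i q l; apply: (smooth_sub (U := tdom D i)) (sp i q l) => w [/DD ? ?]; by split.
Qed.

Section OnD.
Variables (k : nat) (D : set 'cV[R]_k).
Hypothesis oD : open D.
Let oT i : open (tdom D i). Proof. exact: tdom_open. Qed.
Arguments oT : clear implicits.

Lemma sfam_ext p p' : (forall s x, D s -> p s x = p' s x) -> sfam L D p -> sfam L D p'.
Proof.
move=> pp sp i; apply: (msmooth_ext (oT i)) (sp i) => w [Dw iw].
by rewrite /compL pp.
Qed.

Lemma sfamD p p' : sfam L D p -> sfam L D p' -> sfam L D (fun s x => p s x + p' s x).
Proof.
move=> sp sp' i; apply: (msmooth_ext (oT i)) (msmoothD (oT i) (sp i) (sp' i)) => w _.
by rewrite compLD.
Qed.

(** Smooth families of scalar functions on the manifold. *)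
Definition scfam (f : 'cV[R]_k -> M -> R) : Prop :=
  forall i, smooth_on (tdom D i) (fun w => f (usubmx w) (icoord S i (dsubmx w))).

Lemma sfamZ f p : scfam f -> sfam L D p -> sfam L D (fun s x => f s x *: p s x).
Proof.
move=> sf sp i; apply: (msmooth_ext (oT i)) (msmoothZ (oT i) (sf i) (sp i)) => w _.
by rewrite /compL -scalemxAr -scalemxAl.
Qed.

Lemma scfam_param f : smooth_on D f -> scfam (fun s _ => f s).
Proof.
move=> sf i; apply: (smooth_comp (oT i) oD (phi := fun w => usubmx w) _ _ sf).
  by move=> w [].
by move=> j; under eq_fun do rewrite mxE; exact: smooth_coord.
Qed.

Lemma scfam_cst (c : R) : scfam (fun _ _ => c).
Proof. by move=> i; exact: (smooth_cst (oT i)). Qed.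

Lemma sfamN p : sfam L D p -> sfam L D (fun s x => - p s x).
Proof.
move=> sp; apply: (sfam_ext (p := fun s x => (-1) *: p s x)) => [s x _|].
  by rewrite scaleN1r.
exact: sfamZ (scfam_cst _) sp.
Qed.

Lemma sfamB p p' : sfam L D p -> sfam L D p' -> sfam L D (fun s x => p s x - p' s x).
Proof. by move=> sp sp'; exact: sfamD sp (sfamN sp'). Qed.

Lemma sfam_reparam k' (D' : set 'cV[R]_k') (phi : 'cV[R]_k' -> 'cV[R]_k) p :
  open D' -> (forall s, D' s -> D (phi s)) -> (forall j, smooth_on D' (fun s => phi s j 0)) ->
  sfam L D p -> sfam L D' (fun s => p (phi s)).
Proof.
move=> oD' DD sphi sp i q l; have oT' := tdom_open _ _ i oD'.
have := @smooth_comp _ _ _ (tdom D' i) (tdom D i) _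
  (fun w => col_mx (phi (usubmx w)) (dsubmx w)) oT' (oT i) _ _ (sp i q l).
move=> H; apply: (smooth_ext oT' (f := fun w : 'cV[R]_(k' + m) => compL L i (p (usubmx (col_mx (phi (usubmx w)) (dsubmx w))))
   (dsubmx (col_mx (phi (usubmx w)) (dsubmx w))) q l)) (H _ _).
- by move=> w _; rewrite col_mxKu col_mxKd.
- by move=> w [Dw iw]; apply: tdom_col => //; exact: DD.
apply: col_mx_smooth => j.
  apply: (smooth_comp oT' oD' (phi := fun w => usubmx w) _ _ (sphi j)) => [w []//|j'].
  by under eq_fun do rewrite mxE; exact: smooth_coord.
by under eq_fun do rewrite mxE; exact: smooth_coord.
Qed.

Lemma mder_line (p : 'cV[R]_k -> tfield) s (l : 'I_k) x : (forall x, msmooth D (fun s => p s x)) -> D s ->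
  mder (fun h : R => p (h *: delta_mx l 0 + s) x) 0 (\matrix_(a, b) partial l (fun s => p s x a b) s).
Proof.
move=> sp Ds a b; rewrite mxE; apply/(is_derive_line (fun s => p s x a b)).
rewrite scale0r add0r; apply: derivableP; exact: smooth_derivable (sp x a b) Ds.
Qed.

(** The frames do not depend on the parameter, so differentiation in a
    parameter commutes with taking components. *)
Lemma partial_compL (p : 'cV[R]_k -> tfield) i q r (l : 'I_k) w : (forall x, msmooth D (fun s => p s x)) -> tdom D i w ->
  partial (lshift m l) (fun w => compL L i (p (usubmx w)) (dsubmx w) q r) w =
  compL L i (fun x => \matrix_(a, b) partial l (fun s => p s x a b) (usubmx w)) (dsubmx w) q r.
Proof.
move=> sp [Dw iw].
have := @is_derive_line _ _ _ (fun w => compL L i (p (usubmx w)) (dsubmx w) q r) w (delta_mx (lshift m l) 0) 0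
  (compL L i (fun x => \matrix_(a, b) partial l (fun s => p s x a b) (usubmx w)) (dsubmx w) q r).
rewrite scale0r add0r => -[H _]; rewrite /partial; suff /H[_ HE] : is_derive (0 : R) 1
  (fun h : R => compL L i (p (usubmx (h *: delta_mx (lshift m l) 0 + w))) (dsubmx (h *: delta_mx (lshift m l) 0 + w)) q r)
  (compL L i (fun x => \matrix_(a, b) partial l (fun s => p s x a b) (usubmx w)) (dsubmx w) q r) by [].
have uE h : usubmx (h *: delta_mx (lshift m l) 0 + w) = h *: delta_mx l 0 + usubmx w.
  by apply/colP => j; rewrite !mxE (inj_eq (@lshift_inj _ _)).
have dE h : dsubmx (h *: delta_mx (lshift m l) 0 + w) = dsubmx w.
  by apply/colP => j; rewrite !mxE eq_rlshift mulr0 add0r.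
under eq_fun do rewrite uE dE.
have := mderMr (frame S i (dsubmx w)) (mderMl (L i (dsubmx w)) (mder_line l (icoord S i (dsubmx w)) sp Dw)).
exact.
Qed.

Lemma sfam_partial (p : 'cV[R]_k -> tfield) (l : 'I_k) : (forall x, msmooth D (fun s => p s x)) -> sfam L D p ->
  sfam L D (fun s x => \matrix_(a, b) partial l (fun s => p s x a b) s).
Proof.
move=> msp sp i q r; apply: (smooth_ext (oT i)) (smooth_partial (lshift m l) (sp i q r)) => w Tw.
by rewrite partial_compL.
Qed.

End OnD.

End Generic.

Lemma tr_compL i t u : img i u -> \tr (compL L11 i t u) = \tr (t (icoord S i u)).
Proof.
by move=> iu; rewrite /compL /L11 mxtrace_mulC mulmxA mulmxV ?frame_unit// mul1mx.
Qed.

Section Algebra.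
Variables (k : nat) (D : set 'cV[R]_k).
Hypothesis oD : open D.
Let oT i : open (tdom D i). Proof. exact: tdom_open. Qed.
Arguments oT : clear implicits.
Implicit Types (p E : 'cV[R]_k -> tfield).

Lemma sfamM L p E : sfam L D p -> sfam L11 D E -> sfam L D (fun s x => p s x *m E s x).
Proof.
move=> sp sE i; apply: (msmooth_ext (oT i)) (msmoothM (oT i) (sp i) (sE i)) => w [_ iw].
by rewrite /compL /L11 !mulmxA mulmxK ?frame_unit.
Qed.

Lemma sfam1 : sfam L11 D (fun _ _ => 1%:M).
Proof.
move=> i; apply: (msmooth_ext (oT i)) (msmooth_cst (oT i) 1%:M) => w [_ iw].
by rewrite /compL /L11 mulmx1 mulVmx ?frame_unit.
Qed.

Lemma sfam_trM p E : sfam L02 D p -> sfam L11 D E -> sfam L02 D (fun s x => (E s x)^T *m p s x).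
Proof.
move=> sp sE i; apply: (msmooth_ext (oT i)) (msmoothM (oT i) (msmoothT (sE i)) (sp i)) => w [_ iw].
rewrite /compL /L11 /L02 !trmx_mul !mulmxA; congr (_ *m _ *m _).
by rewrite -[LHS]mulmxA -(trmx_mul (frame S i _) (invmx _)) mulmxV ?frame_unit// trmx1 mulmx1.
Qed.

(** In components the frames at both ends of an inverse 2-form cancel, and
    what remains transforms as an endomorphism. *)
Lemma sfam_raise p a : (forall s x, D s -> p s x \in unitmx) -> sfam L02 D p -> sfam L02 D a ->
  sfam L11 D (fun s x => invmx (p s x) *m a s x).
Proof.
move=> up sp sa i.
have up' w : tdom D i w -> compL L02 i (p (usubmx w)) (dsubmx w) \in unitmx.
  by move=> [Dw iw]; rewrite /compL /L02 !unitmx_mul unitmx_tr frame_unit// up.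
apply: (msmooth_ext (oT i)) (msmoothM (oT i) (msmoothV (oT i) up' (sp i)) (sa i)) => w Tw.
have [Dw iw] := Tw; have uF := frame_unit iw; have uP := up' w Tw.
apply: (can_inj (mulKmx uP)); rewrite mulKVmx// /compL /L02 /L11 !mulmxA mulmxK//.
by rewrite mulmxK// up.
Qed.

Lemma sfamV E : (forall s x, D s -> E s x \in unitmx) -> sfam L11 D E ->
  sfam L11 D (fun s x => invmx (E s x)).
Proof.
move=> uE sE i.
have uE' w : tdom D i w -> compL L11 i (E (usubmx w)) (dsubmx w) \in unitmx.
  by move=> [Dw iw]; rewrite /compL /L11 !unitmx_mul unitmx_inv frame_unit// uE.
apply: (msmooth_ext (oT i)) (msmoothV (oT i) uE' (sE i)) => w Tw.
have [Dw iw] := Tw; have uF := frame_unit iw; have uP := uE' w Tw.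
apply: (can_inj (mulKmx uP)); rewrite mulmxV// /compL /L11 !mulmxA mulmxK//.
by rewrite mulmxK ?mulVmx// uE.
Qed.

(** The components of e^E are the exponential of the components of [E], by
    conjugation. *)
Lemma sfam_expm E : sfam L11 D E -> sfam L11 D (fun s x => expm (E s x)).
Proof.
move=> sE i; apply: (msmooth_ext (oT i)) (msmooth_expm (oT i) (sE i)) => w [_ iw].
have uF := frame_unit iw; rewrite /compL /L11 -mulmxA.
rewrite -[RHS](mulmxA (invmx _)) (expm_intertwine (P := frame S i (dsubmx w)) (Y := compL L11 i (E (usubmx w)) (dsubmx w))).
  by rewrite mulKmx// /compL /L11 mulmxA.
by rewrite /compL /L11 -!mulmxA mulKVmx.
Qed.

(** The trace does not see the frame, so it can be computed in a fixed chart
    near the given point. *)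
Lemma sfam_tr_continuous E s0 x0 : sfam L11 D E -> D s0 ->
  {for (s0, x0), continuous (fun z : 'cV[R]_k * M => \tr (E z.1 z.2))}.
Proof.
move=> sE Ds0; pose T (w : 'cV[R]_(k + m)) := \tr (compL L11 x0 (E (usubmx w)) (dsubmx w)).
pose phi (z : 'cV[R]_k * M) := col_mx z.1 (Defs.coord S x0 z.2).
have dx0 : \forall z \near (s0, x0), Defs.dom S x0 z.2.
  apply: (@cvg_snd _ _ (nbhs s0) (nbhs x0) _ (Defs.dom S x0)).
  exact: open_nbhs_in (domO x0) (dom_self S x0).
apply: (near_eq_continuous (f := fun z => T (phi z))).
  apply: filterS dx0 => z dz; have iz := img_coord dz.
  by rewrite /T /phi col_mxKu col_mxKd tr_compL// coordK.
apply: (@continuous_comp _ _ _ phi T).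
  have cc : {for (s0, x0), continuous (fun z : 'cV[R]_k * M => Defs.coord S x0 z.2)}.
    apply: (@continuous_comp _ _ _ snd (Defs.coord S x0)); first exact: cvg_snd.
    exact: Defs.coord_continuous (dom_self S x0).
  have cs : {for (s0, x0), continuous (fun z : 'cV[R]_k * M => z.1)} by exact: cvg_fst.
  apply/continuous_mxP => i j; rewrite (ord1 j) /phi -(splitK i); case: (fintype.split i) => a /=.
    under [X in {for _, continuous X}]eq_fun do rewrite col_mxEu.
    by move/continuous_mxP : cs => /(_ a 0).
  under [X in {for _, continuous X}]eq_fun do rewrite col_mxEd.
  by move/continuous_mxP : cc => /(_ a 0).
apply: (smooth_continuous (U := tdom D x0)).
  exact: (msmooth_tr (oT x0) (sE x0)).
by apply: tdom_col => //; exact: img_center.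
Qed.

End Algebra.

(** At the centre of a distinguished chart the components of a tensor are its
    entries; both kinds of left factors have this property, by [frame_center].
    *)
Definition centered (L : lfactor) := forall x, L x (Defs.coord S x x) = 1%:M.

Lemma L02_centered : centered L02.
Proof. by move=> x; rewrite /L02 frame_center trmx1. Qed.

Lemma L11_centered : centered L11.
Proof. by move=> x; rewrite /L11 frame_center invmx1. Qed.

Lemma compL_center L x t : centered L -> compL L x t (Defs.coord S x x) = t x.
Proof. by move=> cL; rewrite /compL cL frame_center mul1mx mulmx1 icoord_center. Qed.

Section Pointwise.
Variable L : lfactor.
Hypothesis cL : centered L.

Lemma sfam_pointwise k (D : set 'cV[R]_k) p x : open D -> sfam L D p -> msmooth D (fun s => p s x).
Proof.
move=> oD sp i j.
have := @smooth_comp _ _ _ D (tdom D x) _ (fun s => col_mx s (Defs.coord S x x)) oD (tdom_open _ _ x oD) _ _ (sp x i j).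
move=> H; apply: (smooth_ext oD) (H _ _).
- by move=> s _; rewrite col_mxKu col_mxKd compL_center.
- by move=> s Ds; apply: tdom_col => //; exact: img_center.
apply: col_mx_smooth => l; first exact: smooth_coord.
exact: (smooth_cst oD).
Qed.

Lemma sfam_dpartial k (D : set 'cV[R]_k) p (l : 'I_k) : open D -> sfam L D p ->
  sfam L D (fun s x => \matrix_(a, b) partial l (fun s => p s x a b) s).
Proof. by move=> oD sp; apply: sfam_partial => // x; exact: sfam_pointwise. Qed.

End Pointwise.

(** ** Curves of tensor fields *)

Definition scurve (L : lfactor) (c : R -> tfield) := sfam L setT (fun s : 'cV[R]_1 => c (s 0 0)).

Lemma scal11 (s : 'cV[R]_1) : (s 0 0)%:M = s.
Proof. by apply/matrixP => i j; rewrite !ord1 mxE eqxx mulr1n. Qed.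

Lemma scal00 (t : R) : (t%:M : 'cV[R]_1) 0 0 = t.
Proof. by rewrite mxE eqxx mulr1n. Qed.

Section Curves.
Variable L : lfactor.
Hypothesis cL : centered L.

Lemma scurve_mder c t x : scurve L c -> mder (fun s => c s x) t (velocity c t x).
Proof.
move=> sc; have := @msmooth_mder _ _ _ setT (fun s : 'cV[R]_1 => c (s 0 0) x) t I (sfam_pointwise cL x openT sc).
under [X in mder X]eq_fun do rewrite scal00.
by move=> H; rewrite /velocity (mder_derive1 H).
Qed.

Lemma velocityE c (s : 'cV[R]_1) x : scurve L c ->
  velocity c (s 0 0) x = \matrix_(a, b) partial 0 (fun s : 'cV[R]_1 => c (s 0 0) x a b) s.
Proof.
move=> sc; have := @msmooth_mder _ _ _ setT (fun s : 'cV[R]_1 => c (s 0 0) x) (s 0 0) I (sfam_pointwise cL x openT sc).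
under [X in mder X]eq_fun do rewrite scal00.
by rewrite scal11 => H; apply: mder_uniq H; exact: scurve_mder.
Qed.

Lemma scurve_velocity c : scurve L c -> scurve L (velocity c).
Proof.
move=> sc; apply: (sfam_ext openT) (sfam_dpartial cL (0 : 'I_1) openT sc) => s x _.
by rewrite velocityE.
Qed.

(** The quotient of a curve that vanishes at time 0 by the time, extended by
    the velocity. *)
Definition tquot (c : R -> tfield) (t : R) : tfield := fun x =>
  if t == 0 then velocity c 0 x else t^-1 *: c t x.

Lemma scurve_tquot c : scurve L c -> (forall x, c 0 x = 0) -> scurve L (tquot c).
Proof.
move=> sc c0 i q r.
have E : tdom [set: 'cV[R]_1] i = [set w : 'cV[R]_(1 + m) | (Defs.coord S i @` Defs.dom S i) (dsubmx w)].
  by apply/seteqP; split=> [w []|w].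
have := sc i q r; rewrite E => sci.
have := smooth_dquot (img_open i) sci => H.
apply: (smooth_ext _) (H _).
- by rewrite -E; exact: (tdom_open _ _ _ openT).
- move=> w iw; have [w0|w0] := eqVneq (w (lshift m 0) 0) 0.
    rewrite dquot0// (@partial_compL L 1 setT (fun s : 'cV[R]_1 => c (s 0 0)))//.
      have u0 : usubmx w 0 0 = 0 by rewrite mxE.
      congr (compL L i _ _ q r); apply/funext => x.
      by rewrite -(velocityE _ x sc) /tquot u0 eqxx.
    by move=> x; exact: (sfam_pointwise cL x openT sc).
  have u0 : usubmx w 0 0 = w (lshift m 0) 0 by rewrite mxE.
  by rewrite dquotN0// /compL /tquot u0 (negPf w0) -scalemxAr -scalemxAl [RHS]mxE.
move=> v iv; rewrite /compL (_ : usubmx _ 0 0 = 0); last by rewrite col_mxKu mxE.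
by rewrite c0 mulmx0 mul0mx mxE.
Qed.

End Curves.
End Manifold.
Arguments img_open {R m M} S i.
Arguments domO {R m M} S x.
Arguments overlap_open {R m M} S i x.
Arguments tdom_open {R m M} S.

(** * The Liouville measure *)

Section Lebint.
Variable R : realType.
Local Open Scope ereal_scope.

(** Monotonicity without measurability: the integral of a nonnegative function
    is a supremum over the simple functions below it. The iterated integrals
    in the definition of the volume are estimated this way. *)
Lemma ge0_le_integral_any d (T : measurableType d) (mu : {measure set T -> \bar R}) (f g : T -> \bar R) :
  (forall x, 0 <= f x) -> (forall x, f x <= g x) -> \int[mu]_x f x <= \int[mu]_x g x.
Proof.
move=> f0 fg; have g0 x : 0 <= g x by exact: le_trans (f0 x) (fg x).
rewrite !ge0_integralTE//; apply: ereal_sup_le => _ [h hf <-].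
by exists h => // x; exact: le_trans (hf x) (fg x).
Qed.

Lemma lebint_ge0 m (f : 'cV[R]_m -> \bar R) : (forall u, 0 <= f u) -> 0 <= lebint f.
Proof.
elim: m f => [|m IH] f f0 /=; first exact: f0.
by apply: integral_ge0 => t _; apply: IH => v; exact: f0.
Qed.

Lemma le_lebint m (f g : 'cV[R]_m -> \bar R) : (forall u, 0 <= f u) -> (forall u, f u <= g u) ->
  lebint f <= lebint g.
Proof.
elim: m f g => [|m IH] f g f0 fg /=; first exact: fg.
apply: ge0_le_integral_any => t; first by apply: lebint_ge0 => v; exact: f0.
by apply: IH => v; [exact: f0|exact: fg].
Qed.

Lemma lebint_box m (a : 'cV[R]_m) (r c : R) : (0 < r)%R -> (0 <= c)%R ->
  lebint (fun u => (if `[< forall i, `|u i 0 - a i 0| < r >] then c else 0)%R%:E) = (c * (2 * r) ^+ m)%:E.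
Proof.
move=> r0; elim: m a c => [|m IH] a c c0.
  by rewrite /= expr0 mulr1; case: asboolP => // H; exfalso; apply: H => -[].
rewrite /=; pose b : 'cV[R]_(1 + m) := a.
pose J := `](b (lshift m 0%R) 0 - r)%R, (b (lshift m 0%R) 0 + r)%R[%classic : set R.
have Jt (t : R) : (`|t - b (lshift m 0%R) 0| < r)%R = (t \in J).
  rewrite /J; apply/idP/idP => [|]; rewrite ?inE /= in_itv /= ltr_distl.
    by move=> /andP[? ?]; apply/andP; split; lra.
  by move=> /andP[? ?]; apply/andP; split; lra.
have E (t : R) : lebint (fun v : 'cV[R]_m => (if `[< forall i, `|col_mx (t%:M : 'cV[R]_1) v i 0 - b i 0| < r >] then c else 0)%R%:E)
    = ((c * (2 * r) ^+ m) * \1_J t)%R%:E.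
  rewrite indicE -Jt; have [tr|tr] := boolP (`|t - b (lshift m 0%R) 0| < r)%R.
    rewrite mulr1 -(IH (dsubmx b))//; congr lebint; apply/funext => v.
    congr (if _ then _ else _)%:E; apply/asboolP/asboolP => H i.
      by have := H (rshift 1 i); rewrite col_mxEd mxE.
    rewrite -(splitK i); case: (fintype.split i) => k /=.
      by rewrite col_scalar_u (ord1 k).
    by rewrite col_scalar_d; have := H k; rewrite mxE.
  rewrite mulr0 -[RHS](_ : (0 * (2 * r) ^+ m)%:E = _); last by rewrite mul0r.
  rewrite -(IH (dsubmx b) 0%R (lexx _)); congr lebint; apply/funext => v.
  rewrite [in RHS]if_same asboolF// => H.
  by have := H (lshift m 0%R); rewrite col_scalar_u (negPf tr).
under eq_integral do rewrite E.
have mJ : measurable J by exact: measurable_itv.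
under eq_integral do rewrite EFinM.
rewrite ge0_integralZl_EFin//; first last.
- by rewrite mulr_ge0// exprn_ge0// mulr_ge0// ltW.
- exact/measurable_realfun.measurable_EFinP.
have muJ : lebesgue_measure J = (2 * r)%:E.
  rewrite /J lebesgue_measure_itv /= lte_fin ltrD2l gtrN//.
  by rewrite -EFinB; congr (_%:E); ring.
rewrite integral_indic// setIT; transitivity ((c * (2 * r) ^+ m)%:E * (2 * r)%:E).
  by congr (_ * _); exact: muJ.
by rewrite -EFinM exprS; congr (_%:E); ring.
Qed.

End Lebint.

Section Volume.
Variables (R : realType) (n : nat) (M : ptopologicalType).
Variable S : closed_manifold R (n + n) M.
Variable w : tfield R (n + n) M.
Variable mu : {measure set (borel M) -> \bar R}.
Hypotheses (hw : symplectic S w) (hmu : is_volume S w mu).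
Local Notation m := (n + n)%N.
Local Notation img i := (Defs.coord S i @` Defs.dom S i).

Lemma open_borel (A : set M) : open A -> measurable (A : set (borel M)).
Proof. by move=> oA; exact: sub_sigma_algebra. Qed.

Lemma continuous_borel (f : M -> R) : continuous f -> measurable_fun setT (f : borel M -> R).
Proof.
move=> cf; apply: (measurability _ (measurable_realfun.RGenOInfty.measurableE R)) => _ [_ [x ->] <-].
rewrite setTI; apply: open_borel.
by apply: open_comp => [y _|]; [exact: cf|exact: interval_open].
Qed.

(** A coordinate box around [x]. *)
Definition cbox (x : M) (r : R) : set M :=
  [set y | Defs.dom S x y /\ forall i, `|Defs.coord S x y i 0 - Defs.coord S x x i 0| < r].

Lemma cbox_center x r : 0 < r -> cbox x r x.
Proof. by move=> r0; split=> [|i]; [exact: dom_self|rewrite subrr normr0]. Qed.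

Lemma cbox_open x r : open (cbox x r).
Proof.
rewrite openE => y [dy yr].
have cy : {for y, continuous (Defs.coord S x)} := Defs.coord_continuous dy.
apply: filterI; first exact: open_nbhs_in (domO S x) dy.
have : \forall z \near y, forall i, `|Defs.coord S x z i 0 - Defs.coord S x x i 0| < r.
  apply: filter_forall => i; move/continuous_mxP : cy => /(_ i 0) cy.
  have H : `|Defs.coord S x z i 0 - Defs.coord S x x i 0| @[z --> y] --> `|Defs.coord S x y i 0 - Defs.coord S x x i 0|.
    by apply: cvg_norm; apply: cvgB => //; exact: cvg_cst.
  by apply: (cvgr_lt _ H); exact: yr.
by [].
Qed.

(** The density of the volume in the chart at [x], up to sign. *)
Definition lv x (u : 'cV[R]_m) : R := liouville_coef (comp02 S x w u).

Lemma lv_continuous x u : img x u -> {for u, continuous (lv x)}.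
Proof.
move=> xu; have [sw _ _ _] := hw; have oI := img_open S x.
apply: (smooth_continuous (U := img x)) xu.
rewrite /lv /liouville_coef; apply: (smoothM oI (smooth_cst oI _)).
apply: (smoothM oI (smooth_cst oI _)); apply: (smooth_sum oI) => s _.
apply: (smoothM oI (smooth_cst oI _)); apply: (smooth_prod oI) => p _.
by apply: (smooth_prod oI) => q _; exact: sw.
Qed.

Lemma lv_neq0 x u : img x u -> lv x u != 0.
Proof.
move=> xu; have [_ aw uw _] := hw; apply: liouville_coef_neq0.
  by rewrite /comp02 !trmx_mul trmxK aw mulNmx mulmxN mulmxA.
by rewrite /comp02 !unitmx_mul unitmx_tr !frame_unit// uw.
Qed.

Lemma cbox_measure x r : 0 < r -> (forall u : 'cV[R]_m, (forall i, `|u i 0 - Defs.coord S x x i 0| < r) -> img x u) ->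
  mu (cbox x r) = lebint (fun u : 'cV[R]_m => ((if `[< forall i, `|u i 0 - Defs.coord S x x i 0| < r >] then 1 else 0) * `|lv x u|)%:E).
Proof.
move=> r0 rI; rewrite (hmu (i := x)); first last.
- by move=> y [].
- exact: open_borel (cbox_open x r).
congr lebint; apply/funext => u; congr ((_ * _)%:E); rewrite indicE.
case: asboolP => H; case: (boolP (_ \in _)); rewrite ?inE ?notin_setE => H'//; exfalso.
  apply: H'; have [y dy yu] := rI u H; exists y => //; split=> // i; rewrite yu; exact: H.
by apply: H => i; case: H' => y [dy yr] <-; exact: yr.
Qed.

Lemma small_box x (P : 'cV[R]_m -> Prop) : (\forall u \near Defs.coord S x x, P u) ->
  exists2 r, 0 < r & forall u : 'cV[R]_m, (forall i, `|u i 0 - Defs.coord S x x i 0| < r) -> img x u /\ P u.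
Proof.
move=> nP; have : \forall u \near Defs.coord S x x, img x u /\ P u.
  by apply: filterI => //; exact: open_nbhs_in (img_open S x) (img_center S x).
move=> /nbhs_ballP[r /= r0 H]; exists r => // u ur; apply: H.
split => // i j; rewrite (ord1 j) /ball /= distrC; exact: ur.
Qed.

(** Around each point the density is bounded on a small coordinate box;
    finitely many such boxes cover the manifold. *)
Lemma volume_finite : (mu setT < +oo)%E.
Proof.
have H x : exists2 r, 0 < r & (mu (cbox x r) < +oo)%E.
  have cl : `|lv x u| @[u --> Defs.coord S x x] --> `|lv x (Defs.coord S x x)|.
    have cl0 : lv x u @[u --> Defs.coord S x x] --> lv x (Defs.coord S x x) := lv_continuous (img_center S x).
    exact: cvg_norm cl0.
  have := @cvgr_le _ _ _ _ _ _ cl (`|lv x (Defs.coord S x x)| + 1).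
  rewrite ltrDl ltr01 => /(_ _ isT) /small_box[r r0 rP].
  exists r => //; rewrite cbox_measure//; last by move=> u /rP[].
  set K := `|lv x _| + 1 in rP.
  apply: (@le_lt_trans _ _ (lebint (fun u : 'cV[R]_m => (if `[< forall i, `|u i 0 - Defs.coord S x x i 0| < r >] then K else 0)%:E))).
    apply: le_lebint => u; rewrite lee_fin; first by rewrite mulr_ge0//; case: asbool.
    by case: asboolP => [/rP[_]|_]; rewrite ?mul1r ?mul0r.
  by rewrite lebint_box ?ltry// /K addr_ge0.
have [r Hr] := choice (fun x => let: ex_intro2 r a b := H x in ex_intro (fun r => 0 < r /\ (mu (cbox x r) < +oo)%E) r (conj a b)).
have := man_compact S; rewrite compact_cover => /(_ M setT (fun x => cbox x (r x))) [].
- by move=> x _; exact: cbox_open.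
- by move=> x _; exists x => //; apply: cbox_center; have [] := Hr x.
move=> D' _ cD.
have fin (s : seq M) : (mu (\big[setU/set0]_(x <- s) cbox x (r x)) < +oo)%E /\
    measurable (\big[setU/set0]_(x <- s) cbox x (r x) : set (borel M)).
  elim: s => [|x s [IH1 IH2]]; first by rewrite big_nil measure0.
  rewrite big_cons; have mx : measurable (cbox x (r x) : set (borel M)) by apply: open_borel; exact: cbox_open.
  split; last exact: measurableU.
  by apply: (le_lt_trans (measureU2 _ mx IH2)); rewrite lte_add_pinfty//; have [] := Hr x.
have [f1 f2] := fin (finmap.enum_fset D').
apply: le_lt_trans f1; apply: le_measure; rewrite ?inE//.
move=> x _; have [y yD xy] := cD x I; rewrite -bigcup_seq; exists y => //.
Qed.

Lemma continuous_bounded (f : M -> R) : continuous f -> [bounded f x | x in setT].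
Proof.
move=> cf; have [|||c _ Hc] := @compact_EVT_max M R (fun x => `|f x|) setT.
- by exists point.
- exact: man_compact S.
- by apply: continuous_subspaceT => x; apply: cvg_norm; exact: cf.
by exists (`|f c|); split => // K cK x _ /=; rewrite (le_trans _ (ltW cK))// Hc// inE.
Qed.

Lemma continuous_integrable (f : M -> R) : continuous f -> mu.-integrable setT (EFin \o (f : borel M -> R)).
Proof.
move=> cf; apply: measurable_bounded_integrable => //.
- exact: volume_finite.
- exact: continuous_borel.
exact: continuous_bounded.
Qed.

(** If [f] were positive at [x], it would be bounded below on a coordinate box
    around [x] on which the density is bounded away from 0. *)
Lemma integral_eq0 (f : M -> R) : continuous f -> (forall x, 0 <= f x) ->
  Rintegral mu setT (f : borel M -> R) = 0 -> forall x, f x = 0.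
Proof.
move=> cf f0 If x; apply/eqP; rewrite eq_le f0 andbT leNgt; apply/negP => fx.
pose e := f x / 2; have e0 : 0 < e by rewrite divr_gt0.
pose e' := `|lv x (Defs.coord S x x)| / 2.
have lx0 : 0 < `|lv x (Defs.coord S x x)| by rewrite normr_gt0 lv_neq0//; exact: img_center.
have e'0 : 0 < e' by rewrite divr_gt0.
have n1 : \forall u \near Defs.coord S x x, e' <= `|lv x u|.
  have cl : `|lv x u| @[u --> Defs.coord S x x] --> `|lv x (Defs.coord S x x)|.
    have cl0 : lv x u @[u --> Defs.coord S x x] --> lv x (Defs.coord S x x) := lv_continuous (img_center S x).
    exact: cvg_norm cl0.
  by apply: (@cvgr_ge _ _ _ _ _ _ cl e'); rewrite ltr_pdivrMr// ltr_pMr// ltr1n.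
have n2 : \forall u \near Defs.coord S x x, e <= f (icoord S x u).
  have ci : {for Defs.coord S x x, continuous (fun u => f (icoord S x u))}.
    apply: continuous_comp; [exact: icoord_continuous (img_center S x)|exact: cf].
  apply: (@cvgr_ge _ _ _ _ _ _ ci e).
  by rewrite icoord_center ltr_pdivrMr// ltr_pMr// ltr1n.
have [r r0 rP] := small_box (filterI n1 n2).
have mb : (0 < mu (cbox x r))%E.
  rewrite cbox_measure//; last by move=> u /rP[].
  apply: (@lt_le_trans _ _ (e' * (2 * r) ^+ m)%:E).
    by rewrite lte_fin mulr_gt0// exprn_gt0// mulr_gt0.
  rewrite -(lebint_box (Defs.coord S x x) r0 (ltW e'0)); apply: le_lebint => u; rewrite lee_fin.
    by case: asbool => //; exact: ltW.
  by case: asboolP => [/rP[_ [? _]]|_]; rewrite ?mul1r ?mul0r.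
have mB : measurable (cbox x r : set (borel M)) by apply: open_borel; exact: cbox_open.
have H : (e%:E * mu (cbox x r) <= \int[mu]_y (f y)%:E)%E.
  rewrite -[X in (_ * mu X)%E]setIT -(integral_indic mu measurableT mB) -ge0_integralZl_EFin//; first last.
  - exact: ltW.
  - exact/measurable_realfun.measurable_EFinP.
  apply: ge0_le_integral_any => y; first by rewrite -EFinM lee_fin mulr_ge0// ltW.
  rewrite -EFinM lee_fin indicE; case: (boolP (y \in _)); rewrite ?inE => H; last by rewrite mulr0.
  rewrite mulr1; case: H => dy yr; have [_ [_]] := rP _ yr.
  by rewrite coordK.
have : (0 < \int[mu]_y (f y)%:E)%E.
  by apply: lt_le_trans H; rewrite mule_gt0.
have fi := integrable_fin_num measurableT (continuous_integrable cf).
by rewrite -[X in (_ < X)%E]fineK// lte_fin -/(Rintegral mu setT f) If ltxx.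
Qed.

End Volume.

(** * Linear algebra of compatible metrics *)

(** For identities that hold in the free noncommutative algebra: the products are
    expanded and bracketed to the left, generalized, and the identity between
    the entries is then linear. *)
Ltac mxlin :=
  rewrite ?(mulmxDl, mulmxDr, mulmxBl, mulmxBr, mulmxN, mulNmx, mulmx1, mul1mx, mulmx0, mul0mx, opprK);
  rewrite -?scalemxAl -?scalemxAr ?mulmxA;
  repeat (match goal with |- context [?A *m ?B] => move: (A *m B) => ? end);
  apply/matrixP => ? ?; rewrite !mxE; lra.

Section Compat.
Variables (R : realType) (m : nat) (W : 'M[R]_m).
Hypotheses (aW : W^T = - W) (uW : W \in unitmx).

(** The pointwise condition on an associated metric: g(X, Y) = W(X, JY) with
    J^2 = -1. *)
Definition compat (g : 'M[R]_m) :=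
  [/\ g^T = g, posdef g & (invmx W *m g) *m (invmx W *m g) = - 1%:M].

(** The condition that the 2-form gA be tangent, in terms of the endomorphism
    A: it is symmetric for [g] and anticommutes with J. *)
Definition pact (g A : 'M[R]_m) :=
  (g *m A)^T = g *m A /\ A *m (invmx W *m g) = - ((invmx W *m g) *m A).

(** The tangent space at [g]: symmetric forms that are anti-invariant under J.
    *)
Definition ptan (g h : 'M[R]_m) :=
  h^T = h /\ (invmx W *m g)^T *m h *m (invmx W *m g) = - h.

Section AtMetric.
Variable g : 'M[R]_m.
Hypothesis cg : compat g.
Local Notation J := (invmx W *m g).

Lemma compat_unit : g \in unitmx.
Proof. by have [_ pg _] := cg; exact: posdef_unit. Qed.

Lemma invmxN (A : 'M[R]_m) : A \in unitmx -> invmx (- A) = - invmx A.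
Proof.
move=> uA; have uN : - A \in unitmx by rewrite -scaleN1r unitmxZ// unitrN unitr1.
by apply: (can_inj (mulKmx uN)); rewrite mulmxV// mulNmx mulmxN opprK mulmxV.
Qed.

Lemma compat_acs : J *m J = - 1%:M. Proof. by have [] := cg. Qed.

Lemma compat_skew : J^T *m g = - (g *m J).
Proof.
have [sg _ _] := cg; rewrite trmx_mul trmx_inv aW sg invmxN// mulmxN mulNmx.
by rewrite !mulmxA.
Qed.

Lemma ptan_pact h : ptan g h -> pact g (invmx g *m h).
Proof.
move=> [sh Jh]; have ug := compat_unit; split; first by rewrite mulKVmx.
set A := invmx g *m h; have hA : h = g *m A by rewrite mulKVmx.
move: Jh; rewrite hA (mulmxA _^T) compat_skew; have := compat_acs; move: (J) => K KK H.
have {}H : K *m A *m K = A.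
  by apply: (can_inj (mulKmx ug)); apply: oppr_inj; rewrite -H !mulNmx !mulmxA.
by rewrite -[A in LHS]H -(mulmxA (K *m A)) KK mulmxN mulmx1.
Qed.

Lemma pact_ptan A : pact g A -> ptan g (g *m A).
Proof.
move=> [sA JA]; split => //; rewrite (mulmxA _^T) compat_skew.
move: JA; have := compat_acs; move: (J) => K KK JA.
rewrite !mulNmx -!mulmxA JA !mulmxN opprK (mulmxA K) KK.
by rewrite mulNmx mul1mx mulmxN.
Qed.

Lemma pactZ c A : pact g A -> pact g (c *: A).
Proof.
move=> [sA JA]; split; first by rewrite -scalemxAr linearZ /= sA.
by rewrite -scalemxAl JA -scalemxAr scalerN.
Qed.

Lemma pactD A B : pact g A -> pact g B -> pact g (A + B).
Proof.
move=> [sA JA] [sB JB]; split; first by rewrite mulmxDr linearD /= sA sB.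
by rewrite mulmxDl JA JB mulmxDr opprD.
Qed.

Lemma ptanZ c h : ptan g h -> ptan g (c *: h).
Proof.
move=> [sA JA]; split; first by rewrite linearZ /= sA.
by rewrite -scalemxAr -scalemxAl JA scalerN.
Qed.

Lemma ptanD h k : ptan g h -> ptan g k -> ptan g (h + k).
Proof.
move=> [sA JA] [sB JB]; split; first by rewrite linearD /= sA sB.
by rewrite mulmxDr mulmxDl JA JB opprD.
Qed.

(** As A anticommutes with J, J e^A = e^-A J, so that (J e^A)^2 = J^2; and g
    e^A is the pullback of [g] by e^(A/2), hence positive. *)
Lemma compat_expm A : pact g A -> compat (g *m expm A).
Proof.
move=> [sA JA]; have [sg pg _] := cg.
have trA B : (g *m B)^T = g *m B -> (expm B)^T *m g = g *m expm B.
  rewrite trmx_mul sg => H; rewrite expm_tr; exact: expm_intertwine.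
split; first by rewrite trmx_mul sg; exact: trA.
- rewrite -(expm_half A) mulmxA -trA; last by have [] := pactZ 2^-1 (conj sA JA).
  by apply: posdef_congr => //; exact: expm_unit.
rewrite !(mulmxA (invmx W)); move: JA; have := compat_acs; move: (J) => K KK JA.
have H : K *m expm A = expm (- A) *m K.
  by apply/esym/expm_intertwine; rewrite mulNmx JA opprK.
rewrite {1}H -!mulmxA (mulmxA K K) KK mulNmx mul1mx mulmxN.
by rewrite -{2}(opprK A) expmN.
Qed.

(** The Cayley parameter X of g1 = g (1 + X) (1 - X)^-1 is that of P = g^-1
    g1. As J P = P^-1 J, conjugation by J replaces P by its inverse, hence X
    by -X. *)
Lemma compat_cayley_log g1 (X : 'M[R]_m) : compat g1 -> (g + g1) *m X = g1 - g ->
  pact g X /\ g1 *m (1%:M - X) = g *m (1%:M + X).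
Proof.
move=> [sg1 pg1 JJ1] HX; have [sg pg _] := cg; have ug := compat_unit.
have up : g + g1 \in unitmx by apply: posdef_unit; exact: posdefD.
set P := invmx g *m g1; have gP : g *m P = g1 by rewrite mulKVmx.
have PX : (1%:M + P) *m X = P - 1%:M.
  by apply: (can_inj (mulKmx ug)); rewrite mulmxA mulmxDr mulmxBr mulmx1 gP.
have uP : 1%:M + P \in unitmx.
  by move: up; rewrite -gP -{1}(mulmx1 g) -mulmxDr unitmx_mul => /andP[].
have XP : X *m (1%:M + P) = P - 1%:M.
  apply: (can_inj (mulKmx uP)); rewrite mulmxA PX; mxlin.
split; last first.
  rewrite -gP -mulmxA; congr (_ *m _).
  apply: (addIr (P *m X)); rewrite mulmxBr mulmx1 subrK -addrA.
  by move: PX; rewrite mulmxDl mul1mx => ->; rewrite addrC subrK.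
split.
  apply: (can_inj (mulmxK uP)); rewrite -[RHS]mulmxA XP mulmxBr gP mulmx1.
  have -> : (g *m X)^T *m (1%:M + P) = ((g + g1) *m X)^T.
    rewrite mulmxDl (linearD (@trmx _ _ _)) /= (mulmxDr (g *m X)^T) mulmx1; congr (_ + _).
    by rewrite !trmx_mul sg sg1 -mulmxA gP.
  by rewrite HX linearB /= sg sg1.
apply: (can_inj (mulKmx uP)); rewrite mulmxN (mulmxA _ X) PX (mulmxA _ (invmx W *m g)).
(* J P is the complex structure of g1, of square -1 *)
have PJP : P *m (invmx W *m g) *m P = invmx W *m g.
  have JP : invmx W *m g1 = invmx W *m g *m P by rewrite -gP mulmxA.
  move: JJ1; rewrite JP; have := compat_acs; move: (J) => K KK H.
  have : K *m (P *m K *m P) = - 1%:M by rewrite -H !mulmxA.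
  move=> /(congr1 (mulmx (- K))); rewrite (mulmxA (- K) K) mulNmx KK opprK mul1mx => ->.
  by rewrite mulmxN mulmx1 opprK.
have -> : (1%:M + P) *m (invmx W *m g) *m X =  P *m (invmx W *m g) *m ((1%:M + P) *m X).
  by rewrite (mulmxA _ (1%:M + P) X); congr (_ *m X); rewrite mulmxDl mul1mx mulmxDr mulmx1 PJP addrC.
rewrite PX mulmxBr PJP mulmx1 mulmxBl mul1mx; exact/esym/opprB.
Qed.

(** The form is the pullback of g (1 - X^2) by (1 - X)^-1, and its complex
    structure is conjugate to the one of [g] by 1 - X. *)
Lemma compat_cayley X : pact g X -> \tr (X *m X) < 1 ->
  1%:M - X \in unitmx /\ compat (g *m (1%:M + X) *m invmx (1%:M - X)).
Proof.
move=> [sX JX] tX; have [sg pg _] := cg; have ug := compat_unit.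
have pX := posdef_contraction sg pg sX tX.
have E : (1%:M + X) *m (1%:M - X) = 1%:M - X *m X by mxlin.
have uQ : 1%:M - X \in unitmx.
  by have := posdef_unit pX; rewrite -E !unitmx_mul => /and3P[].
split => //; set Q := 1%:M - X in uQ E *.
have QT : Q^T *m g = g *m (1%:M - X).
  rewrite /Q linearB /= trmx1 mulmxBl mulmxBr mul1mx mulmx1; congr (_ - _).
  by rewrite -[in RHS]sX trmx_mul sg.
have F : g *m (1%:M + X) *m invmx Q = (invmx Q)^T *m (g *m (1%:M - X *m X)) *m invmx Q.
  congr (_ *m _); rewrite trmx_inv; have uQT : Q^T \in unitmx by rewrite unitmx_tr.
  apply: (can_inj (mulKmx uQT)); rewrite (mulKVmx uQT) (mulmxA Q^T) QT /Q; mxlin.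
split.
- have sS : (g *m (1%:M - X *m X))^T = g *m (1%:M - X *m X).
    rewrite mulmxBr mulmx1 linearB /= sg; congr (_ - _).
    by rewrite mulmxA trmx_mul sX mulmxA; congr (_ *m _); rewrite -[in RHS]sX trmx_mul sg.
  by rewrite F (trmx_mul _ (invmx Q)) (trmx_mul _ (g *m _)) trmxK sS mulmxA.
- rewrite F; apply: posdef_congr => //; by rewrite unitmx_inv.
have JQ : (invmx W *m g) *m (1%:M + X) = Q *m (invmx W *m g).
  by rewrite /Q mulmxDr mulmxBl JX mulmx1 mul1mx opprK.
rewrite !(mulmxA (invmx W)) JQ; have := compat_acs; move: (J) => K KK.
by rewrite -!mulmxA (mulmxA (invmx Q)) mulVmx// mul1mx (mulmxA K) KK mulNmx mul1mx mulmxN mulmxV.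
Qed.

End AtMetric.

(** The J-anti-invariant part of a symmetric form is tangent, at every metric;
    this extends a tangent vector to a vector field. *)
Lemma ptan_project (a : 'M[R]_m) g : compat g -> a^T = a ->
  ptan g (2^-1 *: (a - (invmx W *m g)^T *m a *m (invmx W *m g))).
Proof.
move=> [_ _]; set K := invmx W *m g => KK sa; split; rewrite -/K; clearbody K.
  by rewrite linearZ /= linearB /= sa !trmx_mul trmxK sa !mulmxA.
have KKT : K^T *m K^T = - 1%:M by rewrite -trmx_mul KK linearN /= trmx1.
rewrite -scalemxAr -scalemxAl -scalerN; congr (_ *: _); rewrite mulmxBr mulmxBl opprB; congr (_ - _).
by rewrite !mulmxA KKT -(mulmxA _ K) KK !mulNmx mul1mx mulmxN mulmx1 opprK.
Qed.

Lemma ptan_project_id a g : ptan g a ->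
  2^-1 *: (a - (invmx W *m g)^T *m a *m (invmx W *m g)) = a.
Proof.
by move=> [_ ->]; apply/matrixP=> i j; rewrite !mxE; lra.
Qed.

(** The product rule applied to J^T c J = -c, with J = W^-1 gam. *)
Lemma ptan_mder (gam c : R -> 'M[R]_m) t v dc : (\near t, ptan (gam t) (c t)) ->
  mder gam t v -> mder c t dc ->
  dc^T = dc /\
  (invmx W *m gam t)^T *m dc *m (invmx W *m gam t) + dc =
  - ((invmx W *m v)^T *m c t *m (invmx W *m gam t) + (invmx W *m gam t)^T *m c t *m (invmx W *m v)).
Proof.
move=> nt mg mc; split.
  apply: (mder_uniq (mder_near _ (mderT mc)) mc).
  by apply: filterS nt => s [].
have mJ := mderMl (invmx W) mg.
have H := mderM (mderM (mderT mJ) mc) mJ.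
have nH : \near t, (invmx W *m gam t)^T *m c t *m (invmx W *m gam t) = - c t.
  by apply: filterS nt => s [].
have H' := mder_uniq (mder_near nH H) (mderN mc).
apply/eqP; rewrite -subr_eq0 opprK; apply/eqP.
transitivity (((invmx W *m v)^T *m c t + (invmx W *m gam t)^T *m dc) *m (invmx W *m gam t)
 + (invmx W *m gam t)^T *m c t *m (invmx W *m v) + dc).
  by rewrite mulmxDl; apply/matrixP=> i j; rewrite ![in LHS]mxE ![in RHS]mxE; ring.
by rewrite H' addNr.
Qed.

(** Symmetry passes to the derivative; differentiating J^2 = -1 gives
    anti-invariance. *)
Lemma compat_mder (gam : R -> 'M[R]_m) t v : (\near t, compat (gam t)) ->
  mder gam t v -> ptan (gam t) v.
Proof.
move=> nt mg; have ct : compat (gam t) by exact: nbhs_singleton nt.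
have sv : v^T = v.
  apply: (mder_uniq (mder_near _ (mderT mg)) mg).
  by apply: filterS nt => s [].
split => //; have mJ := mderMl (invmx W) mg.
have H0 : mder (fun s => invmx W *m gam s *m (invmx W *m gam s)) t 0.
  apply: (mder_near _ (mder_cst (- 1%:M) t)).
  by apply: filterS nt => s [].
have := mder_uniq H0 (mderM mJ mJ) => H1.
have JT : (invmx W *m gam t)^T = - (W *m (invmx W *m gam t) *m invmx W).
  by rewrite mulKVmx// trmx_mul trmx_inv aW invmxN// mulmxN; have [-> _ _] := ct.
rewrite JT; have [_ _] := ct; move: H1; move: (invmx W *m gam t) => K H1 KK.
have H2 : K *m (invmx W *m v) = - (invmx W *m v *m K).
  by apply/eqP; rewrite -addr_eq0 addrC -H1.
rewrite !mulNmx; congr (- _); rewrite -!mulmxA (mulmxA _ v) (mulmxA K) H2.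
by rewrite mulNmx -!mulmxA KK !mulmxN !mulmx1 opprK mulKVmx.
Qed.

(** With v = gA and c = gB, differentiating the anti-invariance of [c] leaves
    g (AB + BA), a J-invariant form; subtracting half of it restores
    anti-invariance. *)
Lemma ptan_nabla (gam c : R -> 'M[R]_m) t v dc : (\near t, compat (gam t)) ->
  (\near t, ptan (gam t) (c t)) -> mder gam t v -> mder c t dc ->
  ptan (gam t) (dc - 2^-1 *: (v *m (invmx (gam t) *m c t) + c t *m (invmx (gam t) *m v))).
Proof.
move=> nc nt mg mc; have ct : compat (gam t) by exact: nbhs_singleton nc.
have [sdc Hdc] := ptan_mder nt mg mc.
have tv := compat_mder nc mg; have tc : ptan (gam t) (c t) by exact: nbhs_singleton nt.
have [sA JA] := ptan_pact ct tv; have [sB JB] := ptan_pact ct tc.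
have ug := compat_unit ct; have [sg _ KK] := ct.
have vA : v = gam t *m (invmx (gam t) *m v) by rewrite mulKVmx.
have cB : c t = gam t *m (invmx (gam t) *m c t) by rewrite mulKVmx.
have KT := compat_skew ct.
move: Hdc; rewrite {1 2}vA {1 2}cB.
move: sA JA sB JB KK KT vA cB; move: (invmx (gam t) *m v) (invmx (gam t) *m c t) => A B.
rewrite !(mulmxA (invmx W)); set K := invmx W *m gam t; move=> sA JA sB JB KK KT vA cB Hdc.
rewrite /ptan -/K; clearbody K.
have gA : A^T *m gam t = gam t *m A by rewrite -sA trmx_mul sg.
have gB : B^T *m gam t = gam t *m B by rewrite -sB trmx_mul sg.
have KAK : K *m A *m K = A by rewrite -mulmxA JA mulmxN mulmxA KK mulNmx mul1mx opprK.
have KBK : K *m B *m K = B by rewrite -mulmxA JB mulmxN mulmxA KK mulNmx mul1mx opprK.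
have {}Hdc : K^T *m dc *m K + dc = gam t *m A *m B + gam t *m B *m A.
  rewrite Hdc opprD; congr (_ + _).
    rewrite trmx_mul (mulmxA _ (gam t)) -(mulmxA A^T) KT mulmxN (mulmxA A^T) gA.
    by rewrite !mulNmx opprK -!mulmxA (mulmxA K) KBK.
  by rewrite (mulmxA K^T) KT !mulNmx opprK -!mulmxA !(mulmxA K) (mulmxA (K *m B)) KBK.
have abs C : K *m C *m K = - C -> K^T *m (gam t *m C) *m K = gam t *m C.
  by move=> H; rewrite (mulmxA K^T) KT !mulNmx -!mulmxA (mulmxA K) H mulmxN opprK.
have KABK : K *m (A *m B) *m K = - (A *m B).
  by rewrite -!mulmxA JB !mulmxN (mulmxA A) JA mulNmx mulmxN opprK !mulmxA KK !mulNmx mul1mx.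
have KBAK : K *m (B *m A) *m K = - (B *m A).
  by rewrite -!mulmxA JA !mulmxN (mulmxA B) JB mulNmx mulmxN opprK !mulmxA KK !mulNmx mul1mx.
rewrite vA cB; split.
  rewrite linearB linearZ linearD /= sdc -!mulmxA; congr (_ - _ *: _).
  by rewrite !trmx_mul !sg -!mulmxA gA gB !mulmxA gA gB addrC.
rewrite mulmxBr mulmxBl -scalemxAr -scalemxAl mulmxDr mulmxDl -!(mulmxA (gam t)) (abs _ KABK) (abs _ KBAK).
move: Hdc; rewrite -!(mulmxA (gam t)) => /eqP; rewrite eq_sym -subr_eq => /eqP <-.
by apply/matrixP=> i j; rewrite ![in LHS]mxE ![in RHS]mxE; lra.
Qed.

End Compat.

(** * Calculus on the space of associated metrics *)

Lemma near_all (T : topologicalType) (t : T) (P : T -> Prop) : (forall s, P s) -> \near t, P t.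
Proof. by move=> H; exact: filterE. Qed.

Section Fields.
Variables (R : realType) (m : nat) (M : ptopologicalType).
Variable S : closed_manifold R m M.
Variable w : tfield R m M.
Hypothesis hw : symplectic S w.
Local Notation tfield := (tfield R m M).
Local Notation img i := (Defs.coord S i @` Defs.dom S i).
Local Notation L02 := (L02 S).
Local Notation L11 := (L11 S).
Local Notation AM := (AM S w).
Local Notation tangent := (tangent S w).

Lemma symp_skew x : (w x)^T = - w x. Proof. by have [] := hw. Qed.
Lemma symp_unit x : w x \in unitmx. Proof. by have [] := hw. Qed.

(** Smoothness of a single tensor field of either kind. *)
Definition sfield (L : lfactor R m M) (t : tfield) := forall i, msmooth (img i) (compL S L i t).

Lemma sfam_cst L k (D : set 'cV[R]_k) t : open D -> sfield L t -> sfam S L D (fun=> t).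
Proof.
move=> oD st i a b; have oT := tdom_open S k D i oD.
apply: (smooth_comp oT (img_open S i) (phi := fun w => dsubmx w) _ _ (st i a b)).
  by move=> z [].
by move=> j; under eq_fun do rewrite mxE; exact: smooth_coord.
Qed.

Lemma sfam_slice L k (D : set 'cV[R]_k) p s : open D -> sfam S L D p -> D s -> sfield L (p s).
Proof.
move=> oD sp Ds i a b; have oI := img_open S i; have oT := tdom_open S k D i oD.
apply: (smooth_ext oI (f := fun u => compL S L i (p (usubmx (col_mx s u))) (dsubmx (col_mx s u)) a b)).
  by move=> u _; rewrite col_mxKu col_mxKd.
apply: (smooth_comp oI oT (phi := fun u => col_mx s u) _ _ (sp i a b)).
  by move=> u iu; exact: tdom_col.
by apply: col_mx_smooth => j; [exact: smooth_cst|exact: smooth_coord].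
Qed.

Lemma mx_bilin_ext (A B : 'M[R]_m) :
  (forall X Y : 'cV[R]_m, X^T *m A *m Y = X^T *m B *m Y) -> A = B.
Proof.
move=> H; apply/matrixP => i j; have := H (delta_mx i 0) (delta_mx j 0).
rewrite !trmx_delta -!rowE -!colE => /matrixP/(_ 0 0).
by rewrite !mxE.
Qed.

(** The complex structure of an associated metric [g] can only be w^-1 g; the
    conditions on it become pointwise conditions on [g], which make no
    reference to a choice. *)
Lemma AME g : AM g <-> smooth02 S g /\ forall x, compat (w x) (g x).
Proof.
split=> [[sg [J [sJ JJ Jw Jp] gJ]]|[sg cg]]; split=> //.
  move=> x; have acsJ : invmx (w x) *m g x = J x by rewrite gJ mulKmx// symp_unit.
  have JwJ : (J x)^T *m w x *m J x = w x.
    apply: mx_bilin_ext => X Y; rewrite -(Jw x X Y) trmx_mul !mulmxA//.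
  have wJ : (J x)^T *m w x = - (w x *m J x).
    by rewrite -[in RHS]JwJ -[in RHS]mulmxA JJ mulmxN mulmx1 opprK.
  split; rewrite ?acsJ ?JJ//; first by rewrite gJ trmx_mul symp_skew mulmxN wJ opprK.
  by move=> X X0; rewrite gJ mulmxA -mulmxA; exact: Jp.
exists (acs w g); last by move=> x; rewrite mulKVmx// symp_unit.
have gw x : w x *m acs w g x = g x by rewrite mulKVmx// symp_unit.
split.
- move=> i; have oI := img_open S i.
  have [sw _ uw _] := hw.
  have := sfam_raise openT _ (sfam_cst openT (sw : sfield L02 w)) (sfam_cst openT (sg : sfield L02 g)).
  move=> /(_ 1%N (fun _ x _ => uw x)) H.
  by have := sfam_slice openT H (s := 0) Logic.I; apply.
- by move=> x; have [] := cg x.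
- move=> x X Y; have JwJ : (acs w g x)^T *m w x *m acs w g x = w x.
    have [sgx _ JJ] := cg x; rewrite -mulmxA gw -sgx -trmx_mul -{1}gw -mulmxA JJ.
    by rewrite mulmxN mulmx1 linearN /= symp_skew opprK.
  by rewrite trmx_mul -[in RHS]JwJ !mulmxA.
move=> x X X0; have [_ pg _] := cg x.
by have := pg X X0; rewrite -{1}gw !mulmxA.
Qed.

Lemma tangentE g h : tangent g h <-> smooth02 S h /\ forall x, ptan (w x) (g x) (h x).
Proof.
split=> [[sh yh Jh]|[sh th]]; split=> //.
- move=> x; split=> //; apply: mx_bilin_ext => X Y.
  by have := Jh x X Y; rewrite trmx_mul mulmxN mulNmx !mulmxA.
- by move=> x; have [] := th x.
by move=> x X Y; have [_ H] := th x; rewrite trmx_mul -mulNmx -mulmxN -H !mulmxA.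
Qed.

Lemma AM_compat g x : AM g -> compat (w x) (g x). Proof. by move=> /AME[_]. Qed.
Lemma AM_unit g x : AM g -> g x \in unitmx. Proof. by move=> /(AM_compat x)/compat_unit. Qed.
Lemma AM_smooth g : AM g -> sfield L02 g. Proof. by move=> /AME[]. Qed.
Lemma tangent_smooth g h : tangent g h -> sfield L02 h. Proof. by case. Qed.
Lemma tangent_ptan g h x : tangent g h -> ptan (w x) (g x) (h x). Proof. by move=> /tangentE[_]. Qed.
Lemma tangent_pact g h x : AM g -> tangent g h -> pact (w x) (g x) (raise g h x).
Proof.
by move=> /(AM_compat x) cg /(tangent_ptan x); apply: ptan_pact => //; [exact: symp_skew|exact: symp_unit].
Qed.

Lemma raiseK g h x : AM g -> g x *m raise g h x = h x.
Proof. by move=> gA; rewrite mulKVmx// AM_unit. Qed.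

Lemma raise_smooth g h : AM g -> sfield L02 h -> sfield L11 (raise g h).
Proof.
move=> gA sh; have := sfam_raise openT _ (sfam_cst openT (AM_smooth gA)) (sfam_cst openT sh).
move=> /(_ 1%N (fun _ x _ => AM_unit x gA)) H.
by have := sfam_slice openT H (s := 0) Logic.I; apply.
Qed.

Lemma tangentZ c g h : tangent g h -> tangent g (c *: h).
Proof.
move=> /tangentE[sh th]; apply/tangentE; split; last by move=> x; exact: ptanZ.
have H := sfamZ openT (scfam_cst (S := S) openT c) (sfam_cst openT (sh : sfield L02 h)).
exact: (sfam_slice openT (H 1%N) (s := 0) Logic.I).
Qed.

Lemma tangentD g h k : tangent g h -> tangent g k -> tangent g (h + k).
Proof.
move=> /tangentE[sh th] /tangentE[sk tk]; apply/tangentE; split; last by move=> x; exact: ptanD.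
have H := sfamD openT (sfam_cst openT (sh : sfield L02 h)) (sfam_cst openT (sk : sfield L02 k)).
exact: (sfam_slice openT (H 1%N) (s := 0) Logic.I).
Qed.

Lemma tangentB g h k : tangent g h -> tangent g k -> tangent g (h - k).
Proof. by move=> th tk; rewrite -scaleN1r; exact/tangentD/tangentZ. Qed.

(** ** Families *)

(** Smooth families of associated metrics. *)
Definition amfam k (D : set 'cV[R]_k) (p : 'cV[R]_k -> tfield) :=
  sfam S L02 D p /\ forall s, D s -> AM (p s).

Lemma amfam_expm k (D : set 'cV[R]_k) p E : open D -> amfam D p -> sfam S L11 D E ->
  (forall s x, D s -> pact (w x) (p s x) (E s x)) -> amfam D (fun s x => p s x *m expm (E s x)).
Proof.
move=> oD [sp pA] sE tE.
have H := sfamM oD sp (sfam_expm oD sE).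
split => // s Ds; apply/AME; split; first exact: sfam_slice oD H Ds.
by move=> x; apply: (compat_expm (AM_compat x (pA s Ds))); exact: tE.
Qed.

(** Smoothness of a map with values in 2-forms, without tangency: flat
    derivatives of vector fields are of this kind. *)
Definition smap (Z : tfield -> tfield) := forall k (D : set 'cV[R]_k) p, open D ->
  amfam D p -> sfam S L02 D (fun s => Z (p s)).

Lemma vector_field_smap X : vector_field S w X -> smap X.
Proof. by move=> [_ sX] k D p oD [sp pA]; exact: sX. Qed.

Lemma vector_fieldP X : (forall g, AM g -> tangent g (X g)) -> smap X -> vector_field S w X.
Proof. by move=> tX sX; split=> [//|k D p oD sp pA]; exact: sX. Qed.

Definition amcurve (c : R -> tfield) := scurve S L02 c /\ forall t, AM (c t).

Lemma amcurveE c : curve_in_AM S w setT c <-> amcurve c.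
Proof. by split=> [[sc cA]|[sc cA]]; split => // t; exact: cA. Qed.

Lemma amcurve_fam c : amcurve c -> amfam setT (fun s : 'cV[R]_1 => c (s 0 0)).
Proof. by move=> [sc cA]; split. Qed.

Lemma smap_curve Z c : smap Z -> amcurve c -> scurve S L02 (fun t => Z (c t)).
Proof. by move=> sZ cA; exact: (sZ 1%N setT _ openT (amcurve_fam cA)). Qed.

Lemma scurve_cst L t : sfield L t -> scurve S L (fun=> t).
Proof. by move=> st; exact: sfam_cst openT st. Qed.

Lemma scurveD L c d : scurve S L c -> scurve S L d -> scurve S L (fun t x => c t x + d t x).
Proof. by move=> sc sd; have H := sfamD openT sc sd; exact: H. Qed.

Lemma scurveB L c d : scurve S L c -> scurve S L d -> scurve S L (fun t x => c t x - d t x).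
Proof. by move=> sc sd; have H := sfamB openT sc sd; exact: H. Qed.

Lemma scurveM L c d : scurve S L c -> scurve S L11 d -> scurve S L (fun t x => c t x *m d t x).
Proof. by move=> sc sd; have H := sfamM openT sc sd; exact: H. Qed.

Lemma scurve_raise c d : (forall t x, c t x \in unitmx) -> scurve S L02 c -> scurve S L02 d ->
  scurve S L11 (fun t x => invmx (c t x) *m d t x).
Proof.
move=> uc sc sd; have H := sfam_raise openT _ sc sd.
by have := H (fun s x _ => uc (s 0 0) x).
Qed.

Lemma scal00_smooth : smooth_on setT (fun s : 'cV[R]_1 => s 0 0).
Proof. exact: (smooth_coord openT). Qed.

Lemma smap_tangent_curve X c : vector_field S w X -> amcurve c -> forall t, tangent (c t) (X (c t)).
Proof. by move=> [tX _] [_ cA] t; exact: tX. Qed.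

Lemma cL02 : centered S L02. Proof. exact: L02_centered. Qed.
Lemma cL11 : centered S L11. Proof. exact: L11_centered. Qed.

Lemma mder_dir N (D : set 'cV[R]_N) p q (F : 'cV[R]_N -> 'M[R]_(p, q)) (z v : 'cV[R]_N) :
  open D -> msmooth D F -> D z ->
  mder (fun h : R => F (h *: v + z)) 0 (\matrix_(a, b) \sum_j v j 0 * partial j (fun z => F z a b) z).
Proof.
move=> oD sF Dz a b; rewrite mxE.
have E : (0 : R) *: v + z = z by rewrite scale0r add0r.
rewrite -[in X in is_derive _ _ _ X]E.
apply: (is_derive_comp_curve (U := D) (f := fun z => F z a b) (phi := fun h : R => h *: v + z)) => //.
- by rewrite E.
- by move=> u l Du; exact: smooth_derivable (sF a b) Du.
- move=> l; rewrite E; apply: (smooth_continuous (U := D) _ Dz); exact: smooth_partial (sF a b).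
by move=> j; under [X in is_derive _ _ X]eq_fun do rewrite !mxE; exact: is_derive_affine.
Qed.

Definition dpart N (l : 'I_N) (F : 'cV[R]_N -> tfield) (z : 'cV[R]_N) : tfield :=
  fun x => \matrix_(a, b) partial l (fun z => F z x a b) z.

Lemma dpart_dir N (D : set 'cV[R]_N) L (F : 'cV[R]_N -> tfield) (z v : 'cV[R]_N) x :
  centered S L -> open D -> sfam S L D F -> D z ->
  mder (fun h : R => F (h *: v + z) x) 0 (\sum_j v j 0 *: dpart j F z x).
Proof.
move=> cL oD sF Dz; have := mder_dir v oD (sfam_pointwise cL x oD sF) Dz.
apply: mder_eq; apply/matrixP => a b; rewrite summxE [LHS]mxE; apply: eq_bigr => j _.
by rewrite [RHS]mxE [X in _ = _ * X]mxE.
Qed.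

Lemma dpart_mder N (D : set 'cV[R]_N) L (F : 'cV[R]_N -> tfield) (z : 'cV[R]_N) l x :
  centered S L -> open D -> sfam S L D F -> D z ->
  mder (fun h : R => F (h *: delta_mx l 0 + z) x) 0 (dpart l F z x).
Proof.
move=> cL oD sF Dz; apply: mder_eq (dpart_dir (delta_mx l 0) x cL oD sF Dz).
rewrite (bigD1 l)//= big1 ?addr0 => [|j jl]; rewrite mxE ?eqxx ?scale1r// (negPf jl).
by rewrite scale0r.
Qed.

Lemma sfam_dpart N (D : set 'cV[R]_N) L (F : 'cV[R]_N -> tfield) l :
  centered S L -> open D -> sfam S L D F -> sfam S L D (dpart l F).
Proof. by move=> cL oD sF; exact: sfam_dpartial. Qed.

(** ** Exponential curves *)

Definition gexp (g A : tfield) (t : R) : tfield := fun x => g x *m expm (t *: A x).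

Lemma gexp0 g A : gexp g A 0 = g.
Proof. by apply/funext => x; rewrite /gexp scale0r expm0 mulmx1. Qed.

Lemma gexp_mder g A t x : mder (fun s => gexp g A s x) t (gexp g A t x *m A x).
Proof. by rewrite /gexp -mulmxA; exact/mderMl/mder_expm_scale. Qed.

Lemma gexp_velocity g A t : velocity (gexp g A) t = fun x => gexp g A t x *m A x.
Proof. by apply/funext => x; exact: mder_derive1 (gexp_mder g A t x). Qed.

Lemma gexp_curve g A : AM g -> sfield L11 A -> (forall x, pact (w x) (g x) (A x)) ->
  amcurve (gexp g A).
Proof.
move=> gA sA tA.
have H : amfam setT (fun (s : 'cV[R]_1) x => g x *m expm (s 0 0 *: A x)).
  apply: (amfam_expm (p := fun=> g) openT) => [||s x _].
  - by split; [exact: sfam_cst openT (AM_smooth gA)|].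
  - have Hf : scfam S setT (fun (s : 'cV[R]_1) (_ : M) => s 0 0) := scfam_param openT scal00_smooth.
    by have H := sfamZ openT Hf (sfam_cst openT sA); exact: H.
  - exact: pactZ.
case: H => H1 H2; split; first exact: H1.
by move=> t; have := H2 t%:M Logic.I; rewrite scal00.
Qed.

Lemma tangent_curve g a : AM g -> tangent g a ->
  [/\ amcurve (gexp g (raise g a)), gexp g (raise g a) 0 = g & velocity (gexp g (raise g a)) 0 = a].
Proof.
move=> gA ta; split.
- apply: gexp_curve => //; first exact: raise_smooth (tangent_smooth ta).
  by move=> x; exact: tangent_pact.
- exact: gexp0.
- by rewrite gexp_velocity gexp0; apply/funext => x; exact: raiseK.
Qed.

(** The curve chosen in the definition of the directional derivative has the
    required properties, because the exponential curve does. *)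
Lemma along_spec g a : AM g -> tangent g a ->
  [/\ amcurve (along S w g a), along S w g a 0 = g & velocity (along S w g a) 0 = a].
Proof.
move=> gA ta; have [H1 H2 H3] := tangent_curve gA ta.
have := @xgetPex _ (fun=> g) [set gam | [/\ curve_in_AM S w setT gam, gam 0 = g & velocity gam 0 = a]].
case; first by exists (gexp g (raise g a)); split => //; exact/amcurveE.
by move=> /amcurveE.
Qed.

Lemma amcurve_mder c t x : amcurve c -> mder (fun s => c s x) t (velocity c t x).
Proof. by move=> [sc _]; apply: scurve_mder => //; exact: cL02. Qed.

Lemma amcurve_velocity c t : amcurve c -> tangent (c t) (velocity c t).
Proof.
move=> cA; have [sc aA] := cA; apply/tangentE; split.
  have H := scurve_velocity cL02 sc.
  by have := sfam_slice openT H (s := t%:M) Logic.I; rewrite scal00; apply.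
move=> x; apply: compat_mder (amcurve_mder t x cA); [exact: symp_skew|exact: symp_unit|].
by apply: near_all => s; exact: AM_compat.
Qed.

Lemma amcurve_shift c t0 : amcurve c -> amcurve (fun t => c (t0 + t)).
Proof.
move=> [sc cA]; split; last by move=> t; exact: cA.
have := sfam_reparam openT openT (phi := fun s : 'cV[R]_1 => t0%:M + s) _ _ sc.
move=> H; apply: sfam_ext (H _ _) => //; first exact: openT.
  by move=> s x _; rewrite mxE scal00.
move=> j; under eq_fun do rewrite mxE; apply: (smoothD openT); first exact: (smooth_cst openT).
exact: (smooth_coord openT).
Qed.

(** ** Independence of the representing curve *)

Definition cay (g B : tfield) (s : R) : tfield :=
  fun x => g x *m (1%:M + s *: B x) *m invmx (1%:M - s *: B x).

Lemma cay0 g B : cay g B 0 = g.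
Proof. by apply/funext => x; rewrite /cay scale0r subr0 addr0 mulmx1 invmx1 mulmx1. Qed.

Local Notation il := (lshift 1 (0 : 'I_1)).
Local Notation ir := (rshift 1 (0 : 'I_1)).

Lemma sum_ord2 (V : nmodType) (F : 'I_(1 + 1) -> V) : \sum_j F j = F il + F ir.
Proof. by rewrite big_split_ord !big_ord1. Qed.

Lemma axis_l (h : R) : ((h *: delta_mx il 0 + 0 : 'cV[R]_(1 + 1)) il 0 = h) *
  ((h *: delta_mx il 0 + 0 : 'cV[R]_(1 + 1)) ir 0 = 0).
Proof. by split; rewrite !mxE ?eqxx /= ?mulr1 ?mulr0 addr0. Qed.

Lemma axis_r (h : R) : ((h *: delta_mx ir 0 + 0 : 'cV[R]_(1 + 1)) il 0 = 0) *
  ((h *: delta_mx ir 0 + 0 : 'cV[R]_(1 + 1)) ir 0 = h).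
Proof. by split; rewrite !mxE ?eqxx /= ?mulr1 ?mulr0 addr0. Qed.

(** The family [cay g (B t) s] is defined where s^2 tr (B^2) < 1 on the whole
    manifold; compactness makes this condition open in the parameters. *)
Lemma cay_family g (B : R -> tfield) : AM g -> scurve S L11 B ->
  (forall t x, pact (w x) (g x) (B t x)) ->
  let D := [set z : 'cV[R]_(1 + 1) | forall x, (z il 0) ^+ 2 * \tr (B (z ir 0) x *m B (z ir 0) x) < 1] in
  [/\ open D, amfam D (fun z => cay g (B (z ir 0)) (z il 0)) &
      forall z x, D z -> 1%:M - z il 0 *: B (z ir 0) x \in unitmx].
Proof.
move=> gA sB tB D.
have sE : sfam S L11 setT (fun (z : 'cV[R]_(1 + 1)) x => z il 0 *: B (z ir 0) x).
  have Hf : scfam S setT (fun (z : 'cV[R]_(1 + 1)) (_ : M) => z il 0) :=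
    scfam_param openT (smooth_coord openT il).
  have HB : sfam S L11 setT (fun z : 'cV[R]_(1 + 1) => B (z ir 0)).
    have := sfam_reparam openT openT (phi := fun z : 'cV[R]_(1 + 1) => (z ir 0)%:M) _ _ sB.
    move=> H; apply: (sfam_ext openT _ (H _ _)) => //.
      by move=> s x _; rewrite scal00.
    by move=> j; rewrite (ord1 j); under eq_fun do rewrite scal00; exact: (smooth_coord openT).
  by have H := sfamZ openT Hf HB; exact: H.
have trE (z : 'cV[R]_(1 + 1)) x : \tr (z il 0 *: B (z ir 0) x *m (z il 0 *: B (z ir 0) x)) =
    (z il 0) ^+ 2 * \tr (B (z ir 0) x *m B (z ir 0) x).
  by rewrite -scalemxAl -scalemxAr scalerA mxtraceZ expr2.
have oD : open D.
  rewrite openE => /= z0 z0D.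
  pose f (z : 'cV[R]_(1 + 1)) x := \tr (z il 0 *: B (z ir 0) x *m (z il 0 *: B (z ir 0) x)).
  have H : \forall z \near z0, forall x, [set: M] x -> f z x < 1.
    apply: (tube_lt (man_compact S)).
      by move=> x _; exact: (sfam_tr_continuous openT (sfamM openT sE sE)).
    by move=> x _; rewrite /f trE; exact: z0D.
  by apply: filterS H => z Hz x; rewrite -trE; exact: Hz.
have cD z x : D z -> 1%:M - z il 0 *: B (z ir 0) x \in unitmx /\ compat (w x) (cay g (B (z ir 0)) (z il 0) x).
  move=> Dz; have pz : pact (w x) (g x) (z il 0 *: B (z ir 0) x) by exact: pactZ.
  by apply: (compat_cayley (AM_compat x gA) pz); rewrite trE; exact: Dz.
split=> [//||z x Dz]; last by have [] := cD z x Dz.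
have sE' : sfam S L11 D (fun (z : 'cV[R]_(1 + 1)) x => z il 0 *: B (z ir 0) x) by exact: sfam_sub sE.
have s1 : sfam S L11 D (fun _ _ => 1%:M) by exact: (sfam1 oD).
have H1 := sfamD oD s1 sE'.
have H2 : sfam S L11 D (fun (z : 'cV[R]_(1 + 1)) x => invmx (1%:M - z il 0 *: B (z ir 0) x)).
  apply: (sfamV oD (E := fun (z : 'cV[R]_(1 + 1)) x => 1%:M - z il 0 *: B (z ir 0) x)).
    by move=> s x Ds; have [] := cD s x Ds.
  by have H := sfamB oD s1 sE'; exact: H.
have H := sfamM oD (sfamM oD (sfam_cst oD (AM_smooth gA)) H1) H2.
split=> [|z Dz]; first exact: H.
apply/AME; split; first exact: sfam_slice oD H Dz.
by move=> x; have [] := cD z x Dz.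
Qed.

(** The Cayley parameter X = (g + c)^-1 (c - g) of a curve that starts at [g]
    vanishes at time 0, hence is t times a smooth curve [B]; and c' = 2gX' at
    time 0 gives B(0). *)
Lemma curve_cay c : amcurve c ->
  exists B : R -> tfield, [/\ scurve S L11 B, (forall t x, pact (w x) (c 0 x) (B t x)),
    (forall t, (forall x, 1%:M - t *: B t x \in unitmx) -> c t = cay (c 0) (B t) t) &
    forall x, B 0 x = 2^-1 *: raise (c 0) (velocity c 0) x].
Proof.
move=> cA; have [sc aA] := cA; set g := c 0.
have gA : AM g by exact: aA.
pose X t : tfield := fun x => invmx (g x + c t x) *m (c t x - g x).
have uX t x : g x + c t x \in unitmx.
  apply: posdef_unit; apply: posdefD; first by have [] := AM_compat x gA.
  by have [] := AM_compat x (aA t).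
have sg := scurve_cst (AM_smooth gA).
have sX : scurve S L11 X := scurve_raise uX (scurveD sg sc) (scurveB sc sg).
have X0 x : X 0 x = 0 by rewrite /X subrr mulmx0.
have gX t x : (g x + c t x) *m X t x = c t x - g x by rewrite mulKVmx.
have tX t x := compat_cayley_log (AM_compat x gA) (AM_compat x (aA t)) (gX t x).
have X'0 x : velocity X 0 x = 2^-1 *: raise g (velocity c 0) x.
  have mX := scurve_mder cL11 0 x sX; have mc := amcurve_mder 0 x cA.
  have H := mderM (mderD (mder_cst (g x) 0) mc) mX.
  have H' : mder (fun t => (g x + c t x) *m X t x) 0 (velocity c 0 x - 0).
    apply: mder_near (mderB mc (mder_cst (g x) 0)).
    by apply: near_all => t; rewrite gX.
  have := mder_uniq H H'; rewrite X0 mulmx0 !add0r subr0 -/g => E.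
  apply: (can_inj (mulKmx (AM_unit x gA))); rewrite -scalemxAr raiseK// -E mulmxDl.
  by move: (g x *m velocity X 0 x) => a; apply/matrixP => i j; rewrite !mxE; lra.
have E t x : X t x = t *: tquot X t x.
  rewrite /tquot; have [->|t0] := eqVneq t 0; first by rewrite scale0r X0.
  by rewrite scalerA mulfV// scale1r.
exists (tquot X); split.
- by have H := scurve_tquot cL11 sX X0; exact: H.
- move=> t x; rewrite /tquot; have [_|t0] := eqVneq t 0.
    rewrite X'0; apply: pactZ; apply: tangent_pact => //.
    by have := amcurve_velocity 0 cA.
  by apply: pactZ; have [] := tX t x.
- move=> t ut; apply/funext => x; rewrite /cay -E.
  have [_ <-] := tX t x; rewrite mulmxK// E; exact: ut.
by move=> x; rewrite /tquot eqxx X'0.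
Qed.

(** The curve is the diagonal of the two-parameter family [cay g (B t) s],
    which is constant for s = 0. The chain rule leaves the derivative in s at
    t = 0, and this only involves B(0). *)
Lemma velocity_cay Z c : smap Z -> amcurve c -> forall x,
  mder (fun t => Z (c t) x) 0
       (velocity (fun t => Z (cay (c 0) (fun x => 2^-1 *: raise (c 0) (velocity c 0) x) t)) 0 x).
Proof.
move=> sZ cA x; have [B [sB tB Bc B0]] := curve_cay cA.
have cA0 : AM (c 0) by case: cA.
have [] := cay_family cA0 sB tB; set D := [set z | _] => oD fp uD.
set p := fun z => _ in fp.
have sF := sZ _ _ _ oD fp.
have D0 : D 0 by move=> y; rewrite mxE expr0n /= mul0r ltr01.
have H := dpart_dir (const_mx 1) x cL02 oD sF D0.
have Hl := dpart_mder il x cL02 oD sF D0.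
have Hr := dpart_mder ir x cL02 oD sF D0.
(* constant for s = 0 *)
have Er : dpart ir (fun z => Z (p z)) 0 x = 0.
  apply: (mder_uniq Hr); apply: mder_near (mder_cst (Z (c 0) x) 0).
  by apply: near_all => h; rewrite /p !axis_r cay0.
have El : dpart il (fun z => Z (p z)) 0 x = velocity (fun t => Z (cay (c 0) (fun x => 2^-1 *: raise (c 0) (velocity c 0) x) t)) 0 x.
  apply/esym/mder_derive1; apply: mder_near Hl.
  by apply: near_all => h; rewrite /p !axis_l; congr (Z (cay _ _ _) x); apply/funext.
apply: mder_near (mder_eq _ H); last first.
  rewrite sum_ord2; move: El Er; move: (dpart il _ 0 x) (dpart ir _ 0 x) => a b -> ->.
  by rewrite scaler0 addr0 mxE scale1r.
have cphi : {for (0 : R), continuous (fun h : R => h *: const_mx 1 + 0 : 'cV[R]_(1 + 1))}.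
  apply/continuous_mxP => i j; under [X in {for _, continuous X}]eq_fun do rewrite !mxE mulr1 addr0.
  exact: cvg_id.
have : \forall h \near (0 : R), D (h *: const_mx 1 + 0).
  by apply: cphi; apply: open_nbhs_in => //; rewrite scale0r addr0.
apply: filterS => h Dh; rewrite /p !mxE mulr1 addr0 -Bc// => y.
by have := uD _ y Dh; rewrite !mxE mulr1 addr0.
Qed.

(** The derivative of a smooth map along a curve only depends on the velocity:
    by [velocity_cay] it is the derivative along a Cayley curve built from the
    velocity, for the given curve and for the one chosen in the definition
    alike. *)
Lemma ddirE Z c t x : smap Z -> amcurve c ->
  mder (fun s => Z (c s) x) t (ddir S w Z (c t) (velocity c t) x).
Proof.
move=> sZ cA; have [aA a0 aV] := along_spec (cA.2 t) (amcurve_velocity t cA).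
have H1 := velocity_cay sZ aA x; rewrite a0 aV in H1.
have cA' := amcurve_shift t cA.
have V' : velocity (fun s => c (t + s)) 0 = velocity c t.
  apply/funext => y; apply: mder_derive1.
  have Hid : is_derive (0 : R) (1 : R) (fun s : R => t + s) 1.
    by have := is_derive_affine 1 t 0; under eq_fun do rewrite mulr1 addrC.
  rewrite -[velocity c t y]scale1r; apply: (mder_comp (F := fun s => c s y) Hid).
  by rewrite addr0; exact: amcurve_mder.
have H2 := velocity_cay sZ cA' x; rewrite V' addr0 in H2.
move: (mder_derive1 H1) H2; rewrite -/(velocity _ _ _) -/(ddir S w Z (c t) (velocity c t) x) => <- H2.
have Hid : is_derive (t : R) (1 : R) (fun s : R => s - t) 1.
  by have := is_derive_affine 1 (- t) t; under eq_fun do rewrite mulr1.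
rewrite -[ddir _ _ _ _ _ _]scale1r.
apply: mder_near (mder_comp (F := fun h => Z (c (t + h)) x) Hid _).
  by apply: near_all => s /=; rewrite addrC subrK.
by rewrite subrr.
Qed.

Lemma ddir_mder Z g a x : smap Z -> AM g -> tangent g a ->
  mder (fun s => Z (gexp g (raise g a) s) x) 0 (ddir S w Z g a x).
Proof.
move=> sZ gA ta; have [cA c0 cV] := tangent_curve gA ta.
by have := ddirE 0 x sZ cA; rewrite c0 cV.
Qed.

(** A family with two parameters through [g], whose partial derivatives at 0
    are gA and gB. *)
Definition exp2 (g A B : tfield) (z : 'cV[R]_(1 + 1)) : tfield :=
  fun x => g x *m expm (z il 0 *: A x + z ir 0 *: B x).

Lemma exp2_l g A B h : exp2 g A B (h *: delta_mx il 0 + 0) = gexp g A h.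
Proof. by apply/funext => y; rewrite /exp2 /gexp !axis_l scale0r addr0. Qed.

Lemma exp2_r g A B h : exp2 g A B (h *: delta_mx ir 0 + 0) = gexp g B h.
Proof. by apply/funext => y; rewrite /exp2 /gexp !axis_r scale0r add0r. Qed.

Lemma exp2_amfam g a b : AM g -> tangent g a -> tangent g b ->
  amfam setT (exp2 g (raise g a) (raise g b)).
Proof.
move=> gA ta tb.
have sA := raise_smooth gA (tangent_smooth ta); have sB := raise_smooth gA (tangent_smooth tb).
have Hl : scfam S setT (fun (z : 'cV[R]_(1 + 1)) (_ : M) => z il 0) := scfam_param openT (smooth_coord openT il).
have Hr : scfam S setT (fun (z : 'cV[R]_(1 + 1)) (_ : M) => z ir 0) := scfam_param openT (smooth_coord openT ir).
have sC := sfamD openT (sfamZ openT Hl (sfam_cst openT sA)) (sfamZ openT Hr (sfam_cst openT sB)).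
apply: (amfam_expm (p := fun=> g) openT _ sC) => [|s y _].
  by split=> [|s _]; [have H := sfam_cst openT (AM_smooth gA); exact: H|exact: gA].
by apply: pactD; apply: pactZ; exact: tangent_pact.
Qed.

(** All directions are seen at once by a family with two parameters, in which
    the directional derivatives are given by partial derivatives. *)
Lemma ddir_linear Z g a b (r : R) : smap Z -> AM g -> tangent g a -> tangent g b ->
  ddir S w Z g (r *: a + b) = r *: ddir S w Z g a + ddir S w Z g b.
Proof.
move=> sZ gA ta tb; apply/funext => x.
have fE := exp2_amfam gA ta tb; set E := exp2 _ _ _ in fE.
have sF := sZ _ _ _ openT fE.
have Eab (p q t : R) : E (t *: col_mx p%:M q%:M + 0) = gexp g (raise g (p *: a + q *: b)) t.
  apply/funext => y; rewrite /E /exp2 /gexp; congr (_ *m expm _).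
  have -> : (t *: col_mx p%:M q%:M + 0 : 'cV[R]_(1 + 1)) il 0 = t * p by rewrite addr0 mxE col_scalar_u.
  have -> : (t *: col_mx p%:M q%:M + 0 : 'cV[R]_(1 + 1)) ir 0 = t * q.
    by rewrite addr0 mxE col_scalar_d scal00.
  by rewrite /raise mulmxDr scalerDr -!scalemxAr !scalerA.
have dE (p q : R) : ddir S w Z g (p *: a + q *: b) x =
    p *: dpart il (fun z => Z (E z)) 0 x + q *: dpart ir (fun z => Z (E z)) 0 x.
  have tpq : tangent g (p *: a + q *: b) by apply: tangentD; exact: tangentZ.
  have H := dpart_dir (z := 0) (col_mx p%:M q%:M) x cL02 openT sF Logic.I.
  apply: (mder_uniq (ddir_mder x sZ gA tpq)).
  apply: (mder_near _ (mder_eq _ H)); first by apply: near_all => t; rewrite Eab.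
  by rewrite sum_ord2 col_scalar_u col_scalar_d scal00.
move: dE; move: (dpart il _ 0 x) (dpart ir _ 0 x) => P Q dE.
have d1 := dE 1 0; rewrite (scale1r a) (scale0r b) (addr0 a) (scale1r P) (scale0r Q) (addr0 P) in d1.
have d2 := dE 0 1; rewrite (scale1r b) (scale0r a) (add0r b) (scale1r Q) (scale0r P) (add0r Q) in d2.
have d3 := dE r 1; rewrite (scale1r b) (scale1r Q) in d3.
by rewrite d3 -[RHS]/(r *: ddir S w Z g a x + ddir S w Z g b x) d1 d2.
Qed.

Lemma ddirB Z g a b : smap Z -> AM g -> tangent g a -> tangent g b ->
  ddir S w Z g (a - b) = ddir S w Z g a - ddir S w Z g b.
Proof.
move=> sZ gA ta tb; have := ddir_linear (-1) sZ gA tb ta.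
by rewrite !scaleN1r addrC => ->; rewrite addrC.
Qed.

(** The derivative of [Z] in the direction of [v] is read off at s = 0 of the
    family p e^(s p^-1 v), which has one more parameter. *)
Lemma sfam_ddir Z k (D : set 'cV[R]_k) p v : smap Z -> open D -> amfam D p -> sfam S L02 D v ->
  (forall s, D s -> tangent (p s) (v s)) -> sfam S L02 D (fun s => ddir S w Z (p s) (v s)).
Proof.
move=> sZ oD fp sv tv; have [sp pA] := fp.
pose D' := [set z : 'cV[R]_(1 + k) | D (dsubmx z)].
have oD' : open D'.
  rewrite openE => z Dz; have cd : {for z, continuous (@dsubmx R 1 k 1)}.
    apply/continuous_mxP => i j; under [X in {for _, continuous X}]eq_fun do rewrite mxE.
    exact: coord_continuous.
  by apply: cd; exact: open_nbhs_in.
have dz j : smooth_on D' (fun z : 'cV[R]_(1 + k) => dsubmx z j 0).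
  by under eq_fun do rewrite mxE; exact: (smooth_coord oD').
have sd L q : sfam S L D q -> sfam S L D' (fun z => q (dsubmx z)).
  by move=> sq; have H := sfam_reparam oD oD' (phi := fun z => dsubmx z) (fun _ h => h) dz sq; exact: H.
have sr : sfam S L11 D (fun s x => raise (p s) (v s) x).
  by apply: (sfam_raise oD _ sp sv) => s x Ds; exact: AM_unit (pA s Ds).
have s0 : scfam S D' (fun (z : 'cV[R]_(1 + k)) (_ : M) => z (lshift k 0) 0) :=
  scfam_param oD' (smooth_coord oD' (lshift k 0)).
have sE := sfamZ oD' s0 (sd _ _ sr).
have fE := amfam_expm oD' (conj (sd _ _ sp) (fun z Dz => pA _ Dz)) sE.
have {}fE := fE (fun z x Dz => pactZ _ (tangent_pact x (pA _ Dz) (tv _ Dz))).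
set E := fun (z : 'cV[R]_(1 + k)) x => _ in fE.
have sF := sZ _ _ _ oD' fE.
have sG := sfam_dpart (lshift k 0) cL02 oD' sF.
have H : sfam S L02 D (fun s => dpart (lshift k 0) (fun z => Z (E z)) (col_mx 0 s)).
  have H := sfam_reparam oD' oD (phi := fun s => col_mx 0 s) _ _ sG; apply: H.
    by move=> s Ds; rewrite /D' /= col_mxKd.
  move=> j; rewrite -(splitK j); case: (fintype.split j) => l /=.
    by under eq_fun do rewrite col_mxEu; exact: (smooth_cst oD).
  by under eq_fun do rewrite col_mxEd; exact: (smooth_coord oD).
apply: (sfam_ext oD _ H) => s x Ds.
have D's : D' (col_mx 0 s) by rewrite /D' /= col_mxKd.
have Hm := dpart_mder (lshift k 0) x cL02 oD' sF D's.
apply: (mder_uniq Hm); apply: mder_near (ddir_mder x sZ (pA s Ds) (tv s Ds)).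
have e0 : (0 : 'cV[R]_1) = (0 : R)%:M by rewrite raddf0.
have EE h : E (h *: delta_mx (lshift k 0) 0 + col_mx 0 s) = gexp (p s) (raise (p s) (v s)) h.
  by apply/funext => y; rewrite /E /gexp e0 col_line col_mxKd col_scalar_u addr0.
by apply: near_all => h; rewrite EE.
Qed.

(** ** Second derivatives *)

Lemma amfam_line N (E : 'cV[R]_N -> tfield) z v : amfam setT E -> amcurve (fun h : R => E (h *: v + z)).
Proof.
move=> [sE EA]; split=> [|h]; last exact: EA.
have H := sfam_reparam openT openT (phi := fun s : 'cV[R]_1 => s 0 0 *: v + z) _ _ sE.
apply: H => // j; under eq_fun do rewrite !mxE.
apply: (smoothD openT); last exact: (smooth_cst openT).
by apply: (smoothM openT); [exact: (smooth_coord openT)|exact: (smooth_cst openT)].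
Qed.

Lemma amfam_line_velocity N (E : 'cV[R]_N -> tfield) z l : amfam setT E ->
  velocity (fun h : R => E (h *: delta_mx l 0 + z)) 0 = dpart l E z.
Proof.
move=> [sE _]; apply/funext => x; apply: mder_derive1.
exact: (dpart_mder l x cL02 openT sE Logic.I).
Qed.

Lemma dpart_tangent N (E : 'cV[R]_N -> tfield) z l : amfam setT E -> tangent (E z) (dpart l E z).
Proof.
move=> fE; rewrite -(amfam_line_velocity z l fE).
by have := amcurve_velocity 0 (amfam_line z (delta_mx l 0) fE); rewrite scale0r add0r.
Qed.

Lemma dpart_smap Z N (E : 'cV[R]_N -> tfield) z l : smap Z -> amfam setT E ->
  dpart l (fun z => Z (E z)) z = ddir S w Z (E z) (dpart l E z).
Proof.
move=> sZ fE; apply/funext => x.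
have H1 := dpart_mder (z := z) l x cL02 openT (sZ _ _ _ openT fE) Logic.I.
have H2 := ddirE 0 x sZ (amfam_line z (delta_mx l 0) fE).
rewrite (amfam_line_velocity z l fE) scale0r add0r in H2.
exact: mder_uniq H1 H2.
Qed.

(** At a time where the tangent field vanishes, the correction term of
    [ptan_mder] vanishes as well. *)
Lemma tangent_mder0 c v : amcurve c -> scurve S L02 v -> (forall t, tangent (c t) (v t)) ->
  (forall x, v 0 x = 0) -> tangent (c 0) (velocity v 0).
Proof.
move=> cA sv tv v0; apply/tangentE; split.
  have H := scurve_velocity cL02 sv.
  by have := sfam_slice openT H (s := 0) Logic.I; rewrite mxE; apply.
move=> x; have [sx Hx] := ptan_mder (near_all 0 (fun t => tangent_ptan x (tv t)))
  (amcurve_mder 0 x cA) (scurve_mder cL02 0 x sv).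
split => //; move: Hx; rewrite v0 !(mulmx0, mul0mx) addr0 oppr0 => /eqP.
by rewrite addr_eq0 => /eqP.
Qed.

Lemma smap_ddir Z Y : smap Z -> vector_field S w Y -> smap (fun g => ddir S w Z g (Y g)).
Proof.
move=> sZ vY k D p oD fp; have H := sfam_ddir sZ oD fp (vector_field_smap vY oD fp).
by apply: H => s Ds; apply: vY.1; exact: fp.2.
Qed.

(** Along the coordinate line of [l1] the vector field [Y] and the partial
    derivative of [E] in the direction [l2] agree at time 0, so that their
    difference is t V(t) with V smooth and tangent. The first term gives the
    mixed partial derivative of Z(E), the second one a first derivative of [Z]
    in the direction V(0) = [U]. *)
Lemma ddir_ddir Z X Y N (E : 'cV[R]_N -> tfield) l1 l2 g : smap Z ->
  vector_field S w X -> vector_field S w Y -> amfam setT E -> E 0 = g ->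
  dpart l1 E 0 = X g -> dpart l2 E 0 = Y g ->
  let U : tfield := ddir S w Y g (X g) - dpart l1 (dpart l2 E) 0 in
  tangent g U /\ forall x, ddir S w (fun g' => ddir S w Z g' (Y g')) g (X g) x =
     dpart l1 (dpart l2 (fun z => Z (E z))) 0 x + ddir S w Z g U x.
Proof.
move=> sZ vX vY fE E0 E1 E2 U; have [sE EA] := fE.
pose c (t : R) := E (t *: delta_mx l1 0 + 0).
have cA : amcurve c by exact: amfam_line.
have c0 : c 0 = g by rewrite /c scale0r add0r.
have cV : velocity c 0 = X g by rewrite amfam_line_velocity.
have sline F : sfam S L02 setT F -> scurve S L02 (fun t : R => F (t *: delta_mx l1 0 + 0 : 'cV[R]_N)).
  move=> sF; have H := sfam_reparam openT openT (phi := fun s : 'cV[R]_1 => s 0 0 *: delta_mx l1 0 + 0) _ _ sF.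
  apply: H => // j; under eq_fun do rewrite !mxE.
  apply: (smoothD openT); last exact: (smooth_cst openT).
  by apply: (smoothM openT); [exact: (smooth_coord openT)|exact: (smooth_cst openT)].
have sE2 := sfam_dpart l2 cL02 openT sE.
pose F t := dpart l2 E (t *: delta_mx l1 0 + 0).
have sF : scurve S L02 F by exact: sline.
have sY := smap_curve (vector_field_smap vY) cA.
pose d t : tfield := fun x => Y (c t) x - F t x.
have sd : scurve S L02 d := scurveB sY sF.
have td t : tangent (c t) (d t).
  by apply: (tangentB (h := Y (c t)) (k := F t)); [exact: smap_tangent_curve|exact: dpart_tangent].
have d0 x : d 0 x = 0 by rewrite /d /F c0 scale0r add0r E2 subrr.
have dV : velocity d 0 = U.
  apply/funext => x; apply: mder_derive1; apply: mderB.
    by have := ddirE 0 x (vector_field_smap vY) cA; rewrite c0 cV.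
  exact: (dpart_mder l1 x cL02 openT sE2 Logic.I).
have tU : tangent g U by rewrite -dV -c0; exact: tangent_mder0.
split => // x.
pose V := tquot d.
have sV : scurve S L02 V by have H := scurve_tquot cL02 sd d0; exact: H.
have V0 : V 0 = U by apply/funext => y; rewrite /V /tquot eqxx dV.
have dE t : d t = t *: V t.
  apply/funext => y; rewrite -[RHS]/(t *: V t y) /V /tquot.
  by have [->|t0] := eqVneq t 0; [rewrite scale0r d0|rewrite scalerA mulfV// scale1r].
have tV t : tangent (c t) (V t).
  have [->|t0] := eqVneq t 0; first by rewrite V0 c0.
  have -> : V t = t^-1 *: d t by apply/funext => y; rewrite /V /tquot (negPf t0).
  apply: tangentZ; exact: td.
pose k t := ddir S w Z (c t) (V t).
have sk : scurve S L02 k.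
  have H := sfam_ddir sZ openT (amcurve_fam cA) (v := fun s : 'cV[R]_1 => V (s 0 0)) sV.
  by apply: H => s _; exact: tV.
have WE t : ddir S w Z (c t) (Y (c t)) x = (t *: 1%:M) *m k t x +
    dpart l2 (fun z => Z (E z)) (t *: delta_mx l1 0 + 0) x.
  have -> : Y (c t) = t *: V t + F t by rewrite -dE; apply/funext => y; rewrite fctE /d subrK.
  rewrite ddir_linear//; [|by case: cA|exact: dpart_tangent].
  by rewrite dpart_smap// -scalemxAl mul1mx.
have H1 := ddirE 0 x (smap_ddir sZ vY) cA; rewrite c0 cV in H1.
have H2 := dpart_mder (z := 0) l1 x cL02 openT (sfam_dpart l2 cL02 openT (sZ _ _ _ openT fE)) Logic.I.
have H3 := mderD (mderM (mder_scale 1%:M (0 : R)) (scurve_mder cL02 0 x sk)) H2.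
have := mder_uniq H1 (mder_near _ H3) => -> //; last by apply: near_all => t; rewrite WE.
by rewrite mul1mx scale0r mul0mx addr0 addrC /k V0 c0.
Qed.

Lemma dpart_swap (F : 'cV[R]_(1 + 1) -> tfield) x : sfam S L02 setT F ->
  dpart il (dpart ir F) 0 x = dpart ir (dpart il F) 0 x.
Proof.
move=> sF; apply/matrixP => a b; rewrite [LHS]mxE [RHS]mxE.
have sab : smooth_on setT (fun z => F z x a b) by exact: (sfam_pointwise cL02 x openT sF).
have H := Schwarz il ir sab.
transitivity (partial il (partial ir (fun z => F z x a b)) 0).
  by congr (partial il _ 0); apply/funext => z; rewrite [LHS]mxE.
by rewrite H; congr (partial ir _ 0); apply/funext => z; rewrite [RHS]mxE.
Qed.

(** The space of 2-forms is flat: in the formula of [ddir_ddir] mixed partial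
    derivatives are symmetric, both for Z(E) and for [E] itself, and the
    remaining first derivatives assemble to the bracket. *)
Lemma ddir_flat Z X Y g : smap Z -> vector_field S w X -> vector_field S w Y -> AM g ->
  tangent g (bracket S w X Y g) /\
  ddir S w (fun g' => ddir S w Z g' (Y g')) g (X g) - ddir S w (fun g' => ddir S w Z g' (X g')) g (Y g)
  = ddir S w Z g (bracket S w X Y g).
Proof.
move=> sZ vX vY gA; set a := X g; set b := Y g.
have ta : tangent g a by exact: vX.1. have tb : tangent g b by exact: vY.1.
have fE := exp2_amfam gA ta tb; set E := exp2 _ _ _ in fE.
have El h : E (h *: delta_mx il 0 + 0) = gexp g (raise g a) h := exp2_l _ _ _ h.
have Er h : E (h *: delta_mx ir 0 + 0) = gexp g (raise g b) h := exp2_r _ _ _ h.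
have E0 : E 0 = g by have := El 0; rewrite scale0r add0r gexp0.
have E1 : dpart il E 0 = a.
  by rewrite -amfam_line_velocity// (_ : (fun h => _) = gexp g (raise g a)); [case: (tangent_curve gA ta)|exact/funext].
have E2 : dpart ir E 0 = b.
  by rewrite -amfam_line_velocity// (_ : (fun h => _) = gexp g (raise g b)); [case: (tangent_curve gA tb)|exact/funext].
have [t1 D1] := ddir_ddir sZ vX vY fE E0 E1 E2.
have [t2 D2] := ddir_ddir sZ vY vX fE E0 E2 E1.
have BE : bracket S w X Y g = (ddir S w Y g a - dpart il (dpart ir E) 0) - (ddir S w X g b - dpart ir (dpart il E) 0).
  have -> : dpart il (dpart ir E) 0 = dpart ir (dpart il E) 0.
    by apply/funext => x; exact: dpart_swap fE.1.
  by rewrite opprB addrA subrK.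
rewrite BE; split; first exact: (tangentB t1 t2).
rewrite (ddirB sZ gA t1 t2); apply/funext => x.
have -> (f h : tfield) : (f - h) x = f x - h x by [].
have -> (f h : tfield) : (f - h) x = f x - h x by [].
rewrite D1 D2 (dpart_swap x (sZ _ _ _ openT fE)) opprD addrACA subrr add0r.
by [].
Qed.

(** ** The Christoffel form *)

Local Notation G0 := (@levi_civita_Christoffel R m M).

Lemma smap_smooth Z g : smap Z -> AM g -> sfield L02 (Z g).
Proof.
move=> sZ gA; have fg : amfam setT (fun _ : 'cV[R]_1 => g).
  by split=> [|s _]; [have H := sfam_cst openT (AM_smooth gA); exact: H|exact: gA].
by have := sfam_slice openT (sZ _ _ _ openT fg) (s := 0) Logic.I; apply.
Qed.

Lemma sfam_G0 k (D : set 'cV[R]_k) p a b : open D -> amfam D p -> sfam S L02 D a ->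
  sfam S L02 D b -> sfam S L02 D (fun s => G0 (p s) (a s) (b s)).
Proof.
move=> oD [sp pA] sa sb.
have ur s x : D s -> p s x \in unitmx by move=> Ds; exact: AM_unit (pA s Ds).
have ra := sfam_raise oD ur sp sa; have rb := sfam_raise oD ur sp sb.
have H := sfamN oD (sfamZ oD (scfam_cst (S := S) oD 2^-1) (sfamD oD (sfamM oD sa rb) (sfamM oD sb ra))).
exact: H.
Qed.

Lemma smap_G0 Y Z : smap Y -> smap Z -> smap (fun g => G0 g (Y g) (Z g)).
Proof.
by move=> sY sZ k D p oD fp; have H := sfam_G0 oD fp (sY _ _ _ oD fp) (sZ _ _ _ oD fp); exact: H.
Qed.

Lemma smapD Y Z : smap Y -> smap Z -> smap (fun g => Y g + Z g).
Proof.
by move=> sY sZ k D p oD fp; have H := sfamD oD (sY _ _ _ oD fp) (sZ _ _ _ oD fp); exact: H.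
Qed.

Lemma smap_nabla0 Y Z : vector_field S w Y -> smap Z -> smap (nabla S w G0 Y Z).
Proof.
move=> vY sZ; apply: smapD; first exact: smap_ddir.
by apply: smap_G0 sZ; exact: vector_field_smap.
Qed.

Lemma ddirD Y Z g a : smap Y -> smap Z -> AM g -> tangent g a ->
  ddir S w (fun g => Y g + Z g) g a = ddir S w Y g a + ddir S w Z g a.
Proof.
move=> sY sZ gA ta; apply/funext => x.
apply: (mder_uniq (ddir_mder x (smapD sY sZ) gA ta)).
exact: mderD (ddir_mder x sY gA ta) (ddir_mder x sZ gA ta).
Qed.

Lemma nabla0_tangent X Y g : vector_field S w X -> vector_field S w Y -> AM g ->
  tangent g (nabla S w G0 X Y g).
Proof.
move=> vX vY gA; have ta := vX.1 g gA; have [cA c0 cV] := tangent_curve gA ta.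
have sY := vector_field_smap vY.
apply/tangentE; split; first exact: smap_smooth (smap_nabla0 vX sY) gA.
move=> x; set c := gexp _ _ in cA c0 cV.
have := ptan_nabla (symp_skew x) (symp_unit x) (gam := fun t => c t x) (c := fun t => Y (c t) x)
  (near_all 0 (fun t => AM_compat x (cA.2 t)))
  (near_all 0 (fun t => tangent_ptan x (smap_tangent_curve vY cA t))) (amcurve_mder 0 x cA) (ddirE 0 x sY cA).
by rewrite c0 cV.
Qed.

Lemma nabla0_field X Y : vector_field S w X -> vector_field S w Y ->
  vector_field S w (nabla S w G0 X Y).
Proof.
move=> vX vY; apply: vector_fieldP => [g gA|]; first exact: nabla0_tangent.
by apply: smap_nabla0 => //; exact: vector_field_smap.
Qed.

Lemma connection0 : connection S w G0.
Proof.
split.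
- move=> g a a' b r _ _ _ _; apply/funext => x.
  rewrite -[RHS]/(r *: G0 g a b x + G0 g a' b x) /levi_civita_Christoffel /raise.
  by rewrite -[(r *: a + a') x]/(r *: a x + a' x); mxlin.
- move=> g a b b' r _ _ _ _; apply/funext => x.
  rewrite -[RHS]/(r *: G0 g a b x + G0 g a b' x) /levi_civita_Christoffel /raise.
  by rewrite -[(r *: b + b') x]/(r *: b x + b' x); mxlin.
- move=> k D p a b oD sp sa sb H.
  have fp : amfam D p by split=> [|s Ds]; [exact: sp|have [] := H s Ds].
  by have H' := sfam_G0 oD fp sa sb; exact: H'.
exact: nabla0_tangent.
Qed.

Lemma torsion_free0 : torsion_free S w G0.
Proof.
move=> X Y g _ _ _; rewrite /nabla /bracket opprD addrACA.
have -> : G0 g (X g) (Y g) = G0 g (Y g) (X g).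
  by apply/funext => x; rewrite /levi_civita_Christoffel addrC.
by rewrite subrr addr0.
Qed.

(** ** Tangent vectors extend to vector fields *)

Lemma extension g a : AM g -> tangent g a -> exists X, extends S w X g a.
Proof.
move=> gA ta.
exists (fun g' x => 2^-1 *: (a x - (acs w g' x)^T *m a x *m acs w g' x)).
have sw : sfield L02 w by have [] := hw.
split; last by apply/funext => x; exact: ptan_project_id (tangent_ptan x ta).
have sX : smap (fun g' x => 2^-1 *: (a x - (acs w g' x)^T *m a x *m acs w g' x)).
  move=> k D p oD [sp pA]; have sa := sfam_cst oD (tangent_smooth ta).
  have sJ := sfam_raise oD (fun _ x _ => symp_unit x) (sfam_cst oD sw) sp.
  have H := sfamZ oD (scfam_cst (S := S) oD 2^-1) (sfamB oD sa (sfamM oD (sfam_trM oD sa sJ) sJ)).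
  exact: H.
apply: (vector_fieldP _ sX) => g' gA'; apply/tangentE; split; first exact: smap_smooth sX gA'.
move=> x; apply: ptan_project; first exact: AM_compat.
by have [] := tangent_ptan x ta.
Qed.

(** ** Curvature of the Christoffel form *)

(** Differentiating c (c^-1 v) = v avoids the derivative of the inverse. *)
Lemma raise_mder c v t x dv : amcurve c -> scurve S L02 v -> mder (fun s => v s x) t dv ->
  mder (fun s => raise (c s) (v s) x) t
    (invmx (c t x) *m dv - raise (c t) (velocity c t) x *m raise (c t) (v t) x).
Proof.
move=> cA sv mv; have [sc aA] := cA.
have sr : scurve S L11 (fun t x => raise (c t) (v t) x).
  by apply: scurve_raise => // s y; exact: AM_unit.
have mr := scurve_mder cL11 t x sr.
apply: mder_eq (mr); have H := mderM (amcurve_mder t x cA) mr.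
have := mder_uniq (mder_near (near_all t (fun s => raiseK (v s) x (aA s))) H) mv.
move=> HV.
have rV : c t x *m raise (c t) (velocity c t) x = velocity c t x := raiseK (velocity c t) x (aA t).
have ut := AM_unit x (aA t); apply: (can_inj (mulKmx ut)).
by rewrite mulmxBr mulKVmx// mulmxA rV -HV addrAC subrr add0r.
Qed.

Lemma ddir_G0 Y Z g a x : smap Y -> smap Z -> AM g -> tangent g a ->
  let dY := ddir S w Y g a x in let dZ := ddir S w Z g a x in
  let A := raise g a x in let B := raise g (Y g) x in let C := raise g (Z g) x in
  ddir S w (fun g => G0 g (Y g) (Z g)) g a x =
  - (2^-1 *: (dY *m C + Y g x *m (invmx (g x) *m dZ - A *m C)
             + (dZ *m B + Z g x *m (invmx (g x) *m dY - A *m B)))).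
Proof.
move=> sY sZ gA ta dY dZ A B C; have [cA c0 cV] := tangent_curve gA ta.
apply: (mder_uniq (ddir_mder x (smap_G0 sY sZ) gA ta)).
have mY := ddir_mder x sY gA ta; have mZ := ddir_mder x sZ gA ta.
have rY := raise_mder cA (smap_curve sY cA) mY; have rZ := raise_mder cA (smap_curve sZ cA) mZ.
rewrite cV c0 in rY rZ.
have H := mderN (mderZ 2^-1 (mderD (mderM mY rZ) (mderM mZ rY))).
by rewrite c0 in H; exact: H.
Qed.

(** The flat second derivatives cancel against the derivative along the
    bracket, by [ddir_flat]. All first derivatives of the fields cancel as
    well, and an identity between noncommutative monomials in A, B, C remains.
    *)
Lemma curvature0 X Y Z g : vector_field S w X -> vector_field S w Y -> vector_field S w Z -> AM g ->
  curvature S w G0 X Y Z g = fun x => - (4^-1 *: (g x *m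
    commx (commx (raise g (X g) x) (raise g (Y g) x)) (raise g (Z g) x))).
Proof.
move=> vX vY vZ gA; apply/funext => x.
have ta := vX.1 g gA; have tb := vY.1 g gA.
have [sX sY sZ] := And3 (vector_field_smap vX) (vector_field_smap vY) (vector_field_smap vZ).
have [_ /(congr1 (fun f => f x)) F] := ddir_flat sZ vX vY gA.
rewrite -[LHS]/(nabla S w G0 X (nabla S w G0 Y Z) g x - nabla S w G0 Y (nabla S w G0 X Z) g x
  - nabla S w G0 (bracket S w X Y) Z g x).
have N2 V W : vector_field S w V -> smap W -> forall P, tangent g P ->
    ddir S w (nabla S w G0 V W) g P x = ddir S w (fun g => ddir S w W g (V g)) g P x +
      ddir S w (fun g => G0 g (V g) (W g)) g P x.
  move=> vV sW P tP.
  by have := ddirD (smap_ddir sW vV) (smap_G0 (vector_field_smap vV) sW) gA tP => /(congr1 (fun f => f x)).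
have N1 : nabla S w G0 X (nabla S w G0 Y Z) g x =
    ddir S w (nabla S w G0 Y Z) g (X g) x + G0 g (X g) (nabla S w G0 Y Z g) x by [].
have N1' : nabla S w G0 Y (nabla S w G0 X Z) g x =
    ddir S w (nabla S w G0 X Z) g (Y g) x + G0 g (Y g) (nabla S w G0 X Z g) x by [].
have N3 : nabla S w G0 (bracket S w X Y) Z g x =
    ddir S w Z g (bracket S w X Y g) x + G0 g (bracket S w X Y g) (Z g) x by [].
have NB : bracket S w X Y g x = ddir S w Y g (X g) x - ddir S w X g (Y g) x by [].
rewrite N1 N1' N3 (N2 _ _ vY sZ _ ta) (N2 _ _ vX sZ _ tb) (ddir_G0 x sY sZ gA ta) (ddir_G0 x sX sZ gA tb).
have {}F : ddir S w (fun g' => ddir S w Z g' (Y g')) g (X g) x =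
    ddir S w Z g (bracket S w X Y g) x + ddir S w (fun g' => ddir S w Z g' (X g')) g (Y g) x.
  by rewrite -F subrK.
rewrite F {F N1 N1' N3 N2}.
move: (ddir S w Z g (bracket S w X Y g) x) (ddir S w (fun g' => ddir S w Z g' (X g')) g (Y g) x) => DB DD.
have G0E a b : G0 g a b x = - (2^-1 *: (a x *m raise g b x + b x *m raise g a x)) by [].
have NE U V : nabla S w G0 U V g x = ddir S w V g (U g) x + G0 g (U g) (V g) x by [].
rewrite !G0E; have rE h : raise g h x = invmx (g x) *m h x by [].
rewrite (rE (nabla _ _ _ _ _ _)) (rE (nabla _ _ _ X _ _)) (rE (bracket _ _ _ _ _)) !NE !G0E NB.
rewrite -!(raiseK (X g) x gA) -!(raiseK (Y g) x gA) -!(raiseK (Z g) x gA).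
have ug := AM_unit x gA; have gE (h : 'M[R]_m) : h = g x *m (invmx (g x) *m h) by rewrite mulKVmx.
clear NB NE G0E rE.
move: (ddir S w Y g (X g) x) (ddir S w Z g (X g) x) (ddir S w X g (Y g) x) (ddir S w Z g (Y g) x) => y1 z1 x2 z2.
move: (raise g (X g) x) (raise g (Y g) x) (raise g (Z g) x) => A B C.
rewrite (gE y1) (gE z1) (gE x2) (gE z2).
move: (invmx (g x) *m y1) (invmx (g x) *m z1) (invmx (g x) *m x2) (invmx (g x) *m z2) => Y1 Z1 X2 Z2.
rewrite /commx ?(mulmxDl, mulmxDr, mulmxBl, mulmxBr, mulmxN, mulNmx, opprK).
rewrite -?scalemxAl -?scalemxAr -?mulmxA ?(mulKmx ug).
rewrite /commx ?(mulmxDl, mulmxDr, mulmxBl, mulmxBr, mulmxN, mulNmx, opprK).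
rewrite -?scalemxAl -?scalemxAr -?mulmxA ?(mulKmx ug).
mxlin.
Qed.

End Fields.

(** * The Levi-Civita connection *)

Lemma continuous_fst_comp (A B X Y : topologicalType) (phi : A -> B) (f : B * X -> Y) a x :
  {for a, continuous phi} -> {for (phi a, x), continuous f} ->
  {for (a, x), continuous (fun z : A * X => f (phi z.1, z.2))}.
Proof.
move=> cp cf; apply: (cvg_comp (G := nbhs (phi a, x)) _ _ _ cf).
apply: (cvg_pair (G := nbhs (phi a)) (H := nbhs x)); last exact: cvg_snd.
apply: (cvg_comp (G := nbhs a) _ _ _ cp); exact: cvg_fst.
Qed.

Lemma continuous_slice (B X Y : topologicalType) (b : B) (f : B * X -> Y) x :
  {for (b, x), continuous f} -> {for x, continuous (fun y : X => f (b, y))}.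
Proof.
move=> cf; apply: (cvg_comp (G := nbhs (b, x)) _ _ _ cf).
apply: (cvg_pair (G := nbhs b) (H := nbhs x)); last exact: cvg_id.
exact: cvg_cst.
Qed.

Section LeviCivita.
Variables (R : realType) (n : nat) (M : ptopologicalType).
Variable S : closed_manifold R (n + n) M.
Variable w : tfield R (n + n) M.
Variable mu : {measure set (borel M) -> \bar R}.
Hypotheses (hw : symplectic S w) (hmu : is_volume S w mu).
Local Notation m := (n + n)%N.
Local Notation tfield := (tfield R m M).
Local Notation L02 := (L02 S).
Local Notation L11 := (L11 S).
Local Notation AM := (AM S w).
Local Notation tangent := (tangent S w).
Local Notation G0 := (@levi_civita_Christoffel R m M).
Local Notation int f := (Rintegral mu setT (f : borel M -> R)).

Lemma sfield_tr_continuous (E : tfield) : sfield S L11 E -> continuous (fun x : M => \tr (E x)).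
Proof.
move=> sE x; have sE1 : sfam S L11 setT (fun _ : 'cV[R]_1 => E).
  by have H := sfam_cst openT sE; exact: H.
have H : {for (0, x), continuous (fun z : 'cV[R]_1 * M => \tr (E z.2))}.
  by have H := sfam_tr_continuous openT sE1 (s0 := 0) (x0 := x) Logic.I; exact: H.
exact: (continuous_slice H).
Qed.

Lemma sfieldM L (A B : tfield) : sfield S L A -> sfield S L11 B -> sfield S L (fun x => A x *m B x).
Proof.
move=> sA sB; have H := sfamM openT (sfam_cst openT sA) (sfam_cst openT sB).
exact: (sfam_slice openT (H 1%N) (s := 0) Logic.I).
Qed.

Lemma sfieldB L (A B : tfield) : sfield S L A -> sfield S L B -> sfield S L (fun x => A x - B x).
Proof.
move=> sA sB; have H := sfamB openT (sfam_cst openT sA) (sfam_cst openT sB).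
exact: (sfam_slice openT (H 1%N) (s := 0) Logic.I).
Qed.

Lemma trB (A B : 'M[R]_m) : \tr (A - B) = \tr A - \tr B.
Proof. exact: raddfB. Qed.

Lemma trN (A : 'M[R]_m) : \tr (- A) = - \tr A.
Proof. exact: raddfN. Qed.

(** tr ([C, B] A) = tr (C [B, A]), with C = [A, B]. *)
Lemma tr_commx (A B : 'M[R]_m) :
  \tr (commx A B *m commx A B) = - \tr (commx (commx A B) B *m A).
Proof.
rewrite {2}/commx; move: (commx A B) => C; rewrite /commx mulmxBr mulmxBl !trB opprB.
by rewrite -(mulmxA B) (mxtrace_mulC B) -!mulmxA.
Qed.

Lemma tr_anticomm (A J : 'M[R]_m) : A *m J = - (J *m A) -> \tr (A *m (A *m J)) = 0.
Proof.
move=> AJ; have H : \tr (A *m (A *m J)) = - \tr (A *m (A *m J)).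
  by rewrite [LHS]mxtrace_mulC [in LHS]AJ mulNmx trN -mulmxA mxtrace_mulC mulmxA.
by move: (\tr _) H => p H; lra.
Qed.

(** [A, AJ] = 2 A^2 J, and J commutes with A^2. *)
Lemma commx_anticomm (A J : 'M[R]_m) : A *m J = - (J *m A) -> J *m J = - 1%:M ->
  commx A (A *m J) ^+ 2 = - 4 *: A ^+ 4.
Proof.
move=> AJ JJ; have JA : J *m A = - (A *m J) by rewrite AJ opprK.
have -> : commx A (A *m J) = 2 *: (A *m A *m J).
  by rewrite /commx -(mulmxA A J) JA mulmxN opprK !mulmxA scaler_nat mulr2n.
rewrite expr2 -mulmxE -scalemxAl -scalemxAr scalerA.
have -> : A *m A *m J *m (A *m A *m J) = - (A ^+ 4).
  rewrite -!mulmxA (mulmxA J) JA mulNmx -(mulmxA A J) (mulmxA J) JA !mulNmx !mulmxN opprK -!mulmxA JJ !mulmxN mulmx1.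
  by rewrite !exprS expr0 mulr1 -!mulmxE.
by rewrite scalerN scaleNr; congr (- (_ *: _)); ring.
Qed.

Lemma innerE (g a b : tfield) : inner mu g a b = int (fun x => \tr (raise g a x *m raise g b x)).
Proof. by []. Qed.

Lemma tr_integrable (E : tfield) : sfield S L11 E ->
  mu.-integrable setT (EFin \o (fun x : borel M => \tr (E x))).
Proof. by move=> sE; apply: (continuous_integrable hw hmu); exact: sfield_tr_continuous. Qed.

Lemma inner_integrable g a b : AM g -> sfield S L02 a -> sfield S L02 b ->
  mu.-integrable setT (EFin \o (fun x : borel M => \tr (raise g a x *m raise g b x))).
Proof.
by move=> gA sa sb; apply: tr_integrable; apply: sfieldM; [have H := raise_smooth hw gA sa|have H := raise_smooth hw gA sb]; exact: H.
Qed.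

Lemma innerC (g a b : tfield) : inner mu g a b = inner mu g b a.
Proof. by rewrite !innerE; congr Rintegral; apply/funext => x; exact: mxtrace_mulC. Qed.

Lemma innerDl g a b c : AM g -> sfield S L02 a -> sfield S L02 b -> sfield S L02 c ->
  inner mu g (a + b) c = inner mu g a c + inner mu g b c.
Proof.
move=> gA sa sb sc; rewrite !innerE -RintegralD//; [|exact: inner_integrable|exact: inner_integrable].
congr Rintegral; apply/funext => x; rewrite -mxtraceD -mulmxDl; congr (\tr (_ *m _)).
by rewrite /raise -mulmxDr.
Qed.

Lemma inner_self_eq0 g a : AM g -> tangent g a -> inner mu g a a = 0 -> a = 0.
Proof.
move=> gA ta; rewrite innerE => H; have sa := tangent_smooth ta.
have c0 := sfield_tr_continuous (sfieldM (raise_smooth hw gA sa) (raise_smooth hw gA sa)).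
apply/funext => x; have [sg pg _] := AM_compat hw x gA; have [syx _] := tangent_ptan x ta.
apply: (tr_raise_sq_eq0 sg pg syx).
apply: (integral_eq0 hw hmu c0 _ H) => y.
have [sgy pgy _] := AM_compat hw y gA; have [sy _] := tangent_ptan y ta.
exact: tr_raise_sq_ge0.
Qed.

(** Differentiation under the integral: the manifold is compact, so the
    difference quotients converge uniformly. *)
Lemma is_derive_int_tr (E : R -> tfield) : scurve S L11 E ->
  is_derive (0 : R) (1 : R) (fun t : R => int (fun x => \tr (E t x))) (int (fun x => \tr (velocity E 0 x))).
Proof.
move=> sE; have sV := scurve_velocity (@L11_centered _ _ _ S) sE.
have sl (F : R -> tfield) t : scurve S L11 F -> sfield S L11 (F t).
  move=> sF; have := sfam_slice openT sF (s := t%:M) Logic.I.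
  by rewrite scal00; apply.
apply: (is_derive_Rintegral measurableT (volume_finite hw hmu)).
- by apply: near_all => t; apply: tr_integrable; exact: sl.
- by apply: tr_integrable; exact: sl.
have := unif_quotient (f := fun t (x : M) => \tr (E t x)) (df := fun t (x : M) => \tr (velocity E t x)) (t := 0) (man_compact S).
apply.
  apply: near_all => t x _; exact: mder_tr (scurve_mder (@L11_centered _ _ _ S) t x sE).
move=> x _; have H := sfam_tr_continuous openT sV (s0 := 0) (x0 := x) Logic.I.
have cphi : {for (0 : R), continuous (fun t : R => t%:M : 'cV[R]_1)}.
  apply/continuous_mxP => i j; rewrite (ord1 i) (ord1 j).
  by under [X in {for _, continuous X}]eq_fun do rewrite scal00; exact: cvg_id.
pose f (z : 'cV[R]_1 * M) := \tr (velocity E (z.1 0 0) z.2).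
have e0 : (0 : R)%:M = 0 :> 'cV[R]_1 by rewrite raddf0.
have E2 : (fun z : R * M => f (z.1%:M, z.2)) = (fun z => \tr (velocity E z.1 z.2)).
  by apply/funext => z; congr (\tr (velocity E _ z.2)); exact: scal00.
have := @continuous_fst_comp _ _ _ _ (fun t : R => t%:M : 'cV[R]_1) f 0 x cphi; rewrite e0 E2 => H2.
exact: (H2 H).
Qed.

(** The Christoffel terms are what the derivatives of the two inverse metrics
    in tr (g^-1 b g^-1 c) leave after the derivatives of the fields are
    accounted for. *)
Lemma metric_compatible0 : metric_compatible S w mu G0.
Proof.
move=> X Y Z g vX vY vZ gA; have ta := vX.1 g gA.
have tY := vY.1 g gA; have tZ := vZ.1 g gA.
have [sX sY sZ] := And3 (vector_field_smap vX) (vector_field_smap vY) (vector_field_smap vZ).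
have [cA c0 cV] := along_spec hw gA ta; set c := along S w g (X g) in cA c0 cV.
have uc t x := AM_unit hw x (cA.2 t).
pose B t : tfield := fun x => raise (c t) (Y (c t)) x.
pose C t : tfield := fun x => raise (c t) (Z (c t)) x.
have sB : scurve S L11 B by have H := scurve_raise uc cA.1 (smap_curve sY cA); exact: H.
have sC : scurve S L11 C by have H := scurve_raise uc cA.1 (smap_curve sZ cA); exact: H.
have sE : scurve S L11 (fun t x => B t x *m C t x) by have H := scurveM sB sC; exact: H.
have st h : tangent g h -> sfield S L02 h by move=> th; have H := tangent_smooth th; exact: H.
have D := is_derive_int_tr sE.
rewrite /ddirR -/c derive1E.
have -> : 'D_1 (fun t => inner mu (c t) (Y (c t)) (Z (c t))) 0 = int (fun x => \tr (velocity (fun t x => B t x *m C t x) 0 x)).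
  exact: (@derive_val _ _ _ _ _ _ _ D).
have nY := nabla0_tangent hw vX vY gA; have nZ := nabla0_tangent hw vX vZ gA.
rewrite !innerE -RintegralD//; [|exact: inner_integrable gA (st _ nY) (st _ tZ)|exact: inner_integrable gA (st _ tY) (st _ nZ)].
congr Rintegral; apply/funext => x.
have mY := ddirE hw 0 x sY cA; have mZ := ddirE hw 0 x sZ cA.
have rY := raise_mder hw cA (smap_curve sY cA) mY; have rZ := raise_mder hw cA (smap_curve sZ cA) mZ.
have mE := scurve_mder (@L11_centered _ _ _ S) 0 x sE.
rewrite (mder_uniq mE (mderM rY rZ)) /B /C cV c0.
have G0E a b : G0 g a b x = - (2^-1 *: (a x *m raise g b x + b x *m raise g a x)) by [].
have rE h : raise g h x = invmx (g x) *m h x by [].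
have NE U V : nabla S w G0 U V g x = ddir S w V g (U g) x + G0 g (U g) (V g) x by [].
rewrite (rE (nabla S w G0 X Y g)) (rE (nabla S w G0 X Z g)) !NE !G0E.
rewrite -!(raiseK hw (X g) x gA) -!(raiseK hw (Y g) x gA) -!(raiseK hw (Z g) x gA).
clear NE G0E rE mE rY rZ mY mZ D.
move: (ddir S w Y g (X g) x) (ddir S w Z g (X g) x) (raise g (X g) x) (raise g (Y g) x) (raise g (Z g) x).
move=> y1 z1 A B0 C0; have ug := AM_unit hw x gA.
have k h : invmx (g x) *m (g x *m h) = h by rewrite mulKmx.
rewrite !(mulmxDl, mulmxDr, mulmxBl, mulmxBr, mulmxN, mulNmx, opprK).
rewrite -?scalemxAl -?scalemxAr -?mulmxA ?k.
rewrite ?(mulmxDl, mulmxDr, mulmxBl, mulmxBr, mulmxN, mulNmx, opprK).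
rewrite -?scalemxAl -?scalemxAr -?mulmxA ?k.
have tr3 : \tr (B0 *m (C0 *m A)) = \tr (A *m (B0 *m C0)) by rewrite mulmxA mxtrace_mulC.
rewrite ?mulmxDl -?mulmxA !(mxtraceD, trN, mxtraceZ) tr3; lra.
Qed.

(** The difference of two Levi-Civita Christoffel forms is symmetric in its
    two arguments, and its inner product with a third one is skew in the last
    two; a trilinear form with both symmetries is zero. As the difference is
    tangent, it may be paired with itself. *)
Lemma christoffel_unique G : levi_civita S w mu G -> forall g a b, AM g ->
  tangent g a -> tangent g b -> G g a b = G0 g a b.
Proof.
move=> [cG tG mG] g a b gA ta tb.
have cG0 := connection0 hw; have tG0 : torsion_free S w G0 by exact: torsion_free0.
have mG0 : metric_compatible S w mu G0 by exact: metric_compatible0.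
pose D a b := G g a b - G0 g a b.
have st h : tangent g h -> sfield S L02 h by move=> th; have H := tangent_smooth th; exact: H.
have tD a' b' : tangent g a' -> tangent g b' -> tangent g (D a' b').
  move=> ta' tb'; have [X [vX Xg]] := extension hw gA ta'; have [Y [vY Yg]] := extension hw gA tb'.
  have [_ _ _ H] := cG; have [_ _ _ H0] := cG0.
  have := tangentB (H X Y g vX vY gA) (H0 X Y g vX vY gA).
  by rewrite /nabla Xg Yg opprD addrACA subrr add0r.
have symD a' b' : tangent g a' -> tangent g b' -> D a' b' = D b' a'.
  move=> ta' tb'; have [X [vX Xg]] := extension hw gA ta'; have [Y [vY Yg]] := extension hw gA tb'.
  have H := tG X Y g vX vY gA; rewrite -(tG0 X Y g vX vY gA) /nabla Xg Yg in H.
  apply/funext => x; have := congr1 (fun f => f x) H.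
  rewrite -[LHS]/(ddir S w Y g a' x + G g a' b' x - (ddir S w X g b' x + G g b' a' x)).
  rewrite -[RHS]/(ddir S w Y g a' x + G0 g a' b' x - (ddir S w X g b' x + G0 g b' a' x)).
  rewrite -[D a' b' x]/(G g a' b' x - G0 g a' b' x) -[D b' a' x]/(G g b' a' x - G0 g b' a' x).
  move: (ddir S w Y g a' x) (ddir S w X g b' x) (G g a' b' x) (G g b' a' x) (G0 g a' b' x) (G0 g b' a' x).
  move=> p q r s r0 s0 E; apply/matrixP => i j; have := congr1 (fun F : 'M[R]_m => F i j) E.
  by rewrite !mxE; lra.
have skewD a' b' c' : tangent g a' -> tangent g b' -> tangent g c' ->
    inner mu g (D a' b') c' = - inner mu g (D a' c') b'.
  move=> ta' tb' tc'; have [X [vX Xg]] := extension hw gA ta'; have [Y [vY Yg]] := extension hw gA tb'.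
  have [Z [vZ Zg]] := extension hw gA tc'.
  have H := mG X Y Z g vX vY vZ gA; rewrite (mG0 X Y Z g vX vY vZ gA) in H.
  have nE U V : nabla S w G U V g = nabla S w G0 U V g + D (U g) (V g).
    by rewrite /nabla /D -addrA [G0 g _ _ + _]addrC subrK.
  move: H; rewrite !nE (innerC g (Y g) (nabla _ _ _ _ _ _)) (innerC g (Y g) (_ + _)).
  have tn := nabla0_tangent hw vX vY gA; have tn' := nabla0_tangent hw vX vZ gA.
  have tY := vY.1 g gA; have tZ := vZ.1 g gA; have tX := vX.1 g gA.
  rewrite (innerDl gA (st _ tn) (st _ (tD _ _ tX tY)) (st _ tZ)).
  rewrite (innerDl gA (st _ tn') (st _ (tD _ _ tX tZ)) (st _ tY)) Xg Yg Zg.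
  move: (inner _ _ _ _) (inner _ _ _ _) (inner _ _ (D _ _) _) (inner _ _ (D _ _) _) => p q r s; lra.
(* three exchanges of each kind bring the trilinear form to its opposite *)
have D0 c' : tangent g c' -> inner mu g (D a b) c' = 0.
  move=> tc'; have := skewD a b c' ta tb tc'; rewrite (symD a c' ta tc').
  rewrite (skewD c' a b tc' ta tb) (symD c' b tc' tb) (skewD b c' a tb tc' ta).
  rewrite (symD b a tb ta) !opprK; move: (inner _ _ _ _) => p; lra.
have := inner_self_eq0 gA (tD a b ta tb) (D0 _ (tD a b ta tb)).
by move/eqP; rewrite subr_eq0 => /eqP.
Qed.

(** ** Curvature *)

Section Unique.
Variable G : Christoffel R m M.
Hypothesis hG : levi_civita S w mu G.

Lemma nabla_unique X Y g : vector_field S w X -> vector_field S w Y -> AM g ->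
  nabla S w G X Y g = nabla S w G0 X Y g.
Proof.
by move=> vX vY gA; rewrite /nabla (christoffel_unique hG gA (vX.1 g gA) (vY.1 g gA)).
Qed.

Lemma ddir_ext Z Z' g a : (forall g', AM g' -> Z g' = Z' g') -> AM g -> tangent g a ->
  ddir S w Z g a = ddir S w Z' g a.
Proof.
move=> ZZ gA ta; have [cA _ _] := along_spec hw gA ta.
by rewrite /ddir; congr (velocity _ 0); apply/funext => t; rewrite ZZ//; exact: cA.2.
Qed.

(** Off the tangent spaces, the values of a Christoffel form do not enter the
    curvature: derivatives are taken along curves of associated metrics, and
    all vectors involved are tangent, the bracket included. *)
Lemma curvature_unique X Y Z g : vector_field S w X -> vector_field S w Y -> vector_field S w Z -> AM g ->
  curvature S w G X Y Z g = curvature S w G0 X Y Z g.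
Proof.
move=> vX vY vZ gA.
have N U V : vector_field S w U -> vector_field S w V ->
    nabla S w G U (nabla S w G V Z) g = nabla S w G0 U (nabla S w G0 V Z) g.
  move=> vU vV; rewrite -(nabla_unique vU (nabla0_field hw vV vZ) gA) /nabla.
  rewrite (ddir_ext _ gA (vU.1 g gA) (Z' := nabla S w G0 V Z)); last by move=> g' gA'; exact: nabla_unique.
  by congr (_ + G g _ _); exact: nabla_unique.
have [tB _] := ddir_flat hw (vector_field_smap vZ) vX vY gA.
have NB : nabla S w G (bracket S w X Y) Z g = nabla S w G0 (bracket S w X Y) Z g.
  by rewrite /nabla (christoffel_unique hG gA tB (vZ.1 g gA)).
by rewrite -[LHS]/(nabla S w G X (nabla S w G Y Z) g - nabla S w G Y (nabla S w G X Z) g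
  - nabla S w G (bracket S w X Y) Z g) (N X Y vX vY) (N Y X vY vX) NB.
Qed.

Lemma curvatureE g a b c : AM g -> tangent g a -> tangent g b -> tangent g c ->
  is_curvature S w G g a b c (fun x => - (4^-1 *: (g x *m
    commx (commx (raise g a x) (raise g b x)) (raise g c x)))).
Proof.
move=> gA ta tb tc; split.
  have [X eX] := extension hw gA ta; have [Y eY] := extension hw gA tb.
  by have [Z eZ] := extension hw gA tc; exists X, Y, Z.
move=> X Y Z [vX Xg] [vY Yg] [vZ Zg].
by rewrite (curvature_unique vX vY vZ gA) (curvature0 hw vX vY vZ gA) Xg Yg Zg.
Qed.

Lemma sectional_curvatureE g a b : AM g -> tangent g a -> tangent g b -> orthonormal_pair mu g a b ->
  is_sectional_curvature S w mu G g a b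
    (4^-1 * int (fun x => \tr (commx (raise g a x) (raise g b x) ^+ 2))).
Proof.
move=> gA ta tb on; split => //.
exists (fun x => - (4^-1 *: (g x *m commx (commx (raise g a x) (raise g b x)) (raise g b x)))).
  exact: curvatureE.
have sA : sfield S L11 (raise g a) by have H := raise_smooth hw gA (tangent_smooth ta); exact: H.
have sB : sfield S L11 (raise g b) by have H := raise_smooth hw gA (tangent_smooth tb); exact: H.
have sC : sfield S L11 (fun x => commx (raise g a x) (raise g b x)).
  exact: sfieldB (sfieldM sA sB) (sfieldM sB sA).
rewrite -RintegralZl//; last first.
  by have H := tr_integrable (sfieldM sC sC); exact: H.
rewrite innerE; congr Rintegral; apply/funext => x; rewrite expr2 -mulmxE.
set C := commx (raise g a x) (raise g b x).
have -> : raise g (fun x => - (4^-1 *: (g x *m commx (commx (raise g a x) (raise g b x)) (raise g b x)))) x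
    = - (4^-1 *: commx C (raise g b x)).
  by rewrite /raise mulmxN -scalemxAr mulKmx// (AM_unit hw).
rewrite mulNmx -scalemxAl raddfN /= mxtraceZ; rewrite -mulrN; congr (_ * _).
exact: tr_commx.
Qed.

Lemma bfJ_raise g a x : AM g -> raise g (bfJ w g a) x = raise g a x *m acs w g x.
Proof. by move=> gA; rewrite /raise /bfJ mulmxA. Qed.

Lemma acs_sq g x : AM g -> acs w g x *m acs w g x = - 1%:M.
Proof. by move=> /(AM_compat hw x)[]. Qed.

Lemma raise_acs g a x : AM g -> tangent g a -> raise g a x *m acs w g x = - (acs w g x *m raise g a x).
Proof. by move=> gA ta; have [] := tangent_pact hw x gA ta. Qed.

(** AJ is symmetric for [g] and anticommutes with J because A does. *)
Lemma bfJ_tangent g a : AM g -> tangent g a -> tangent g (bfJ w g a).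
Proof.
move=> gA ta; have sa : sfield S L02 a by have H := tangent_smooth ta; exact: H.
have sw : sfield S L02 w by have [] := hw.
have sJ : sfield S L11 (acs w g).
  have H := sfam_raise openT (fun _ x _ => symp_unit hw x) (sfam_cst openT sw) (sfam_cst openT (AM_smooth hw gA)).
  exact: (sfam_slice openT (H 1%N) (s := 0) Logic.I).
apply/tangentE; split; first exact: sfieldM sa sJ.
move=> x; have -> : bfJ w g a x = g x *m (raise g a x *m acs w g x) by rewrite mulmxA (raiseK hw).
apply: (pact_ptan (symp_skew hw x) (symp_unit hw x) (AM_compat hw x gA)).
have [sA JA] := tangent_pact hw x gA ta; have JJ := acs_sq x gA.
have [sg _ _] := AM_compat hw x gA; have KT := compat_skew (symp_skew hw x) (symp_unit hw x) (AM_compat hw x gA).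
move: sA JA JJ KT; rewrite /pact -/(acs w g x); move: (raise g a x) (acs w g x) => A J sA JA JJ KT; split.
  by rewrite mulmxA trmx_mul sA mulmxA KT mulNmx -!mulmxA JA mulmxN.
by rewrite -mulmxA JJ mulmxN mulmx1 mulmxA -[J *m A]opprK -JA mulNmx -mulmxA JJ mulmxN mulmx1 opprK.
Qed.

Lemma bfJ_orthonormal g a : AM g -> tangent g a -> inner mu g a a = 1 ->
  orthonormal_pair mu g a (bfJ w g a).
Proof.
move=> gA ta a1; split => //.
  rewrite -a1 !innerE; congr Rintegral; apply/funext => x; rewrite bfJ_raise//.
  rewrite -mulmxA (mulmxA (acs w g x)) -[acs w g x *m raise g a x]opprK -raise_acs//.
  by rewrite mulNmx -(mulmxA (raise g a x)) acs_sq// !mulmxN mulmx1 opprK.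
rewrite innerE (_ : (fun x => _) = cst 0).
  by rewrite Rintegral_cst// mul0r.
apply/funext => x; rewrite bfJ_raise//.
by apply: tr_anticomm; exact: raise_acs.
Qed.

Lemma holomorphic_curvatureE g a : AM g -> tangent g a -> inner mu g a a = 1 ->
  is_sectional_curvature S w mu G g a (bfJ w g a) (- int (fun x => \tr (raise g a x ^+ 4))).
Proof.
move=> gA ta a1.
have := sectional_curvatureE gA ta (bfJ_tangent gA ta) (bfJ_orthonormal gA ta a1).
have sA : sfield S L11 (raise g a) by have H := raise_smooth hw gA (tangent_smooth ta); exact: H.
have E4 : mu.-integrable setT (EFin \o (fun x : borel M => \tr (raise g a x ^+ 4))).
  have := tr_integrable (sfieldM (sfieldM (sfieldM sA sA) sA) sA).
  by under eq_fun do rewrite !mulmxE -expr2 -!exprSr.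
congr (is_sectional_curvature _ _ _ _ _ _ _ _).
have -> : (fun x => \tr (commx (raise g a x) (raise g (bfJ w g a) x) ^+ 2)) = (fun x => - 4 * \tr (raise g a x ^+ 4)).
  apply/funext => x; rewrite bfJ_raise// commx_anticomm ?mxtraceZ//; first exact: raise_acs.
  exact: acs_sq.
by rewrite (RintegralZl _ measurableT E4); field.
Qed.

(** ** Geodesics *)

(** The calculus of curves defined on an open set of times. *)
Lemma interval_curve L (I : set R) c : centered S L -> open I ->
  sfam S L [set s : 'cV[R]_1 | I (s 0 0)] (fun s => c (s 0 0)) ->
  (forall t x, I t -> mder (fun s => c s x) t (velocity c t x)) /\
  sfam S L [set s : 'cV[R]_1 | I (s 0 0)] (fun s => velocity c (s 0 0)).
Proof.
move=> cL oI sc; set D := [set s : 'cV[R]_1 | _] in sc *.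
have oD : open D.
  rewrite openE => s Is; have cs : {for s, continuous (fun s : 'cV[R]_1 => s 0 0)} by exact: coord_continuous.
  by apply: cs; exact: open_nbhs_in.
have mc t x : I t -> mder (fun s => c s x) t (dpart 0 (fun s : 'cV[R]_1 => c (s 0 0)) t%:M x).
  move=> It; have Dt : D t%:M by rewrite /D /= scal00.
  have H := msmooth_mder Dt (sfam_pointwise cL x oD sc).
  by apply: mder_near H; apply: near_all => s; rewrite scal00.
have vc t x : I t -> velocity c t x = dpart 0 (fun s : 'cV[R]_1 => c (s 0 0)) t%:M x.
  by move=> It; exact: mder_derive1 (mc t x It).
split=> [t x It|]; first by rewrite vc//; exact: mc.
apply: (sfam_ext oD _ (sfam_dpart 0 cL oD sc)) => s x Ds.
by rewrite vc ?scal11.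
Qed.

Lemma geodesic_exp g a : AM g -> tangent g a ->
  [/\ geodesic S w G setT (gexp g (raise g a)), gexp g (raise g a) 0 = g & velocity (gexp g (raise g a)) 0 = a].
Proof.
move=> gA ta; have [cA c0 cV] := tangent_curve hw gA ta; split=> //; split; first exact/amcurveE.
move=> t _; set c := gexp _ _ in cA c0 cV *.
have tv := amcurve_velocity hw t cA.
rewrite (christoffel_unique hG (cA.2 t) tv tv); apply/funext => x.
have uc := AM_unit hw x (cA.2 t).
have V s y : velocity c s y = c s y *m raise g a y by rewrite /c gexp_velocity.
have VV : velocity (velocity c) t x = c t x *m raise g a x *m raise g a x.
  apply: mder_derive1; have H := mderMr (raise g a x) (gexp_mder g (raise g a) t x).
  by apply: mder_near H; apply: near_all => s; rewrite V.
rewrite -[LHS]/(velocity (velocity c) t x - 2^-1 *: (velocity c t x *m raise (c t) (velocity c t) x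
  + velocity c t x *m raise (c t) (velocity c t) x)) -[RHS]/(0 : 'M[R]_m) VV.
have -> : raise (c t) (velocity c t) x = raise g a x by rewrite /raise -/(raise g a x) V mulKmx.
rewrite V; move: (_ *m _) => E; apply/matrixP => i j; rewrite !mxE; lra.
Qed.

(** The geodesic equation says c'' = c' c^-1 c', so c^-1 c' has zero
    derivative. It is thus the constant A = g^-1 a; then c' = cA, and c
    e^(-tA) has zero derivative. *)
Lemma geodesic_unique g a (I : set R) gam : AM g -> tangent g a -> open I -> is_interval I -> I 0 ->
  geodesic S w G I gam -> gam 0 = g -> velocity gam 0 = a -> forall t, I t -> gam t = gexp g (raise g a) t.
Proof.
move=> gA ta oI itI I0 [[sc cA] geo] g0 ga.
have [mc sv] := interval_curve (@L02_centered _ _ _ S) oI sc.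
have [mv _] := interval_curve (@L02_centered _ _ _ S) oI sv.
have oD : open [set s : 'cV[R]_1 | I (s 0 0)].
  rewrite openE => s Is; have cs : {for s, continuous (fun s : 'cV[R]_1 => s 0 0)} by exact: coord_continuous.
  by apply: cs; exact: open_nbhs_in.
have tv t : I t -> tangent (gam t) (velocity gam t).
  move=> It; apply/tangentE; split.
    have H := sfam_slice oD sv (s := t%:M); rewrite /= scal00 in H; exact: H.
  move=> x; have nI : \forall s \near t, I s by exact: open_nbhs_in.
  have nc : \near t, compat (w x) (gam t x) by apply: filterS nI => s Is; have H := AM_compat hw x (cA s Is); exact: H.
  exact: (compat_mder (symp_skew hw x) (symp_unit hw x) nc (mc t x It)).
pose P t : tfield := fun x => raise (gam t) (velocity gam t) x.
have sP : sfam S L11 [set s : 'cV[R]_1 | I (s 0 0)] (fun s => P (s 0 0)).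
  have H := sfam_raise oD (fun s x (Ds : I (s 0 0)) => AM_unit hw x (cA _ Ds)) sc sv; exact: H.
have [mP _] := interval_curve (@L11_centered _ _ _ S) oI sP.
have P0 t x : I t -> mder (fun s => P s x) t 0.
  move=> It; have uc := AM_unit hw x (cA t It).
  apply: mder_eq (mP t x It); apply: (can_inj (mulKmx uc)); rewrite mulmx0.
  have nI : \forall s \near t, I s by exact: open_nbhs_in.
  have nP : \near t, gam t x *m P t x = velocity gam t x.
    by apply: filterS nI => s Is; have H := raiseK hw (velocity gam s) x (cA s Is); exact: H.
  have E := mder_uniq (mder_near nP (mderM (mc t x It) (mP t x It))) (mv t x It).
  have := congr1 (fun f => f x) (geo t It); rewrite (christoffel_unique hG (cA t It) (tv t It) (tv t It)).
  rewrite -[LHS]/(velocity (velocity gam) t x - 2^-1 *: (velocity gam t x *m P t x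
    + velocity gam t x *m P t x)) -[RHS]/(0 : 'M[R]_m) -E.
  move: (velocity gam t x *m P t x) (gam t x *m velocity P t x) => p q H.
  by apply/matrixP => i j; have := congr1 (fun F : 'M[R]_m => F i j) H; rewrite !mxE; lra.
have PA t x : I t -> P t x = raise g a x.
  move=> It; rewrite (mder0_cst itI (fun s Is => P0 s x Is) It I0).
  by rewrite /P g0 ga.
move=> t It; apply/funext => x; set A := raise g a x.
have Q0 s : I s -> mder (fun s => gam s x *m expm (s *: - A)) s 0.
  move=> Is; apply: mder_eq (mderM (mc s x Is) (mder_expm_scale (- A) s)).
  have -> : velocity gam s x = gam s x *m A by rewrite /A -(PA s x Is) /P (raiseK hw)//; exact: cA.
  by rewrite -expm_comm mulNmx mulmxN -mulmxA subrr.
have := mder0_cst itI Q0 It I0; rewrite scale0r expm0 mulmx1 g0 => /(congr1 (mulmx^~ (expm (t *: A)))) /=.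
have -> : t *: A = - (t *: - A) by rewrite scalerN opprK.
by rewrite -mulmxA expmN mulmx1 /gexp scalerN opprK.
Qed.

End Unique.

Lemma levi_civita0 : levi_civita S w mu G0.
Proof. by split; [exact: connection0|exact: torsion_free0|exact: metric_compatible0]. Qed.

End LeviCivita.

Unset Implicit Arguments.

Theorem theorem5p2 (R : realType) (n : nat) (M : ptopologicalType)
    (S : closed_manifold R (n + n) M) (w : tfield R (n + n) M)
    (mu : {measure set (borel M) -> \bar R})
    (hw : symplectic S w) (hmu : is_volume S w mu) :
  levi_civita S w mu (@levi_civita_Christoffel R (n + n) M) /\
  forall G : Christoffel R (n + n) M, levi_civita S w mu G ->
  [/\ (* 1 *)
      (forall g a b c : tfield R (n + n) M, AM S w g ->
         tangent S w g a -> tangent S w g b -> tangent S w g c ->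
         is_curvature S w G g a b c
           (fun x => - (4^-1 *: (g x *m
              commx (commx (raise g a x) (raise g b x)) (raise g c x))))),
      (* 2 *)
      (forall g a b : tfield R (n + n) M, AM S w g ->
         tangent S w g a -> tangent S w g b -> orthonormal_pair mu g a b ->
         is_sectional_curvature S w mu G g a b
           (4^-1 * fine (\int[mu]_x
              (\tr (commx (raise g a x) (raise g b x) ^+ 2))%:E)%E)),
      (forall g a : tfield R (n + n) M, AM S w g ->
         tangent S w g a -> inner mu g a a = 1 ->
         is_sectional_curvature S w mu G g a (bfJ w g a)
           (- fine (\int[mu]_x (\tr (raise g a x ^+ 4))%:E)%E)) &
      (* 3 *)
      (forall g a : tfield R (n + n) M, AM S w g -> tangent S w g a ->
         let gt := fun (t : R) x => g x *m expm (t *: raise g a x) in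
         [/\ geodesic S w G setT gt, gt 0 = g, velocity gt 0 = a &
             forall (I : set R) (gam : R -> tfield R (n + n) M),
               open I -> is_interval I -> I 0 ->
               geodesic S w G I gam -> gam 0 = g -> velocity gam 0 = a ->
               forall t, I t -> gam t = gt t])].
Proof.
split; first exact: (levi_civita0 hw hmu).
move=> G hG; split.
- by move=> g a b c gA ta tb tc; exact: (curvatureE hw hmu hG gA ta tb tc).
- by move=> g a b; exact: sectional_curvatureE.
- by move=> g a; exact: holomorphic_curvatureE.
move=> g a gA ta gt; have [H1 H2 H3] := geodesic_exp hw hmu hG gA ta.
by split=> // I gam oI itI I0; exact: (geodesic_unique hw hmu hG gA ta oI itI I0).
Qed.
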